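(* Let $m\in H^\infty$ be inner, $H=H^2\ominus mH^2$ with $\dim H\ge2$, and $T=P_HS|_H$ (so $m=m_T$ is the minimal/characteristic function of $T$). Suppose: (A) $m(\lambda)\not\equiv m(-\lambda)$ on $\mathbb D$; (B) for every $\lambda_0\in\mathbb D$ with $m(\lambda_0)=0$, the function $m_{\lambda_0}(\lambda)=m(\lambda)\Big/\dfrac{\lambda-\lambda_0}{1-\bar\lambda_0\lambda}$ satisfies $m_{\lambda_0}(\lambda)\not\equiv m_{\lambda_0}(-\lambda)$; (C) there exists a nonconstant inner divisor $p\in H^\infty$ of $m$ with $p(\lambda)=p(-\lambda)$ for all $\lambda\in\mathbb D$. Then (D) $T^2$ is irreducible, and (E) $\mathrm{Lat}\{T^2\}\ne\mathrm{Lat}\{T^2\}'$.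
   Context: $S$ is the unilateral shift $(Sh)(z)=zh(z)$ on the Hardy space $H^2$ of the unit disc $\mathbb D$; $P_H$ is the orthogonal projection onto $H$. Irreducible means having no closed subspace other than $\{0\}$ and the whole space invariant under both the operator and its adjoint. $\mathrm{Lat}\{X\}$ is the lattice of closed invariant subspaces of $X$; $\mathrm{Lat}\{X\}'$ is the lattice of hyperinvariant subspaces (closed subspaces invariant under every operator commuting with $X$). *)

(* Defs.v *)
From HB Require Import structures.
From mathcomp Require Import all_boot all_order all_algebra.
From mathcomp Require Import all_classical all_reals all_analysis.
From mathcomp Require Import complex.
Import Order.TTheory GRing.Theory Num.Theory.
Import numFieldTopology.Exports numFieldNormedType.Exports.

Set Implicit Arguments.
Unset Strict Implicit.
Unset Printing Implicit Defensive.

(** complex numbers as a normed field over themselves (topology, limits,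
    complex differentiability) *)
Set Warnings "-redundant-canonical-projection".
HB.instance Definition _ (R : rcfType) := PseudoPointedMetric.copy R[i] (R[i])^o.
HB.instance Definition _ (R : rcfType) := GRing.ComAlgebra.copy R[i] (R[i])^o.
HB.instance Definition _ (R : rcfType) := Vector.copy R[i] (R[i])^o.
HB.instance Definition _ (R : rcfType) := NormedModule.copy R[i] (R[i])^o.

Local Open Scope classical_set_scope.
Local Open Scope ring_scope.
Local Open Scope complex_scope.

Notation normc := (@ComplexField.Normc.normc _).

Section Hardy.
Variable R : realType.

(** Sequences of complex numbers: Taylor coefficients of elements of H^2. *)
Definition cseq := nat -> R[i].

Definition zero_seq : cseq := fun _ => 0.

Definition in_disc (z : R[i]) : Prop := normc z < 1.

(** H^2 = { h = sum a_n z^n : sum |a_n|^2 < oo }, identified with the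
    coefficient sequences. *)
Definition H2 : set cseq :=
  [set a | cvgn (series (fun n => normc (a n) ^+ 2))].

Definition ev (a : cseq) (z : R[i]) : R[i] :=
  limn (series (fun n => a n * z ^+ n)).

Definition ip (a b : cseq) : R[i] :=
  limn (series (fun n => a n * conjc (b n))).

Definition nrm (a : cseq) : R :=
  Num.sqrt (limn (series (fun n => normc (a n) ^+ 2))).

(** the unilateral shift (S h)(z) = z h(z) *)
Definition ushift (a : cseq) : cseq :=
  fun n => if n is k.+1 then a k else 0.

Definition holomorphic_on_disc (f : R[i] -> R[i]) : Prop :=
  forall z, in_disc z -> derivable f z 1.

Definition Hinf (f : R[i] -> R[i]) : Prop :=
  holomorphic_on_disc f /\ exists M : R, forall z, in_disc z -> normc (f z) <= M.

Definition cexpi (t : R) : R[i] := (cos t) +i* (sin t).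

Definition inner_fun (f : R[i] -> R[i]) : Prop :=
  Hinf f /\
  {ae (@lebesgue_measure R), forall t : R,
     exists l : R[i],
       (fun r : R => f (r%:C * cexpi t)) @ (1 : R)^'- --> l /\ normc l = 1}.

Definition mH2 (m : R[i] -> R[i]) : set cseq :=
  [set b | H2 b /\ exists a, H2 a /\ forall z, in_disc z -> ev b z = m z * ev a z].

Definition model_space (m : R[i] -> R[i]) : set cseq :=
  [set x | H2 x /\ forall y, mH2 m y -> ip x y = 0].

Definition is_proj (H : set cseq) (x y : cseq) : Prop :=
  H y /\ forall z, H z -> ip (fun n => x n - y n) z = 0.

Definition dim_ge2 (H : set cseq) : Prop :=
  exists x y, H x /\ H y /\
    forall al be : R[i], (forall n, al * x n + be * y n = 0) -> al = 0 /\ be = 0.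

Definition closed_subspace (H M : set cseq) : Prop :=
  M `<=` H /\ M zero_seq /\
  (forall (al : R[i]) x y, M x -> M y -> M (fun n => al * x n + y n)) /\
  (forall (u : nat -> cseq) y, (forall k, M (u k)) -> H y ->
     (fun k => nrm (fun n => u k n - y n)) @ \oo --> (0 : R) -> M y).

Definition op_invariant (A : cseq -> cseq) (M : set cseq) : Prop :=
  forall x, M x -> M (A x).

Definition is_adjoint (H : set cseq) (A B : cseq -> cseq) : Prop :=
  (forall x, H x -> H (B x)) /\
  forall x y, H x -> H y -> ip (A x) y = ip x (B y).

Definition op_irreducible (H : set cseq) (A : cseq -> cseq) : Prop :=
  forall M, closed_subspace H M -> op_invariant A M ->
    (forall B, is_adjoint H A B -> op_invariant B M) ->
    M = [set zero_seq] \/ M = H.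

Definition bounded_op (H : set cseq) (B : cseq -> cseq) : Prop :=
  (forall x, H x -> H (B x)) /\
  (forall (al : R[i]) x y, H x -> H y ->
     B (fun n => al * x n + y n) = (fun n => al * B x n + B y n)) /\
  exists K : R, forall x, H x -> nrm (B x) <= K * nrm x.

Definition Lat (H : set cseq) (A : cseq -> cseq) : set (set cseq) :=
  [set M | closed_subspace H M /\ op_invariant A M].

Definition Lat' (H : set cseq) (A : cseq -> cseq) : set (set cseq) :=
  [set M | closed_subspace H M /\
     forall B, bounded_op H B -> (forall x, H x -> B (A x) = A (B x)) ->
       op_invariant B M].

Definition blaschke (lam0 lam : R[i]) : R[i] :=
  (lam - lam0) / (1 - conjc lam0 * lam).

End Hardy.

(* Main.v *)
Require Import Defs.
From HB Require Import structures.
From mathcomp Require Import all_boot all_order all_algebra.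
From mathcomp Require Import all_classical all_reals all_analysis.
From mathcomp Require Import complex ring lra.
Import Order.TTheory GRing.Theory Num.Theory.
Import numFieldTopology.Exports numFieldNormedType.Exports.
Local Open Scope classical_set_scope.
Local Open Scope ring_scope.
Local Open Scope complex_scope.

(** Identify [H^2] with square-summable Taylor coefficients and let [c] be those of [m].
A bounded holomorphic function has a Taylor series: Goursat bisection, applied to the
form [(f w - f z0) dw / (w - z0)] on the cone over a circle with apex [z0], yields Cauchy's
formula.  Parseval on circles and the unimodular radial limits make the functions
[z^k m] orthonormal, so [H] consists of the [x] orthogonal to all of them, and it contains
the backward shifts [S*^j m] for [j >= 1].

(E) [M = {x in H : x _|_ S*^(2k+1) p for all k}] is invariant under [T^2].  As [p] is even,
[M] contains [S*^2 p]; but [<T S*^2 p, S* p> = |S*^2 p|^2 <> 0], so [M] is not invariant under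
[T], which commutes with [T^2].

(D) Let [M] reduce [T^2] and [N = H - M].  Both are invariant under [S*^2], so the pairs
[(x 0, x 1)] with [x] in [M] are orthogonal to those with [x] in [N]; unless [M] or [N]
vanishes, they span a line [C (a, b)] and its orthogonal complement in [C^2].  The
projection [Q] onto the sequences all of whose pairs [(x (2n), x (2n+1))] lie on that
line maps [H] to itself and commutes with [S*^2], whence [Q m = (g0 + g1 z) m] and
[Q (z m) = (conj g1 + d1 z) m].  Elements of the ranges of [Q] and [1 - Q] are even
functions times [a + b z], respectively [- conj b + conj a z]; comparing [z] with [- z]
forces [m] to be even, or odd, or [m] divided by a Blaschke factor to be even. *)

Set Implicit Arguments.
Unset Strict Implicit.
Unset Printing Implicit Defensive.

(** Holomorphy provides a derivative at each point but no continuity of it, which is why Cauchy's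
    formula rests on bisection. Radial limits exist only almost everywhere, so norms are computed on
    circles of radius r < 1 and dominated convergence removes r. In (D), Q acts on H as the
    projection onto M and commutes with S*^2 on all of H^2. Hence Q m and Q (z m) are orthogonal to
    H and to z^k m for k >= 2, which leaves the span of m and z m; self-adjointness of Q produces
    the coefficient conj g1. Eliminating m(z) and m(-z) leaves polynomial identities: either g1 = 0,
    where m is even or odd, or g1 = b conj a and g0 is |a|^2 or |b|^2. The value |a|^2 makes m even.
    If g0 = |b|^2 <> |a|^2, both m (a - b z) / (conj b - conj a z) and m (conj b + conj a z) / (a +
    b z) are even; up to a constant the former is m over a Blaschke factor when |b| < |a|, the
    latter when |a| < |b|. An odd m vanishes at 0 and m / z is even, which is (B) at 0. *)

Local Notation Re := (@complex.Re _).
Local Notation Im := (@complex.Im _).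

(** * Complex series *)

Section ComplexModulus.
Variable R : realType.
Implicit Types z w : R[i].

Lemma normc_ge0 z : 0 <= normc z.
Proof. by case: z => a b; exact: sqrtr_ge0. Qed.

Lemma abscE z : `|z| = (normc z)%:C.
Proof. by []. Qed.

Lemma normc_eq0 z : (normc z == 0) = (z == 0).
Proof.
apply/eqP/eqP => [/ComplexField.Normc.eq0_normc//|->].
exact: ComplexField.Normc.normc0.
Qed.

Lemma normc_gt0 z : (0 < normc z) = (z != 0).
Proof. by rewrite lt_neqAle normc_ge0 andbT eq_sym normc_eq0. Qed.

Lemma normc00 : normc (0 : R[i]) = 0.
Proof. exact: ComplexField.Normc.normc0. Qed.

Lemma normc11 : normc (1 : R[i]) = 1.
Proof. exact: ComplexField.Normc.normc1. Qed.

Lemma normcMM z w : normc (z * w) = normc z * normc w.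
Proof. exact: ComplexField.Normc.normcM. Qed.

Lemma normcVV z : normc z^-1 = (normc z)^-1.
Proof. exact: ComplexField.Normc.normcV. Qed.

Lemma normcX z n : normc (z ^+ n) = normc z ^+ n.
Proof.
by elim: n => [|n IH]; rewrite ?normc11// !exprS normcMM IH.
Qed.

Lemma normc_sub z w : normc (z - w) <= normc z + normc w.
Proof. by rewrite -(normcN w); exact: le_normcD. Qed.

Lemma normc_subC z w : normc (z - w) = normc (w - z).
Proof. by rewrite -normcN opprB. Qed.

Lemma normc_sum (F : nat -> R[i]) m n :
  normc (\sum_(m <= k < n) F k) <= \sum_(m <= k < n) normc (F k).
Proof.
elim/big_ind2: _ => [|x a y b xa yb|//]; first by rewrite normc00.
by rewrite (le_trans (le_normcD _ _))// lerD.
Qed.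

Lemma normcJ_eq z : normc (conjc z) = normc z.
Proof. by case: z => a b /=; rewrite sqrrN. Qed.

Lemma normc_real (x : R) : normc x%:C = `|x|.
Proof. by rewrite /= expr0n/= addr0 sqrtr_sqr. Qed.

Lemma sqr_normcE z : (normc z) ^+ 2 = (Re z) ^+ 2 + (Im z) ^+ 2.
Proof. by case: z => a b /=; rewrite sqr_sqrtr// addr_ge0// sqr_ge0. Qed.

Lemma mulcJ z : z * conjc z = ((normc z) ^+ 2)%:C.
Proof. by rewrite -sqr_normc abscE rmorphXn. Qed.

Lemma Re_le_normc z : `|Re z| <= normc z.
Proof.
rewrite -(ger0_norm (normc_ge0 z)) -ler_sqr ?nnegrE ?normr_ge0//.
rewrite !real_normK ?num_real// sqr_normcE; have := sqr_ge0 (Im z); lra.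
Qed.

Lemma Im_le_normc z : `|Im z| <= normc z.
Proof.
rewrite -(ger0_norm (normc_ge0 z)) -ler_sqr ?nnegrE ?normr_ge0//.
rewrite !real_normK ?num_real// sqr_normcE; have := sqr_ge0 (Re z); lra.
Qed.

Lemma normc_le_ReIm z : normc z <= `|Re z| + `|Im z|.
Proof.
rewrite -ler_sqr ?nnegrE ?normc_ge0 ?addr_ge0//.
rewrite sqr_normcE -(real_normK (num_real (Re z))) -(real_normK (num_real (Im z))).
have := mulr_ge0 (normr_ge0 (Re z)) (normr_ge0 (Im z)); nra.
Qed.

Lemma ReB z w : Re (z - w) = Re z - Re w.
Proof. by case: z => a b; case: w. Qed.
Lemma ImB z w : Im (z - w) = Im z - Im w.
Proof. by case: z => a b; case: w. Qed.
Lemma ReD z w : Re (z + w) = Re z + Re w.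
Proof. by case: z => a b; case: w. Qed.
Lemma ImD z w : Im (z + w) = Im z + Im w.
Proof. by case: z => a b; case: w. Qed.
Lemma ReM z w : Re (z * w) = Re z * Re w - Im z * Im w.
Proof. by case: z => a b; case: w. Qed.
Lemma ImM z w : Im (z * w) = Re z * Im w + Im z * Re w.
Proof. by case: z => a b; case: w. Qed.
Lemma eqcP z w : Re z = Re w -> Im z = Im w -> z = w.
Proof. by case: z => a b; case: w => c d /= -> ->. Qed.

Lemma RtoC_inj (x y : R) : x%:C = y%:C -> x = y.
Proof. by case. Qed.
Lemma RtoCD (x y : R) : (x + y)%:C = x%:C + y%:C.
Proof. exact: (rmorphD (real_complex R)). Qed.
Lemma RtoCB (x y : R) : (x - y)%:C = x%:C - y%:C.
Proof. exact: (rmorphB (real_complex R)). Qed.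
Lemma RtoCM (x y : R) : (x * y)%:C = x%:C * y%:C.
Proof. exact: (rmorphM (real_complex R)). Qed.
Lemma RtoCV (x : R) : (x^-1)%:C = (x%:C)^-1.
Proof. exact: (fmorphV (real_complex R)). Qed.
Lemma RtoCn (n : nat) : (n%:R)%:C = n%:R :> R[i].
Proof. exact: (rmorph_nat (real_complex R)). Qed.
Lemma RtoC_eq0 (x : R) : (x%:C == 0) = (x == 0).
Proof. exact: (fmorph_eq0 (real_complex R)). Qed.

Lemma ltc_real (x y : R) : (x%:C < y%:C :> R[i]) = (x < y).
Proof. by rewrite ltcE /= eqxx. Qed.

Lemma posc (e : R[i]) : 0 < e -> e = (Re e)%:C /\ 0 < Re e.
Proof.
rewrite ltcE /= => /andP[/eqP ie re]; split => //.
by apply: eqcP.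
Qed.

End ComplexModulus.

(** * Limits of complex sequences *)

Section ComplexLimits.
Variable R : realType.

Lemma cvgcP (u : nat -> R[i]) (l : R[i]) :
  u @ \oo --> l <->
  forall e : R, 0 < e -> exists N, forall n, (N <= n)%N -> normc (u n - l) < e.
Proof.
split=> [/cvgrPdist_lt ul e e0|ul].
  have /ul[N _ NP] : 0 < e%:C by rewrite ltc_real.
  exists N => n Nn; have := NP n Nn.
  by rewrite /= abscE ltc_real normc_subC.
apply/cvgrPdist_lt => e /posc[-> e0].
have [N NP] := ul _ e0; exists N => // n Nn /=.
by rewrite abscE ltc_real normc_subC; exact: NP.
Qed.

Lemma cvgc_lim (u : nat -> R[i]) (l : R[i]) : u @ \oo --> l -> limn u = l.
Proof. by move=> ul; apply: cvg_lim => //; exact: norm_hausdorff. Qed.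

Lemma cvgc_unique (u : nat -> R[i]) (l l' : R[i]) :
  u @ \oo --> l -> u @ \oo --> l' -> l = l'.
Proof. by move=> /cvgc_lim <- /cvgc_lim <-. Qed.

Lemma cvgcReIm (u : nat -> R[i]) (a b : R) :
  (fun n => Re (u n)) @ \oo --> a -> (fun n => Im (u n)) @ \oo --> b ->
  u @ \oo --> (a +i* b).
Proof.
move=> /cvgrPdist_lt ua /cvgrPdist_lt ub; apply/cvgcP => e e0.
have e2 : 0 < e / 2 by rewrite divr_gt0.
have [N _ NP] := ua _ e2; have [M _ MP] := ub _ e2.
exists (maxn N M) => n; rewrite geq_max => /andP[Nn Mn].
rewrite (le_lt_trans (normc_le_ReIm _))// ReB ImB /=.
have := NP _ Nn; have := MP _ Mn => /=; rewrite distrC => h1.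
rewrite distrC => h2; lra.
Qed.

Lemma cvgc_normc (u : nat -> R[i]) (l : R[i]) :
  u @ \oo --> l -> (fun n => normc (u n)) @ \oo --> normc l.
Proof.
move=> /cvgcP ul; apply/cvgrPdist_lt => e e0.
have [N NP] := ul _ e0; exists N => // n Nn /=.
have h1 : normc l <= normc (u n) + normc (u n - l).
  by have := normc_sub (u n) (u n - l); rewrite subKr.
have h2 : normc (u n) <= normc l + normc (u n - l).
  by apply: le_trans (le_normcD _ _); rewrite addrC subrK.
have := NP n Nn; rewrite ltr_norml => h3; apply/andP; split; lra.
Qed.

Lemma cvgc_conj (u : nat -> R[i]) (l : R[i]) :
  u @ \oo --> l -> (fun n => conjc (u n)) @ \oo --> conjc l.
Proof.
move=> /cvgcP ul; apply/cvgcP => e e0.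
have [N NP] := ul _ e0; exists N => n Nn.
by rewrite -rmorphB normcJ_eq; exact: NP.
Qed.

Lemma cvgc_cst (l : R[i]) : (fun _ : nat => l) @ \oo --> l.
Proof. by apply/cvgcP => e e0; exists 0%N => n _; rewrite subrr normc00. Qed.

Lemma cvgcD (u v : nat -> R[i]) (k l : R[i]) :
  u @ \oo --> k -> v @ \oo --> l -> (fun n => u n + v n) @ \oo --> (k + l).
Proof.
move=> /cvgcP uk /cvgcP vl; apply/cvgcP => e e0.
have e2 : 0 < e / 2 by rewrite divr_gt0.
have [N NP] := uk _ e2; have [M MP] := vl _ e2.
exists (maxn N M) => n; rewrite geq_max => /andP[/NP h1 /MP h2].
rewrite opprD addrACA (le_lt_trans (le_normcD _ _))//; lra.
Qed.

Lemma cvgcZ (a : R[i]) (u : nat -> R[i]) (l : R[i]) :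
  u @ \oo --> l -> (fun n => a * u n) @ \oo --> (a * l).
Proof.
move=> /cvgcP ul; apply/cvgcP => e e0.
have [->|a0] := eqVneq a 0.
  by exists 0%N => n _; rewrite !mul0r subrr normc00.
have na : 0 < normc a by rewrite normc_gt0.
have [N NP] := ul _ (divr_gt0 e0 na); exists N => n /NP.
by rewrite -mulrBr normcMM ltr_pdivlMr// mulrC.
Qed.

Lemma cvgr_le (u : nat -> R) (l B : R) :
  u @ \oo --> l -> (forall n, u n <= B) -> l <= B.
Proof.
move=> ul uB; rewrite -(cvg_lim _ ul)//; apply: limr_le; last exact: nearW.
by apply/cvg_ex; exists l.
Qed.

Lemma cvgc_le (u : nat -> R[i]) (l : R[i]) (B : R) :
  u @ \oo --> l -> (forall n, normc (u n) <= B) -> normc l <= B.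
Proof. by move=> /cvgc_normc ul uB; exact: cvgr_le ul uB. Qed.

End ComplexLimits.

(** * Absolutely convergent complex series *)

Section Series.
Variable R : realType.
Implicit Types (x : nat -> R) (u v : nat -> R[i]).

Lemma series_nondecr x : (forall n, 0 <= x n) ->
  {homo series x : n m / (n <= m)%N >-> n <= m}.
Proof. by move=> x0; exact: nondecreasing_series. Qed.

Lemma bounded_series_cvg x B : (forall n, 0 <= x n) ->
  (forall n, series x n <= B) -> cvgn (series x).
Proof.
move=> x0 xB; apply: nondecreasing_is_cvgn; first exact: series_nondecr.
by exists B => _ [n _ <-].
Qed.

Lemma series_le_lim x n : (forall n, 0 <= x n) -> cvgn (series x) ->
  series x n <= limn (series x).
Proof. by move=> x0 cx; apply: nondecreasing_cvgn_le => //; exact: series_nondecr. Qed.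

Lemma lim_series_ub x B : cvgn (series x) -> (forall n, series x n <= B) ->
  limn (series x) <= B.
Proof. by move=> cx xB; apply: limr_le => //; exact: nearW. Qed.

Definition abs_summable u := cvgn (series (fun n => normc (u n))).

Lemma abs_summable_bound u B :
  (forall n, series (fun n => normc (u n)) n <= B) -> abs_summable u.
Proof. by apply: bounded_series_cvg => n; exact: normc_ge0. Qed.

Lemma abs_summable_le u x : (forall n, normc (u n) <= x n) ->
  cvgn (series x) -> abs_summable u.
Proof.
move=> ux cx; apply: (@abs_summable_bound _ (limn (series x))) => n.
apply: le_trans (series_le_lim n _ cx); first by apply: ler_sum => i _; exact: ux.
by move=> k; exact: le_trans (normc_ge0 _) (ux k).
Qed.

Lemma series_Re u n : series (fun n => Re (u n)) n = Re (series u n).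
Proof. by rewrite /series /= raddf_sum. Qed.

Lemma series_Im u n : series (fun n => Im (u n)) n = Im (series u n).
Proof. by rewrite /series /= raddf_sum. Qed.

Lemma abs_summable_cvg u : abs_summable u -> series u @ \oo --> limn (series u).
Proof.
move=> cu.
have cabs x : (forall n, `|x n| <= normc (u n)) -> cvgn (series x).
  move=> xu; apply: normed_cvg; apply: (series_le_cvg _ _ _ cu) => n /=;
    [exact: normr_ge0|exact: normc_ge0|exact: xu].
have cRe := cabs (fun n => Re (u n)) (fun n => Re_le_normc _).
have cIm := cabs (fun n => Im (u n)) (fun n => Im_le_normc _).
suff h : series u @ \oo --> limn (series (fun n => Re (u n))) +i*
    limn (series (fun n => Im (u n))) by rewrite (cvgc_lim h).
by apply: cvgcReIm; under eq_fun do rewrite -?series_Re -?series_Im.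
Qed.

Lemma csumD u v : abs_summable u -> abs_summable v ->
  limn (series (fun n => u n + v n)) = limn (series u) + limn (series v).
Proof.
move=> /abs_summable_cvg cu /abs_summable_cvg cv; apply: cvgc_lim.
have -> : series (fun n => u n + v n) = (fun n => series u n + series v n).
  by apply/funext => n; rewrite /series /= big_split.
exact: (cvgcD cu cv).
Qed.

Lemma csumZ (a : R[i]) u : abs_summable u ->
  limn (series (fun n => a * u n)) = a * limn (series u).
Proof.
move=> /abs_summable_cvg cu; apply: cvgc_lim.
have -> : series (fun n => a * u n) = (fun n => a * series u n).
  by apply/funext => n; rewrite /series /= mulr_sumr.
exact: (cvgcZ cu).
Qed.

Lemma csum_conj u : abs_summable u ->
  limn (series (fun n => conjc (u n))) = conjc (limn (series u)).
Proof.
move=> /abs_summable_cvg cu; apply: cvgc_lim.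
have -> : series (fun n => conjc (u n)) = (fun n => conjc (series u n)).
  by apply/funext => n; rewrite /series /= raddf_sum.
exact: (cvgc_conj cu).
Qed.

Lemma csum_le u : abs_summable u ->
  normc (limn (series u)) <= limn (series (fun n => normc (u n))).
Proof.
move=> su; apply: (cvgc_le (abs_summable_cvg su)) => n.
apply: le_trans (series_le_lim n _ su); first exact: normc_sum.
by move=> k; exact: normc_ge0.
Qed.

Lemma abs_summableS u : abs_summable u -> abs_summable (fun n => u n.+1).
Proof.
move=> su; apply: (@abs_summable_bound _ (limn (series (fun n => normc (u n))))) => n.
apply: le_trans (series_le_lim n.+1 _ su); last by move=> k; exact: normc_ge0.
by rewrite /series /= big_nat_recl// lerDr normc_ge0.
Qed.

Lemma csumS u : abs_summable u ->
  limn (series u) = u 0%N + limn (series (fun n => u n.+1)).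
Proof.
move=> su; have /abs_summable_cvg c1 := abs_summableS su.
have /abs_summable_cvg/cvgcP c0 := su.
apply: (@cvgc_unique _ (fun n => series u n.+1)).
  apply/cvgcP => e /c0[N NP]; exists N => n Nn; apply: NP; exact: leqW.
have -> : (fun n => series u n.+1) = (fun n => u 0%N + series (fun n => u n.+1) n).
  by apply/funext => n; rewrite /series /= big_nat_recl.
exact: (cvgcD (@cvgc_cst _ (u 0%N)) c1).
Qed.

End Series.

Local Arguments ComplexField.Normc.normc : simpl never.

(** * Power series and the Hardy space *)

Section BoundedPowerSeries.
Variable R : realType.
Implicit Types (x y : cseq R) (z : R[i]).

Definition bshift x : cseq R := fun n => x n.+1.

Definition coef_bound (B : R) x := forall n, normc (x n) <= B.

Lemma coef_bound_ge0 B x : coef_bound B x -> 0 <= B.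
Proof. by move=> /(_ 0%N); apply: le_trans; exact: normc_ge0. Qed.

Lemma geometric_bound (B r : R) : 0 <= B -> 0 <= r < 1 ->
  cvgn (series (geometric B r)) /\ limn (series (geometric B r)) = B / (1 - r).
Proof.
move=> B0 /andP[r0 r1]; have r1' : `|r| < 1 by rewrite ger0_norm.
have h := @cvg_geometric_series R B r r1'; split; first by apply/cvg_ex; eexists; exact: h.
exact: cvg_lim h.
Qed.

Lemma ev_term_le B x z n : coef_bound B x ->
  normc (x n * z ^+ n) <= geometric B (normc z) n.
Proof.
by move=> xB; rewrite normcMM normcX /geometric /= ler_wpM2r// exprn_ge0// normc_ge0.
Qed.

Lemma ev_summable B x z : coef_bound B x -> in_disc z ->
  abs_summable (fun n => x n * z ^+ n).
Proof.
move=> xB z1; apply: abs_summable_le (ev_term_le z ^~ xB) _.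
have := @geometric_bound B (normc z) (coef_bound_ge0 xB).
by rewrite normc_ge0 z1 => /(_ isT)[].
Qed.

Lemma ev_cvg B x z : coef_bound B x -> in_disc z ->
  series (fun n => x n * z ^+ n) @ \oo --> ev x z.
Proof. by move=> xB z1; apply: abs_summable_cvg; exact: ev_summable xB z1. Qed.

Lemma ev_le B x z : coef_bound B x -> in_disc z ->
  normc (ev x z) <= B / (1 - normc z).
Proof.
move=> xB z1; have su := ev_summable xB z1.
apply: le_trans (csum_le su) _.
have := @geometric_bound B (normc z) (coef_bound_ge0 xB).
rewrite normc_ge0 z1 => /(_ isT)[cg <-].
apply: (lim_series_ub su) => n; apply: le_trans (series_le_lim n _ cg).
  by apply: ler_sum => i _; exact: ev_term_le.
move=> k; rewrite /geometric /= mulr_ge0 ?exprn_ge0 ?normc_ge0//.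
exact: coef_bound_ge0 xB.
Qed.

Lemma coef_bound_shift B x : coef_bound B x -> coef_bound B (bshift x).
Proof. by move=> xB n; exact: xB. Qed.

Lemma coef_bound_lin A B (a : R[i]) x y : coef_bound A x -> coef_bound B y ->
  coef_bound (normc a * A + B) (fun n => a * x n + y n).
Proof.
move=> xA yB n; apply: le_trans (le_normcD _ _) _.
by rewrite normcMM lerD// ler_wpM2l// normc_ge0.
Qed.

Lemma coef_bound_ushift B x : coef_bound B x -> coef_bound B (ushift x).
Proof. by move=> xB [|n] /=; [rewrite normc00; exact: coef_bound_ge0 xB|exact: xB]. Qed.

Lemma ev_lin A B (a : R[i]) x y z : coef_bound A x -> coef_bound B y -> in_disc z ->
  ev (fun n => a * x n + y n) z = a * ev x z + ev y z.
Proof.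
move=> xA yB z1; have sx := ev_summable xA z1; have sy := ev_summable yB z1.
rewrite /ev -(csumZ a sx).
have sax : abs_summable (fun n => a * (x n * z ^+ n)).
  apply: (abs_summable_le (x := geometric (normc a * A) (normc z))) => [n|].
    rewrite normcMM /geometric /= -mulrA; apply: ler_wpM2l; first exact: normc_ge0.
    exact: ev_term_le.
  have := @geometric_bound (normc a * A) (normc z).
  rewrite normc_ge0 z1 mulr_ge0 ?normc_ge0 ?(coef_bound_ge0 xA)//.
  by move=> /(_ isT isT)[].
rewrite -(csumD sax sy); congr (limn (series _)).
by apply/funext => n; rewrite mulrDl mulrA.
Qed.

Lemma ev_zero z : ev (@zero_seq R) z = 0.
Proof.
apply: cvgc_lim; have -> : series (fun n => @zero_seq R n * z ^+ n) = (fun=> 0).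
  by apply/funext => n; apply: big1 => k _; rewrite mul0r.
exact: cvgc_cst.
Qed.

Lemma evS B x z : coef_bound B x -> in_disc z ->
  ev x z = x 0%N + z * ev (bshift x) z.
Proof.
move=> xB z1; have sx := ev_summable xB z1.
rewrite {1}/ev (csumS sx) expr0 mulr1 -(csumZ z); last first.
  exact: ev_summable (coef_bound_shift xB) z1.
congr (_ + limn (series _)).
by apply/funext => n; rewrite exprS mulrCA.
Qed.

Lemma ev_ushift B x z : coef_bound B x -> in_disc z ->
  ev (ushift x) z = z * ev x z.
Proof. by move=> xB z1; rewrite (evS (coef_bound_ushift xB) z1) /= add0r. Qed.

Lemma ev_opp x z : ev x (- z) = ev (fun n => (-1) ^+ n * x n) z.
Proof.
congr (limn (series _)); apply/funext => n.
by rewrite (exprNn z n); ring.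
Qed.

Lemma ev_near0 B x : coef_bound B x -> x 0%N != 0 ->
  exists d : R, [/\ 0 < d, d <= 1 & forall z, normc z < d -> ev x z != 0].
Proof.
move=> xB x0; have B0 := coef_bound_ge0 xB.
have nx : 0 < normc (x 0%N) by rewrite normc_gt0.
have s0 : 0 < B + normc (x 0%N) by rewrite ltr_wpDl.
(* The radius solves |z| B = |x 0| (1 - |z|): below it the tail, at most |z| B / (1 - |z|), is
   smaller than |x 0|. *)
exists (normc (x 0%N) / (B + normc (x 0%N))); split.
- exact: divr_gt0.
- by rewrite ler_pdivrMr// mul1r lerDr.
move=> z; rewrite ltr_pdivlMr// mulrDr => hz.
have z1 : in_disc z.
  rewrite /in_disc -(ltr_pM2r s0) mul1r; have := normc_ge0 z; nra.
apply/eqP => e0.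
have := ev_le (coef_bound_shift xB) z1.
have := evS xB z1; rewrite e0 => /eqP; rewrite eq_sym addrC addr_eq0 => /eqP e.
have ne : normc z * normc (ev (bshift x) z) = normc (x 0%N).
  by rewrite -normcMM e normcN.
rewrite ler_pdivlMr; last by rewrite subr_gt0.
have := normc_ge0 z; have := normc_ge0 (ev (bshift x) z).
set w := normc (ev _ _) in ne *; set t := normc z in ne z1 hz *; move: z1; rewrite /in_disc -/t.
move=> t1 w0 t0 h.
have : t * (w * (1 - t)) <= t * B by rewrite ler_wpM2l.
rewrite mulrA ne; nra.
Qed.

(** Each vanishing leading coefficient is split off as a factor z by [evS], until [ev_near0]
    applies. *)
Lemma ev_isolated B x n : coef_bound B x -> x n != 0 ->
  exists d : R, [/\ 0 < d, d <= 1 & forall z, z != 0 -> normc z < d -> ev x z != 0].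
Proof.
elim: n x => [|n IH] x xB xn.
  by have [d [d0 d1 H]] := ev_near0 xB xn; exists d; split => // z _; exact: H.
have [x0|x0] := eqVneq (x 0%N) 0; last first.
  by have [d [d0 d1 H]] := ev_near0 xB x0; exists d; split => // z _; exact: H.
have [d [d0 d1 H]] := IH _ (coef_bound_shift xB) xn.
exists d; split => // z z0 zd.
rewrite (evS xB (lt_le_trans zd d1)) x0 add0r mulf_eq0 (negbTE z0) /=.
exact: H.
Qed.

(** The identity theorem. It asks for a punctured disc only, because some relations become available
    after division by z. *)
Lemma ev_eq0 B x (d : R) : coef_bound B x -> 0 < d ->
  (forall z, z != 0 -> normc z < d -> ev x z = 0) -> forall n, x n = 0.
Proof.
move=> xB d0 H n; apply/eqP/negPn/negP => xn.
have [d' [d'0 d'1 H']] := ev_isolated xB xn.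
pose t := Num.min d d' / 2.
have m0 : 0 < Num.min d d' by rewrite lt_min d0.
have t0 : 0 < t by rewrite divr_gt0.
have td : t < d /\ t < d'.
  by split; rewrite (@lt_le_trans _ _ (Num.min d d'))// ?ge_min ?lexx ?orbT//
    ltr_pdivrMr// ltr_pMr// ltr1n.
have tz : t%:C != 0 by rewrite -normc_gt0 normc_real gtr0_norm.
have := H' _ tz; rewrite normc_real gtr0_norm// (H _ tz) ?eqxx; last first.
  by rewrite normc_real gtr0_norm// td.1.
by move=> /(_ td.2).
Qed.

End BoundedPowerSeries.

(** * Norm, inner product and shifts on square-summable sequences *)

Section HardySpace.
Variable R : realType.
Implicit Types (x y w : cseq R) (z : R[i]).

Definition nrm2 x : R := limn (series (fun n => normc (x n) ^+ 2)).

Lemma sq_ge0 x n : 0 <= normc (x n) ^+ 2.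
Proof. exact: sqr_ge0. Qed.

Lemma H2_bound x B : (forall n, series (fun n => normc (x n) ^+ 2) n <= B) -> H2 x.
Proof. by move=> xB; apply: bounded_series_cvg xB => n; exact: sq_ge0. Qed.

Lemma nrm2_ub x B : H2 x -> (forall n, series (fun n => normc (x n) ^+ 2) n <= B) ->
  nrm2 x <= B.
Proof. by move=> xH xB; exact: lim_series_ub. Qed.

Lemma series_le_nrm2 x n : H2 x -> series (fun n => normc (x n) ^+ 2) n <= nrm2 x.
Proof. by move=> xH; apply: series_le_lim => // k; exact: sq_ge0. Qed.

Lemma nrm2_ge0 x : H2 x -> 0 <= nrm2 x.
Proof. by move=> xH; have := series_le_nrm2 0%N xH; rewrite /series /= big_geq. Qed.

Lemma nrmE x : nrm x = Num.sqrt (nrm2 x).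
Proof. by []. Qed.

Lemma nrm_ge0 x : 0 <= nrm x.
Proof. exact: sqrtr_ge0. Qed.

Lemma sqr_nrm x : H2 x -> nrm x ^+ 2 = nrm2 x.
Proof. by move=> xH; rewrite nrmE sqr_sqrtr// nrm2_ge0. Qed.

Lemma coef_le_nrm2 x n : H2 x -> normc (x n) ^+ 2 <= nrm2 x.
Proof.
move=> xH; apply: le_trans (series_le_nrm2 n.+1 xH).
rewrite /series /= big_nat_recr//= lerDr; apply: sumr_ge0 => i _; exact: sq_ge0.
Qed.

Lemma H2_coef_bound x : H2 x -> coef_bound (nrm x) x.
Proof.
move=> xH n; rewrite -ler_sqr ?nnegrE ?normc_ge0 ?nrm_ge0// sqr_nrm//.
exact: coef_le_nrm2.
Qed.

Lemma nrm2_eq0 x : H2 x -> nrm2 x = 0 -> x = @zero_seq R.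
Proof.
move=> xH x0; apply/funext => n; apply/eqP; rewrite -normc_eq0 -sqrf_eq0.
by rewrite eq_le sq_ge0 andbT -x0 coef_le_nrm2.
Qed.

Lemma H2_lin (a : R[i]) x y : H2 x -> H2 y -> H2 (fun n => a * x n + y n).
Proof.
move=> xH yH.
apply: (@H2_bound _ (2 * normc a ^+ 2 * nrm2 x + 2 * nrm2 y)) => n.
apply: (@le_trans _ _ (2 * normc a ^+ 2 * series (fun n => normc (x n) ^+ 2) n +
   2 * series (fun n => normc (y n) ^+ 2) n)).
  rewrite /series /= !mulr_sumr -big_split /=; apply: ler_sum => k _.
  have h := le_normcD (a * x k) (y k); rewrite normcMM in h.
  have := normc_ge0 (a * x k + y k).
  set p := normc (a * _ + _) in h *; set q := normc a in h *.
  set r := normc (x k) in h *; set s := normc (y k) in h *.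
  move=> p0; have : p ^+ 2 <= (q * r + s) ^+ 2 by rewrite ler_sqr ?nnegrE//; lra.
  have := sqr_ge0 (q * r - s); lra.
apply: lerD; apply: ler_wpM2l; [|exact: series_le_nrm2|by []|exact: series_le_nrm2].
by apply: mulr_ge0 => //; exact: sqr_ge0.
Qed.

Arguments H2_lin a {x y} _ _.

Lemma H2_0 : H2 (@zero_seq R).
Proof.
apply: (@H2_bound _ 0) => n; rewrite /series /= big1// => i _.
by rewrite /zero_seq normc00 expr0n.
Qed.

Lemma H2_Z (a : R[i]) x : H2 x -> H2 (fun n => a * x n).
Proof.
by move=> xH; have := H2_lin a xH H2_0; under eq_fun do rewrite /zero_seq addr0.
Qed.

Arguments H2_Z a {x} _.

Lemma H2_D x y : H2 x -> H2 y -> H2 (fun n => x n + y n).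
Proof. by move=> xH yH; have := H2_lin 1 xH yH; under eq_fun do rewrite mul1r. Qed.

Lemma H2_B x y : H2 x -> H2 y -> H2 (fun n => x n - y n).
Proof.
by move=> xH yH; have := H2_lin (-1) yH xH; under eq_fun do rewrite mulN1r addrC.
Qed.

Lemma ip_summable x y : H2 x -> H2 y -> abs_summable (fun n => x n * conjc (y n)).
Proof.
move=> xH yH; apply: (@abs_summable_bound _ _ (nrm2 x + nrm2 y)) => n.
apply: (@le_trans _ _ (series (fun n => normc (x n) ^+ 2) n +
   series (fun n => normc (y n) ^+ 2) n)); last by rewrite lerD// series_le_nrm2.
rewrite /series /= -big_split /=; apply: ler_sum => k _.
rewrite normcMM normcJ_eq.
have := sqr_ge0 (normc (x k) - normc (y k)).
have := mulr_ge0 (normc_ge0 (x k)) (normc_ge0 (y k)); lra.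
Qed.

Lemma ip_lin (a : R[i]) x y w : H2 x -> H2 y -> H2 w ->
  ip (fun n => a * x n + y n) w = a * ip x w + ip y w.
Proof.
move=> xH yH wH; have sx := ip_summable xH wH; have sy := ip_summable yH wH.
have sax : abs_summable (fun n => a * (x n * conjc (w n))).
  have := ip_summable (H2_Z a xH) wH; by under eq_fun do rewrite -mulrA.
rewrite /ip -(csumZ a sx) -(csumD sax sy); congr (limn (series _)).
by apply/funext => n; rewrite mulrDl mulrA.
Qed.

Lemma ip_conj x y : H2 x -> H2 y -> ip y x = conjc (ip x y).
Proof.
move=> xH yH; rewrite /ip -(csum_conj (ip_summable xH yH)); congr (limn (series _)).
by apply/funext => n; rewrite rmorphM /= conjcK mulrC.
Qed.

Lemma ip0l w : ip (@zero_seq R) w = 0.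
Proof.
apply: cvgc_lim.
have -> : series (fun n => @zero_seq R n * conjc (w n)) = (fun _ => 0).
  by apply/funext => n; rewrite /series /= big1// => i _; rewrite mul0r.
exact: cvgc_cst.
Qed.

Lemma ipZl (a : R[i]) x w : H2 x -> H2 w -> ip (fun n => a * x n) w = a * ip x w.
Proof.
move=> xH wH; have := ip_lin a xH H2_0 wH; rewrite ip0l addr0.
by under eq_fun do rewrite /zero_seq addr0.
Qed.

Lemma ipDl x y w : H2 x -> H2 y -> H2 w ->
  ip (fun n => x n + y n) w = ip x w + ip y w.
Proof.
by move=> xH yH wH; have := ip_lin 1 xH yH wH; rewrite mul1r; under eq_fun do rewrite mul1r.
Qed.

Lemma ipBl x y w : H2 x -> H2 y -> H2 w ->
  ip (fun n => x n - y n) w = ip x w - ip y w.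
Proof.
move=> xH yH wH; have := ip_lin (-1) yH xH wH; rewrite mulN1r addrC => <-.
by congr ip; apply/funext => n; rewrite mulN1r addrC.
Qed.

Lemma ipZr (a : R[i]) x w : H2 x -> H2 w -> ip x (fun n => a * w n) = conjc a * ip x w.
Proof.
move=> xH wH; rewrite (ip_conj (H2_Z a wH) xH) ipZl// rmorphM /=; congr (_ * _).
by rewrite -ip_conj.
Qed.

Lemma ipDr x y w : H2 x -> H2 y -> H2 w ->
  ip w (fun n => x n + y n) = ip w x + ip w y.
Proof.
move=> xH yH wH; rewrite (ip_conj (H2_D xH yH) wH) ipDl// rmorphD /=.
by rewrite -!ip_conj.
Qed.

Lemma ipBr x y w : H2 x -> H2 y -> H2 w ->
  ip w (fun n => x n - y n) = ip w x - ip w y.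
Proof.
move=> xH yH wH; rewrite (ip_conj (H2_B xH yH) wH) ipBl// rmorphB /=.
by rewrite -!ip_conj.
Qed.

Lemma ip_self x : H2 x -> ip x x = (nrm2 x)%:C.
Proof.
move=> xH; apply: cvgc_lim; apply: cvgcReIm; last first.
  rewrite [X in X @ _ --> _](_ : _ = (fun=> 0)); first exact: cvg_cst.
  apply/funext => n; rewrite -series_Im /series /= big1// => i _.
  by rewrite mulcJ.
rewrite [X in X @ _ --> _](_ : _ = series (fun n => normc (x n) ^+ 2)); first exact: xH.
by apply/funext => n; rewrite -series_Re /series /=; apply: eq_bigr => i _; rewrite mulcJ.
Qed.

Lemma ip_cauchy_schwarz x y : H2 x -> H2 y -> normc (ip x y) <= nrm x * nrm y.
Proof.
move=> xH yH.
have [x0|x0] := eqVneq (nrm2 x) 0.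
  by rewrite (nrm2_eq0 xH x0) ip0l normc00 mulr_ge0// nrm_ge0.
have [y0|y0] := eqVneq (nrm2 y) 0.
  rewrite (nrm2_eq0 yH y0) (ip_conj H2_0 xH) ip0l conjc0 normc00.
  by rewrite mulr_ge0 ?nrm_ge0.
have nx : 0 < nrm x by rewrite sqrtr_gt0 lt_neqAle eq_sym x0 nrm2_ge0.
have ny : 0 < nrm y by rewrite sqrtr_gt0 lt_neqAle eq_sym y0 nrm2_ge0.
(* This weight balances 2 p q <= t p^2 + q^2 / t: after summation both terms on the right equal
   [nrm x * nrm y], so the termwise bound loses nothing. *)
pose t := nrm y / nrm x; have t0 : 0 < t by exact: divr_gt0.
have key : 2 * normc (ip x y) <= t * nrm2 x + t^-1 * nrm2 y.
  have su := ip_summable xH yH.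
  have h n : series (fun n => normc (x n * conjc (y n))) n <=
      (t * nrm2 x + t^-1 * nrm2 y) / 2.
    apply: (@le_trans _ _ ((t * series (fun n => normc (x n) ^+ 2) n +
       t^-1 * series (fun n => normc (y n) ^+ 2) n) / 2)); last first.
      rewrite ler_pM2r//; apply: lerD; apply: ler_wpM2l; rewrite ?invr_ge0 ?(ltW t0)//;
        exact: series_le_nrm2.
    rewrite /series /= !mulr_sumr -big_split /= mulr_suml; apply: ler_sum => k _.
    rewrite normcMM normcJ_eq.
    set p := normc (x k); set q := normc (y k).
    have := sqr_ge0 (t * p - q) => h.
    have : 0 <= t^-1 * (t * p - q) ^+ 2 by rewrite mulr_ge0// invr_ge0 ltW.
    have -> : t^-1 * (t * p - q) ^+ 2 = t * p ^+ 2 + t^-1 * q ^+ 2 - 2 * p * q.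
      by field; rewrite gt_eqF.
    lra.
  have := le_trans (csum_le su) (lim_series_ub su h); rewrite -/(ip x y); lra.
rewrite -(sqr_nrm xH) -(sqr_nrm yH) in key.
have -> : nrm x * nrm y = (t * nrm x ^+ 2 + t^-1 * nrm y ^+ 2) / 2.
  by rewrite /t; field; rewrite !gt_eqF.
lra.
Qed.

Lemma bshift_H2 x : H2 x -> H2 (bshift x).
Proof.
move=> xH; apply: (@H2_bound _ (nrm2 x)) => n.
apply: le_trans (series_le_nrm2 n.+1 xH).
by rewrite /series /= [leRHS]big_nat_recl// lerDr sq_ge0.
Qed.

Lemma ushift_series x n :
  series (fun n => normc (ushift x n) ^+ 2) n.+1 = series (fun n => normc (x n) ^+ 2) n.
Proof. by rewrite /series /= big_nat_recl//= normc00 expr0n/= add0r. Qed.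

Lemma ushift_H2 x : H2 x -> H2 (ushift x).
Proof.
move=> xH; apply: (@H2_bound _ (nrm2 x)) => -[|n].
  by rewrite /series /= big_geq// nrm2_ge0.
by rewrite ushift_series series_le_nrm2.
Qed.

Lemma nrm2_ushift_le x : H2 x -> nrm2 (ushift x) <= nrm2 x.
Proof.
move=> xH; apply: nrm2_ub; first exact: ushift_H2.
move=> [|n]; first by rewrite /series /= big_geq// nrm2_ge0.
by rewrite ushift_series series_le_nrm2.
Qed.

Lemma ip_ushift x y : H2 x -> H2 y -> ip (ushift x) y = ip x (bshift y).
Proof.
move=> xH yH; rewrite /ip (csumS (ip_summable (ushift_H2 xH) yH)) /=.
by rewrite mul0r add0r.
Qed.

Lemma ip_split x y : H2 x -> H2 y ->
  ip x y = x 0%N * conjc (y 0%N) + ip (bshift x) (bshift y).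
Proof. by move=> xH yH; rewrite /ip (csumS (ip_summable xH yH)). Qed.

Lemma ev_le_nrm x z : H2 x -> in_disc z -> normc (ev x z) <= nrm x / (1 - normc z).
Proof. by move=> xH z1; exact: ev_le (H2_coef_bound xH) z1. Qed.

End HardySpace.

Arguments H2_lin {R} a {x y} _ _.
Arguments H2_Z {R} a {x} _.

(** * Completeness and orthogonal projection *)

Section HardyCompleteness.
Variable R : realType.
Implicit Types (x y w : cseq R).

Lemma real_cauchy_cvg (u : nat -> R) :
  (forall e : R, 0 < e -> exists N, forall k l, (N <= k)%N -> (N <= l)%N ->
     `|u k - u l| < e) -> cvgn u.
Proof.
move=> H; apply/cauchy_cvgP/cauchy_ballP => e e0.
have [N NP] := H _ e0; pose A := [set r : R | exists2 n, (N <= n)%N & r = u n].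
exists (A, A) => /=; first by split; exists N => // n Nn; exists n.
by move=> [_ _] [/= [k Nk ->] [l Nl ->]]; exact: NP.
Qed.

Lemma complex_cauchy_cvg (u : nat -> R[i]) :
  (forall e : R, 0 < e -> exists N, forall k l, (N <= k)%N -> (N <= l)%N ->
     normc (u k - u l) < e) -> exists l : R[i], u @ \oo --> l.
Proof.
move=> H.
have cr : cvgn (fun n => Re (u n)).
  apply: real_cauchy_cvg => e /H[N NP]; exists N => k l Nk Nl.
  by rewrite -ReB (le_lt_trans (Re_le_normc _))// NP.
have ci : cvgn (fun n => Im (u n)).
  apply: real_cauchy_cvg => e /H[N NP]; exists N => k l Nk Nl.
  by rewrite -ImB (le_lt_trans (Im_le_normc _))// NP.
by eexists; exact: cvgcReIm cr ci.
Qed.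

Lemma H2_complete (u : nat -> cseq R) : (forall k, H2 (u k)) ->
  (forall e : R, 0 < e -> exists N, forall k l, (N <= k)%N -> (N <= l)%N ->
     nrm2 (fun n => u k n - u l n) <= e) ->
  exists y, H2 y /\ forall e : R, 0 < e -> exists N, forall k, (N <= k)%N ->
     nrm2 (fun n => u k n - y n) <= e.
Proof.
move=> uH uC.
have ex n : exists l : R[i], (fun k => u k n) @ \oo --> l.
  apply: complex_cauchy_cvg => e e0.
  have e2 : 0 < (e / 2) ^+ 2 by rewrite exprn_gt0// divr_gt0.
  have [N NP] := uC _ e2; exists N => k l Nk Nl.
  have h := le_trans (coef_le_nrm2 n (H2_B (uH k) (uH l))) (NP _ _ Nk Nl).
  rewrite ler_sqr ?nnegrE ?normc_ge0 ?divr_ge0 ?(ltW e0)// in h.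
  apply: le_lt_trans h _; lra.
have [y yP] := choice ex.
(* A partial sum has finitely many terms, so coordinatewise convergence carries the bound through l
   -> oo; only afterwards does the number of terms grow. *)
have part k e N n : (forall l, (N <= l)%N -> nrm2 (fun n => u k n - u l n) <= e) ->
    series (fun n => normc (u k n - y n) ^+ 2) n <= e.
  move=> h.
  pose v l := series (fun n => normc (u k n - u (l + N)%N n) ^+ 2) n.
  have vl : v @ \oo --> series (fun n => normc (u k n - y n) ^+ 2) n.
    rewrite /v /series /=; apply: cvg_big; first exact: add_continuous.
    move=> i _.
    suff /cvgc_normc h' : (fun l => u k i - u (l + N)%N i) @ \oo --> (u k i - y i).
      exact: (cvgM h' h').
    have /cvgcP yi := yP i; apply/cvgcP => d /yi[M MP]; exists M => l Ml.
    rewrite opprD addrACA subrr add0r -opprD normcN; apply: MP.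
    exact: leq_trans Ml (leq_addr _ _).
  apply: (cvgr_le vl) => l; apply: le_trans (h (l + N)%N (leq_addl _ _)).
  by apply: series_le_nrm2; exact: H2_B.
have HB k e N : (forall l, (N <= l)%N -> nrm2 (fun n => u k n - u l n) <= e) ->
    H2 (fun n => u k n - y n) /\ nrm2 (fun n => u k n - y n) <= e.
  move=> h.
  have H : H2 (fun n => u k n - y n).
    by apply: (@H2_bound _ _ e) => n; exact: part h.
  by split => //; apply: nrm2_ub => // n; exact: part h.
exists y; split; last first.
  move=> e /uC[N NP]; exists N => k Nk.
  by have [] := HB k e N (fun l Nl => NP _ _ Nk Nl).
have [N NP] := uC _ ltr01.
have [h _] := HB N _ N (fun l Nl => NP _ _ (leqnn N) Nl).
have := H2_B (uH N) h.
by under eq_fun do rewrite subKr.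
Qed.

Lemma ip_ge0_expand x y (a : R[i]) : H2 x -> H2 y ->
  (nrm2 (fun n => x n - a * y n))%:C =
  (nrm2 x)%:C - conjc a * ip x y - a * ip y x + a * conjc a * (nrm2 y)%:C.
Proof.
move=> xH yH; have ayH := H2_Z a yH.
rewrite -!ip_self//; last exact: H2_B.
rewrite ipBl// ?ipBr// ?ipZl// ?ipZr//; [ring | exact: H2_B..].
Qed.

Lemma nrm2Z (a : R[i]) x : H2 x -> nrm2 (fun n => a * x n) = normc a ^+ 2 * nrm2 x.
Proof.
move=> xH; apply: RtoC_inj.
rewrite -ip_self; last exact: H2_Z.
by rewrite ipZl// ?ipZr// ?ip_self// ?mulrA ?mulcJ -?RtoCM//; exact: H2_Z.
Qed.

Lemma parallelogram x y : H2 x -> H2 y ->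
  nrm2 (fun n => x n - y n) + nrm2 (fun n => x n + y n) = 2 * nrm2 x + 2 * nrm2 y.
Proof.
move=> xH yH; apply: RtoC_inj.
rewrite !RtoCD !RtoCM -!ip_self//; [|exact: H2_D|exact: H2_B].
rewrite ipBl// ?ipBr// ?ipDl// ?ipDr//; [|exact: H2_D|exact: H2_B].
rewrite RtoCn.
ring.
Qed.

Lemma nrm2_le_nrm x (e : R) : H2 x -> 0 <= e -> nrm2 x <= e ^+ 2 -> nrm x <= e.
Proof. by move=> xH e0; rewrite -sqr_nrm// ler_sqr ?nnegrE ?nrm_ge0. Qed.

Definition nrm_closed (M : set (cseq R)) :=
  forall (u : nat -> cseq R) y, (forall k, M (u k)) -> H2 y ->
    (fun k => nrm (fun n => u k n - y n)) @ \oo --> (0 : R) -> M y.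

Definition subspace (M : set (cseq R)) := [/\ M `<=` @H2 R, M (@zero_seq R) &
  forall (al : R[i]) x y, M x -> M y -> M (fun n => al * x n + y n)].

Lemma hilbert_projection M x : subspace M -> nrm_closed M -> H2 x ->
  exists2 y, M y & forall w, M w -> ip (fun n => x n - y n) w = 0.
Proof.
move=> [MH M0 Mlin] Mcl xH.
pose D := [set d : R | exists2 y, M y & d = nrm2 (fun n => x n - y n)].
have Dge0 : lbound D 0.
  by move=> _ [y My ->]; apply: nrm2_ge0; apply: H2_B => //; exact: MH.
have hinf : has_inf D.
  by split; [exists (nrm2 (fun n => x n - zero_seq R n)); exists (@zero_seq R)|exists 0].
pose d := inf D.
have dle y : M y -> d <= nrm2 (fun n => x n - y n).
  by move=> My; apply: ge_inf; [exists 0|exists y].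
have ex k : exists y, M y /\ nrm2 (fun n => x n - y n) < d + k.+1%:R^-1.
  have [|_ [y My ->] h] := @inf_adherent _ D (k.+1%:R^-1) _ hinf.
    by rewrite invr_gt0 ltr0n.
  by exists y.
have [u uP] := choice ex.
have uM k : M (u k) by case: (uP k).
have uH k : H2 (u k) := MH _ (uM k).
have xuH k : H2 (fun n => x n - u k n) := H2_B xH (uH k).
have small (e : R) : 0 < e -> exists N, forall k, (N <= k)%N -> (k.+1%:R : R)^-1 <= e.
  move=> e0; exists (Num.truncn e^-1) => k Nk.
  rewrite -[leRHS]invrK lef_pV2 ?posrE ?ltr0n ?invr_gt0//.
  have := truncnS_gt e^-1 => h; apply: (ltW (lt_le_trans h _)).
  by rewrite ler_nat ltnS.
have uC (e : R) : 0 < e -> exists N, forall k l, (N <= k)%N -> (N <= l)%N ->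
     nrm2 (fun n => u k n - u l n) <= e.
  move=> e0; have e4 : 0 < e / 4 by rewrite divr_gt0.
  have [N NP] := small _ e4; exists N => k l Nk Nl.
  have := parallelogram (xuH l) (xuH k).
  have -> : (fun n => x n - u l n - (x n - u k n)) = (fun n => u k n - u l n).
    by apply/funext => n; ring.
  (* The midpoint of [u k] and [u l], written so that closure under [al * x + y] applies twice. It
     cannot be closer to x than the infimum, so the parallelogram law makes u a Cauchy sequence. *)
  pose v : cseq R := fun n => 2^-1 * u k n + (2^-1 * u l n + zero_seq R n).
  have vM : M v by apply: (Mlin _ _ (fun n => _)) => //; exact: (Mlin _ _ (@zero_seq R)).
  have -> : (fun n => x n - u l n + (x n - u k n)) = (fun n => 2 * (x n - v n)).
    by apply/funext => n; rewrite /v /zero_seq; field.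
  rewrite nrm2Z; last by apply: H2_B => //; exact: MH.
  have -> : normc (2 : R[i]) = 2 :> R.
    by rewrite -RtoCn normc_real normr_nat.
  have := dle _ vM; have := (uP k).2; have := (uP l).2.
  have := NP _ Nk; have := NP _ Nl.
  move: (k.+1%:R^-1) (l.+1%:R^-1) => p q.
  set a := nrm2 _; set b := nrm2 _; set c := nrm2 _; set f := nrm2 _.
  by move=> *; lra.
have [y [yH yP]] := H2_complete uH uC.
have yM : M y.
  apply: (Mcl u) => //; apply/cvgrPdist_lt => e e0.
  have e2 : 0 < (e / 2) ^+ 2 by rewrite exprn_gt0// divr_gt0.
  have [N NP] := yP _ e2; exists N => // k /= Nk.
  rewrite sub0r normrN ger0_norm ?nrm_ge0//.
  apply: (@le_lt_trans _ _ (e / 2)); last lra.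
  by apply: nrm2_le_nrm (NP _ Nk); [exact: H2_B|rewrite divr_ge0// ltW].
exists y => // w wM; have wH := MH _ wM.
have [w0|w0] := eqVneq (nrm2 w) 0.
  by rewrite (nrm2_eq0 wH w0) (ip_conj (@H2_0 R) (H2_B xH yH)) ip0l conjc0.
have nw : 0 < nrm2 w by rewrite lt_neqAle eq_sym w0 nrm2_ge0.
(* Moving [u k] by the best multiple of w lowers the squared distance to x by |c|^2 / |w|^2; this
   cannot exceed the excess of [u k] over the infimum. *)
have approx k : normc (ip (fun n => x n - u k n) w) ^+ 2 <= nrm2 w * k.+1%:R^-1.
  set c := ip _ _; pose a := c / (nrm2 w)%:C.
  have aM : M (fun n => a * w n + u k n) by exact: Mlin.
  have := dle _ aM.
  have -> : (fun n => x n - (a * w n + u k n)) = (fun n => (x n - u k n) - a * w n).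
    by apply/funext => n; ring.
  have E : nrm2 (fun n => x n - u k n - a * w n) =
      nrm2 (fun n => x n - u k n) - normc c ^+ 2 / nrm2 w.
    apply: RtoC_inj.
    rewrite [LHS]ip_ge0_expand// (ip_conj (xuH k) wH) -/c.
    rewrite RtoCB RtoCM -mulcJ RtoCV.
    have -> : conjc a = conjc c / (nrm2 w)%:C.
      by rewrite /a -RtoCV rmorphM; congr (_ * _); apply: eqcP => //=; rewrite oppr0.
    rewrite /a; field.
    by rewrite RtoC_eq0.
  rewrite E => h; have := (uP k).2 => h2.
  have : normc c ^+ 2 / nrm2 w <= k.+1%:R^-1.
    move: (k.+1%:R^-1) (normc c ^+ 2 / nrm2 w) h h2 => p q h h2; lra.
  by rewrite ler_pdivrMr// mulrC.
apply/eqP; rewrite -normc_eq0 eq_le normc_ge0 andbT; apply/ler_addgt0Pl => e e0.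
rewrite addr0.
have e2 : 0 < (e / 2) ^+ 2 by rewrite exprn_gt0// divr_gt0.
have [N NP] := small _ (divr_gt0 e2 nw).
have [N' NP'] := yP _ (divr_gt0 e2 nw).
pose k := maxn N N'.
have -> : ip (fun n => x n - y n) w =
    ip (fun n => x n - u k n) w + ip (fun n => u k n - y n) w.
  rewrite -ipDl//; last exact: H2_B.
  by congr ip; apply/funext => n; ring.
apply: le_trans (le_normcD _ _) _.
have h1 : normc (ip (fun n => x n - u k n) w) <= e / 2.
  rewrite -ler_sqr ?nnegrE ?normc_ge0 ?divr_ge0 ?(ltW e0)//.
  apply: le_trans (approx k) _; rewrite mulrC -ler_pdivlMr//.
  exact: NP (leq_maxl _ _).
have h2 : normc (ip (fun n => u k n - y n) w) <= e / 2.
  have uyH := H2_B (uH k) yH.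
  apply: le_trans (ip_cauchy_schwarz uyH wH) _.
  rewrite -ler_sqr ?nnegrE ?mulr_ge0 ?nrm_ge0 ?divr_ge0 ?(ltW e0)//.
  rewrite exprMn !sqr_nrm// -ler_pdivlMr//.
  exact: NP' (leq_maxr _ _).
lra.
Qed.

End HardyCompleteness.

(** * Cauchy's formula *)

Section RealIntegral.
Variable R : realType.
Local Notation mu := (@lebesgue_measure R).
Implicit Types (a b c : R) (f g : R -> R).

Definition Rint a b f : R := (\int[mu]_(x in `[a, b]) f x)%R.

Lemma Rint_integrable a b f : continuous f -> mu.-integrable `[a, b] (EFin \o f).
Proof.
move=> cf; apply: continuous_compact_integrable; first exact: segment_compact.
exact: continuous_subspaceT.
Qed.

Lemma RintD a b f g : continuous f -> continuous g ->
  Rint a b (fun t => f t + g t) = Rint a b f + Rint a b g.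
Proof. by move=> cf cg; apply: RintegralD => //; exact: Rint_integrable. Qed.

Lemma RintB a b f g : continuous f -> continuous g ->
  Rint a b (fun t => f t - g t) = Rint a b f - Rint a b g.
Proof. by move=> cf cg; apply: RintegralB => //; exact: Rint_integrable. Qed.

Lemma RintZ a b (k : R) f : continuous f ->
  Rint a b (fun t => k * f t) = k * Rint a b f.
Proof. by move=> cf; apply: RintegralZl => //; exact: Rint_integrable. Qed.

Lemma Rint_ext a b f g : (forall t, a <= t <= b -> f t = g t) ->
  Rint a b f = Rint a b g.
Proof. by move=> fg; apply: eq_Rintegral => t; rewrite inE /= in_itv /=; exact: fg. Qed.

Lemma Rint_cst a b (k : R) : a <= b -> Rint a b (fun=> k) = k * (b - a).
Proof.
move=> ab; rewrite /Rint Rintegral_cst//; congr (_ * _).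
apply: etrans (congr1 fine (lebesgue_measure_itv `[a, b])) _.
by rewrite /= lte_fin; case: ltgtP ab => // -> _; rewrite subrr.
Qed.

Lemma Rint_mono a b f g : continuous f -> continuous g ->
  (forall t, a <= t <= b -> f t <= g t) -> Rint a b f <= Rint a b g.
Proof.
move=> cf cg fg; by apply: le_Rintegral => //; exact: Rint_integrable.
Qed.

Lemma Rint_norm_le a b f (K : R) : a <= b -> continuous f ->
  (forall t, a <= t <= b -> `|f t| <= K) -> `|Rint a b f| <= K * (b - a).
Proof.
move=> ab cf fK; have ck : continuous (fun _ : R => K) by move=> ?; exact: cvg_cst.
have ckN : continuous (fun _ : R => - K) by move=> ?; exact: cvg_cst.
rewrite ler_norml; apply/andP; split.
  rewrite -mulNr -Rint_cst//; apply: Rint_mono => // t /fK.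
  by rewrite ler_norml => /andP[].
rewrite -Rint_cst//; apply: Rint_mono => // t /fK.
by rewrite ler_norml => /andP[].
Qed.

Lemma Rint_split a b c f : continuous f -> a <= c <= b ->
  Rint a b f = Rint a c f + Rint c b f.
Proof.
move=> cf /andP[ac cb].
have := @Rintegral_itvB R f (BLeft a) (BRight b) c (Rint_integrable a b cf).
rewrite !bnd_simp => /(_ ac cb) h.
rewrite /Rint -(Rintegral_itv_obnd_cbnd (r := c)).
  by rewrite -h addrC subrK.
by apply: integrableS (Rint_integrable c b cf) => //; exact: subset_itv_oc_cc.
Qed.

Lemma Rint_FTC a b (F f : R -> R) : a <= b -> continuous f ->
  (forall t : R, is_derive t 1 F (f t)) -> Rint a b f = F b - F a.
Proof.
rewrite le_eqVlt => /orP[/eqP <-|ab] cf dF.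
  by rewrite subrr /Rint set_itv1 Rintegral_set1.
have cF : continuous F.
  move=> t; apply: differentiable_continuous; apply/derivable1_diffP.
  by case: (dF t).
rewrite /Rint /Rintegral (@continuous_FTC2 R f F)//=.
- exact: continuous_subspaceT.
- split => [t _| |]; first by case: (dF t).
  + by apply: cvg_at_right_filter; exact: cF.
  + by apply: cvg_at_left_filter; exact: cF.
- by move=> t _; rewrite derive1E; case: (dF t).
Qed.

End RealIntegral.

(** * Integrals of complex-valued functions over an interval *)

Section ComplexIntegral.
Variable R : realType.
Implicit Types (a b c : R) (f g : R -> R[i]).

(** Continuity is recorded by components because [Cint] integrates them separately. *)
Definition ccont f := continuous (fun t => Re (f t)) /\ continuous (fun t => Im (f t)).

Definition Cint a b f : R[i] :=
  Rint a b (fun t => Re (f t)) +i* Rint a b (fun t => Im (f t)).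

Lemma ccont_cst (k : R[i]) : ccont (fun=> k).
Proof. by split => ?; exact: cvg_cst. Qed.

Lemma ccontD f g : ccont f -> ccont g -> ccont (fun t => f t + g t).
Proof.
move=> [f1 f2] [g1 g2]; split.
  rewrite (_ : (fun _ => _) = (fun t => Re (f t) + Re (g t))).
    by move=> t; apply: cvgD; [exact: f1|exact: g1].
  by apply/funext => t; rewrite ReD.
rewrite (_ : (fun _ => _) = (fun t => Im (f t) + Im (g t))).
  by move=> t; apply: cvgD; [exact: f2|exact: g2].
by apply/funext => t; rewrite ImD.
Qed.

Lemma ccontM f g : ccont f -> ccont g -> ccont (fun t => f t * g t).
Proof.
move=> [f1 f2] [g1 g2]; split.
  rewrite (_ : (fun _ => _) = (fun t => Re (f t) * Re (g t) - Im (f t) * Im (g t))).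
    move=> t; apply: cvgB; apply: cvgM;
      by [exact: f1|exact: g1|exact: f2|exact: g2].
  by apply/funext => t; rewrite ReM.
rewrite (_ : (fun _ => _) = (fun t => Re (f t) * Im (g t) + Im (f t) * Re (g t))).
  move=> t; apply: cvgD; apply: cvgM;
    by [exact: f1|exact: g1|exact: f2|exact: g2].
by apply/funext => t; rewrite ImM.
Qed.

Lemma ccont_conj f : ccont f -> ccont (fun t => conjc (f t)).
Proof.
move=> [f1 f2]; split.
  by rewrite (_ : (fun _ => _) = (fun t => Re (f t)))//; apply/funext => t; case: (f t).
rewrite (_ : (fun _ => _) = (fun t => - Im (f t))); last by apply/funext => t; case: (f t).
by move=> t; apply: cvgN; exact: f2.
Qed.

Lemma ccont_sub f g : ccont f -> ccont g -> ccont (fun t => f t - g t).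
Proof.
move=> cf cg; rewrite (_ : (fun _ => _) = (fun t => f t + (-1) * g t)).
  by apply: ccontD => //; apply: ccontM => //; exact: ccont_cst.
by apply/funext => t; rewrite mulN1r.
Qed.

Lemma ccontP f : (forall (t e : R), 0 < e -> exists2 d : R, 0 < d &
    forall s, `|s - t| < d -> normc (f s - f t) < e) -> ccont f.
Proof.
move=> H; split => t; apply/cvgrPdist_lt => e e0; have [d d0 dP] := H t e e0.
  exists d => //= s; rewrite /ball /= distrC => /dP; rewrite distrC -ReB.
  by apply: le_lt_trans; exact: Re_le_normc.
exists d => //= s; rewrite /ball /= distrC => /dP; rewrite distrC -ImB.
by apply: le_lt_trans; exact: Im_le_normc.
Qed.

Lemma ccont_eps f (t e : R) : ccont f -> 0 < e ->
  exists2 d : R, 0 < d & forall s, `|s - t| < d -> normc (f s - f t) < e.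
Proof.
move=> [cr ci] e0; have e2 : 0 < e / 2 by rewrite divr_gt0.
have /cvgrPdist_lt/(_ _ e2)[d1 /= d10 h1] := cr t.
have /cvgrPdist_lt/(_ _ e2)[d2 /= d20 h2] := ci t.
exists (Num.min d1 d2); first by rewrite lt_min d10.
move=> s; rewrite lt_min => /andP[s1 s2].
have := h1 s; rewrite /ball /= distrC => /(_ s1); rewrite distrC -ReB => k1.
have := h2 s; rewrite /ball /= distrC => /(_ s2); rewrite distrC -ImB => k2.
apply: le_lt_trans (normc_le_ReIm _) _; lra.
Qed.

Lemma ccont_normc_sq f : ccont f -> continuous (fun t => normc (f t) ^+ 2).
Proof.
move=> [cr ci]; rewrite (_ : (fun _ => _) = (fun t => Re (f t) * Re (f t) + Im (f t) * Im (f t))).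
  by move=> t; apply: cvgD; apply: cvgM; [exact: cr|exact: cr|exact: ci|exact: ci].
by apply/funext => t; rewrite sqr_normcE !expr2.
Qed.

Lemma CintD a b f g : ccont f -> ccont g ->
  Cint a b (fun t => f t + g t) = Cint a b f + Cint a b g.
Proof.
move=> [f1 f2] [g1 g2]; rewrite /Cint; apply: eqcP; rewrite ?ReD ?ImD /= -RintD//.
  by apply: Rint_ext => t _; rewrite ReD.
by apply: Rint_ext => t _; rewrite ImD.
Qed.

Lemma CintZ a b (k : R[i]) f : ccont f ->
  Cint a b (fun t => k * f t) = k * Cint a b f.
Proof.
move=> [f1 f2].
have cz (l : R) (h : R -> R) : continuous h -> continuous (fun t => l * h t).
  by move=> ch t; apply: cvgM; [exact: cvg_cst|exact: ch].
rewrite /Cint; apply: eqcP; rewrite ?ReM ?ImM /= -!RintZ//.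
  rewrite -RintB//; try exact: cz.
  by apply: Rint_ext => t _; rewrite ReM.
rewrite -RintD//; try exact: cz.
by apply: Rint_ext => t _; rewrite ImM.
Qed.

Lemma CintB a b f g : ccont f -> ccont g ->
  Cint a b (fun t => f t - g t) = Cint a b f - Cint a b g.
Proof.
move=> cf cg; rewrite -mulN1r -CintZ// -CintD//; last first.
  by apply: ccontM => //; exact: ccont_cst.
by congr Cint; apply/funext => t; rewrite mulN1r.
Qed.

Lemma Cint_split a b c f : ccont f -> a <= c <= b ->
  Cint a b f = Cint a c f + Cint c b f.
Proof.
move=> [f1 f2] acb; apply: eqcP; rewrite ?ReD ?ImD /=.
  exact: Rint_split f1 acb.
exact: Rint_split f2 acb.
Qed.

(** The factor 2 stems from estimating real and imaginary parts separately. It is the origin of the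
    2 in the coefficient bounds [2 * M]. *)
Lemma Cint_le a b f (K : R) : a <= b -> ccont f ->
  (forall t, a <= t <= b -> normc (f t) <= K) ->
  normc (Cint a b f) <= 2 * K * (b - a).
Proof.
move=> ab [f1 f2] fK; apply: le_trans (normc_le_ReIm _) _.
rewrite mulr2n 2!mulrDl !mul1r; apply: lerD.
  by apply: Rint_norm_le => // t /fK; apply: le_trans; exact: Re_le_normc.
by apply: Rint_norm_le => // t /fK; apply: le_trans; exact: Im_le_normc.
Qed.

Lemma Cint_cst a b (k : R[i]) : a <= b -> Cint a b (fun=> k) = k * (b - a)%:C.
Proof.
move=> ab; rewrite /Cint !Rint_cst//; case: k => x y; apply: eqcP; rewrite ?ReM ?ImM /=; ring.
Qed.

Lemma Cint_sum a b (F : nat -> R -> R[i]) n : (forall k, ccont (F k)) ->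
  ccont (fun t => \sum_(0 <= k < n) F k t) /\
  Cint a b (fun t => \sum_(0 <= k < n) F k t) = \sum_(0 <= k < n) Cint a b (F k).
Proof.
move=> cF; elim: n => [|n [IH1 IH2]].
  rewrite (_ : (fun _ => _) = (fun=> 0)); last by apply/funext => t; rewrite big_geq.
  split; first exact: ccont_cst.
  rewrite big_geq//; have c0 := @ccont_cst 0.
  have := CintB a b c0 c0; rewrite [in RHS]subrr => E; apply: etrans E.
  by congr Cint; apply/funext => t; rewrite subrr.
rewrite (_ : (fun _ => _) = (fun t => \sum_(0 <= k < n) F k t + F n t)).
  split; first exact: ccontD.
  by rewrite CintD// IH2 big_nat_recr.
by apply/funext => t; rewrite big_nat_recr.
Qed.

Lemma cexpiD (s t : R) : cexpi (s + t) = cexpi s * cexpi t.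
Proof. by rewrite /cexpi cosD sinD; apply: eqcP; rewrite ?ReM ?ImM /=; ring. Qed.

Lemma cexpi0 : cexpi (0 : R) = 1.
Proof. by rewrite /cexpi cos0 sin0. Qed.

Lemma cexpiX (t : R) n : cexpi t ^+ n = cexpi (n%:R * t).
Proof.
elim: n => [|n IH]; first by rewrite mul0r cexpi0.
by rewrite exprS IH -cexpiD -{1}(mul1r t) -mulrDl -natr1 addrC.
Qed.

Lemma normc_cexpi (t : R) : normc (cexpi t) = 1.
Proof.
by apply/eqP; rewrite -sqrp_eq1 ?normc_ge0// sqr_normcE /= cos2Dsin2.
Qed.

Lemma cexpi_2pi : cexpi (2 * pi : R) = 1.
Proof. by rewrite /cexpi mulr_natl cos2pi sin2pi. Qed.

Lemma ccont_cexpi (k : R) : ccont (fun t => cexpi (k * t)).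
Proof.
have c : continuous (fun t : R => k * t).
  by move=> t; apply: cvgM; [exact: cvg_cst|exact: cvg_id].
split => t.
  exact: (@continuous_comp _ _ _ (fun t => k * t) cos t (c t) (@continuous_cos R _)).
exact: (@continuous_comp _ _ _ (fun t => k * t) sin t (c t) (@continuous_sin R _)).
Qed.

Lemma Cint_cexpi (k a b : R) : a <= b ->
  Cint a b (fun t => (0 +i* k) * cexpi (k * t)) = cexpi (k * b) - cexpi (k * a).
Proof.
move=> ab; have [c1 c2] := ccontM (ccont_cst (0 +i* k)) (ccont_cexpi k).
have dk (t : R) : is_derive t 1 (fun t : R => k * t) k.
  by apply: is_derive_eq; rewrite /= ?scaler0 ?add0r ?addr0 /GRing.scale /= mulr1.
apply: eqcP; rewrite ?ReB ?ImB /=.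
  apply: (@Rint_FTC _ a b (fun t => cos (k * t)) _ ab c1) => t.
  have h := @is_derive1_comp R cos (fun t => k * t) t _ _ (is_derive_cos (k * t)) (dk t).
  by apply: (is_derive_eq h); rewrite ReM /= mul0r sub0r mulNr mulrC.
apply: (@Rint_FTC _ a b (fun t => sin (k * t)) _ ab c2) => t.
have h := @is_derive1_comp R sin (fun t => k * t) t _ _ (is_derive_sin (k * t)) (dk t).
by apply: (is_derive_eq h); rewrite ImM /= mul0r add0r mulrC.
Qed.

Lemma Cint_cexpi_period (k : nat) : (0 < k)%N ->
  Cint 0 (2 * pi) (fun t => cexpi t ^+ k) = 0.
Proof.
move=> k0; have pi0 : 0 <= 2 * pi :> R by rewrite mulr_ge0// pi_ge0.
have := Cint_cexpi k%:R pi0; rewrite mulr0 cexpi0 -cexpiX cexpi_2pi expr1n subrr.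
rewrite CintZ; last exact: ccont_cexpi.
move=> /eqP; rewrite mulf_eq0 => /orP[/eqP[/eqP]|/eqP <-].
  by rewrite pnatr_eq0; case: k k0.
by congr Cint; apply/funext => t; rewrite cexpiX.
Qed.

Lemma Cint_conj a b f : ccont f -> Cint a b (fun t => conjc (f t)) = conjc (Cint a b f).
Proof.
move=> [f1 f2]; apply: eqcP => /=.
  by apply: Rint_ext => t _; case: (f t).
rewrite -mulN1r -RintZ//; apply: Rint_ext => t _; rewrite mulN1r.
by case: (f t).
Qed.

End ComplexIntegral.

(** * Goursat's bisection for a subadditive function of rectangles *)

Section Bisection.
Variable R : realType.
Variables (I : R -> R -> R -> R -> R) (s0 t0 A B : R).
Hypotheses (A0 : 0 <= A) (B0 : 0 <= B).
Hypothesis I_sub : forall s t a b, 0 <= a -> 0 <= b ->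
  s0 <= s -> s + a <= s0 + A -> t0 <= t -> t + b <= t0 + B ->
  I s t a b <= I s t (a / 2) (b / 2) + I (s + a / 2) t (a / 2) (b / 2) +
    (I s (t + b / 2) (a / 2) (b / 2) + I (s + a / 2) (t + b / 2) (a / 2) (b / 2)).
Hypothesis I_loc : forall s' t' e, s0 <= s' <= s0 + A -> t0 <= t' <= t0 + B -> 0 < e ->
  exists2 d, 0 < d & forall s t a b, 0 <= a < d -> 0 <= b < d ->
    s0 <= s -> s + a <= s0 + A -> t0 <= t -> t + b <= t0 + B ->
    s <= s' <= s + a -> t <= t' <= t + b -> I s t a b <= e * (a + b) ^+ 2.

Let good h n (p : R * R) :=
  [/\ s0 <= p.1, p.1 + A / 2 ^+ n <= s0 + A, t0 <= p.2, p.2 + B / 2 ^+ n <= t0 + B &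
   h / 4 ^+ n <= I p.1 p.2 (A / 2 ^+ n) (B / 2 ^+ n)].

Let nested n (p q : R * R) :=
  [/\ p.1 <= q.1, q.1 + A / 2 ^+ n.+1 <= p.1 + A / 2 ^+ n, p.2 <= q.2 &
      q.2 + B / 2 ^+ n.+1 <= p.2 + B / 2 ^+ n].

Let half (x : R) n : x / 2 ^+ n.+1 = x / 2 ^+ n / 2.
Proof. by rewrite exprSr; field; rewrite expf_neq0. Qed.

Let good_step h n p : good h n p -> exists q, good h n.+1 q /\ nested n p q.
Proof.
move=> [h1 h2 h3 h4 h5].
have a0 : 0 <= A / 2 ^+ n by rewrite divr_ge0// exprn_ge0.
have b0 : 0 <= B / 2 ^+ n by rewrite divr_ge0// exprn_ge0.
have := I_sub a0 b0 h1 h2 h3 h4.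
have e4 : h / 4 ^+ n.+1 = h / 4 ^+ n / 4.
  by rewrite exprSr; field; rewrite expf_neq0// pnatr_eq0.
rewrite /good /nested !half e4.
move: (A / 2 ^+ n) (B / 2 ^+ n) a0 b0 h2 h4 h5 => a b a0 b0 h2 h4 h5.
move: (h / 4 ^+ n) h5 => k h5 hs.
have [c|c] := leP (k / 4) (I p.1 p.2 (a / 2) (b / 2)).
  by exists p; split; split => //; lra.
have [c2|c2] := leP (k / 4) (I (p.1 + a / 2) p.2 (a / 2) (b / 2)).
  by exists (p.1 + a / 2, p.2); split; split => //=; lra.
have [c3|c3] := leP (k / 4) (I p.1 (p.2 + b / 2) (a / 2) (b / 2)).
  by exists (p.1, p.2 + b / 2); split; split => //=; lra.
by exists (p.1 + a / 2, p.2 + b / 2); split; split => //=; lra.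
Qed.

(** If the value were h > 0, subadditivity would give one quarter at least h / 4, and so on. The
    nested rectangles shrink to a point, where [I_loc] bounds the value by e (a + b)^2; this decays
    like 4^-n too, and a small e contradicts h / 4^n. *)
Lemma rectangle_bisection : I s0 t0 A B <= 0.
Proof.
rewrite leNgt; apply/negP => h0; set h := I s0 t0 A B in h0.
have [F FP] : exists F : nat * (R * R) -> R * R, forall x, good h x.1 x.2 ->
    good h x.1.+1 (F x) /\ nested x.1 x.2 (F x).
  have /choice[F FP] : forall x : nat * (R * R), exists q, good h x.1 x.2 ->
      good h x.1.+1 q /\ nested x.1 x.2 q.
    move=> [n p] /=; have [/good_step[q H]|ng] := pselect (good h n p).
      by exists q.
    by exists p => /ng.
  by exists F.
pose P := fix P n := if n is k.+1 then F (k, P k) else (s0, t0).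
have PG n : good h n (P n).
  elim: n => [|n IH]; last by have [] := FP (n, P n) IH.
  by rewrite /good /= !expr0 !divr1; split.
have PN n : nested n (P n) (P n.+1) by have [] := FP (n, P n) (PG n).
have lim (g : R * R -> R) C : (forall n, g (P n) <= g (P n.+1)) ->
   (forall n, g (P n.+1) + C / 2 ^+ n.+1 <= g (P n) + C / 2 ^+ n) -> 0 <= C ->
   exists x, forall n, g (P n) <= x <= g (P n) + C / 2 ^+ n.
  move=> inc dec C0.
  have incr n k : g (P n) <= g (P (n + k)%N).
    by elim: k => [|k IH]; [rewrite addn0|rewrite addnS (le_trans IH)].
  have decr n k : g (P (n + k)%N) + C / 2 ^+ (n + k) <= g (P n) + C / 2 ^+ n.
    by elim: k => [|k IH]; [rewrite addn0|rewrite addnS (le_trans _ IH)].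
  have c0 n : 0 <= C / 2 ^+ n by rewrite divr_ge0// exprn_ge0.
  have ub n k : g (P n) <= g (P k) + C / 2 ^+ k.
    have [nk|/ltnW kn] := leqP n k.
      rewrite -(subnKC nk); have := incr n (k - n)%N; have := c0 (n + (k - n))%N; lra.
    rewrite -(subnKC kn); have := decr k (n - k)%N; have := c0 (k + (n - k))%N; lra.
  have hs : has_sup [set y | exists n, y = g (P n)].
    split; first by exists (g (P 0%N)); exists 0%N.
    by exists (g (P 0%N) + C / 2 ^+ 0) => _ [n ->]; exact: ub.
  exists (sup [set y | exists n, y = g (P n)]) => n; apply/andP; split.
    by apply: ub_le_sup; [case: hs|exists n].
  by apply: ge_sup; [case: hs|move=> _ [k ->]; exact: ub].
have [s' sP] := @lim fst A (fun n => let: And4 x _ _ _ := PN n in x)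
  (fun n => let: And4 _ x _ _ := PN n in x) A0.
have [t' tP] := @lim snd B (fun n => let: And4 _ _ x _ := PN n in x)
  (fun n => let: And4 _ _ _ x := PN n in x) B0.
(* Chosen so that e (A + B)^2 < h; the summand 1 covers A + B = 0. *)
have e0 : 0 < h / ((A + B) ^+ 2 + 1).
  by rewrite divr_gt0// ltr_wpDl// sqr_ge0.
have s'i : s0 <= s' <= s0 + A by have := sP 0%N; rewrite /= expr0 divr1.
have t'i : t0 <= t' <= t0 + B by have := tP 0%N; rewrite /= expr0 divr1.
have [d d0 dP] := I_loc s'i t'i e0.
pose n := (Num.truncn ((A + B) / d)).+1.
have nd : (A + B) / 2 ^+ n < d.
  rewrite ltr_pdivrMr ?exprn_gt0// mulrC -ltr_pdivrMr//.
  apply: lt_le_trans (truncnS_gt _) _; rewrite -natrX ler_nat.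
  exact: ltnW (ltn_expl _ _).
have a0 : 0 <= A / 2 ^+ n by rewrite divr_ge0// exprn_ge0.
have b0 : 0 <= B / 2 ^+ n by rewrite divr_ge0// exprn_ge0.
rewrite mulrDl in nd.
have [g1 g2 g3 g4 g5] := PG n.
have := dP _ _ (A / 2 ^+ n) (B / 2 ^+ n) _ _ g1 g2 g3 g4 (sP n) (tP n).
rewrite a0 b0 /=.
move=> /(_ ltac:(lra) ltac:(lra)) hle.
have := le_trans g5 hle.
rewrite -mulrDl expr_div_n -exprM mulnC exprM (_ : (2 ^+ 2 : R) = 4); last by ring.
rewrite mulrA ler_pM2r ?invr_gt0 ?exprn_gt0//.
rewrite mulrAC ler_pdivlMr; last by rewrite ltr_wpDl// sqr_ge0.
by rewrite mulrDr mulr1 gerDl leNgt h0.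
Qed.

End Bisection.

Section ComplexDifferentiability.
Variable R : realType.
Implicit Types (f : R[i] -> R[i]) (z w : R[i]).

Lemma derivable_eps f z : derivable f z 1 -> exists d : R[i], forall e : R, 0 < e ->
  exists2 r : R, 0 < r & forall w, normc (w - z) < r ->
    normc (f w - f z - d * (w - z)) <= e * normc (w - z).
Proof.
move=> /cvg_ex[d /cvgrPdist_lt hd]; exists d => e e0.
have /hd[r /= r0 rP] : 0 < e%:C by rewrite ltc_real.
have [rE r0'] := posc r0; exists (Re r) => // w wz.
have [->|wz0] := eqVneq w z.
  by rewrite !subrr mulr0 subrr normc00 mulr0.
have wz1 : w - z != 0 by rewrite subr_eq0.
have := rP (w - z); rewrite /ball /= sub0r normrN abscE rE ltc_real => /(_ wz wz1).
rewrite abscE ltc_real /GRing.scale /= mulr1 subrK => h.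
have -> : f w - f z - d * (w - z) = - (d - (w - z)^-1 * (f w - f z)) * (w - z).
  by field.
by rewrite normcMM normcN ler_wpM2r ?normc_ge0// ltW.
Qed.

Lemma derivable_cont f z : derivable f z 1 -> forall e : R, 0 < e ->
  exists2 r : R, 0 < r & forall w, normc (w - z) < r -> normc (f w - f z) < e.
Proof.
move=> /derivable_eps[d dP] e e0; have [r r0 rP] := dP 1 ltr01.
have k0 : 0 < normc d + 1 by rewrite ltr_wpDl ?normc_ge0.
exists (Num.min r (e / (normc d + 1))); first by rewrite lt_min r0 divr_gt0.
move=> w; rewrite lt_min => /andP[/rP h]; rewrite ltr_pdivlMr// => h2.
have -> : f w - f z = (f w - f z - d * (w - z)) + d * (w - z) by ring.
apply: le_lt_trans (le_normcD _ _) _; rewrite normcMM; lra.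
Qed.

Lemma ccont_comp f (g : R -> R[i]) : ccont g -> (forall t, derivable f (g t) 1) ->
  ccont (fun t => f (g t)).
Proof.
move=> cg df; apply: ccontP => t e e0.
have [r r0 rP] := derivable_cont (df t) e0.
have [d d0 dP] := ccont_eps t cg r0; exists d => // s /dP; exact: rP.
Qed.

Lemma ccontV (g : R -> R[i]) : ccont g -> (forall t, g t != 0) ->
  ccont (fun t => (g t)^-1).
Proof.
move=> cg g0; have cn := ccont_normc_sq cg.
have n0 t : normc (g t) ^+ 2 != 0 by rewrite sqrf_eq0 normc_eq0.
have cv : ccont (fun t => ((normc (g t) ^+ 2)^-1)%:C).
  by split => t /=; [apply: cvgV; [exact: n0|exact: cn]|exact: cvg_cst].
rewrite (_ : (fun _ => _) = (fun t => conjc (g t) * ((normc (g t) ^+ 2)^-1)%:C)).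
  by apply: ccontM => //; exact: ccont_conj.
apply/funext => t; rewrite RtoCV -mulcJ; field.
by rewrite conjc_eq0 g0.
Qed.

End ComplexDifferentiability.

(** * Cauchy's formula on a circle, in logarithmic coordinates on the cone *)

Section CauchyFormula.
Variable R : realType.

Let ii : R[i] := 0 +i* 1.

Let normc_ii : normc ii = 1.
Proof. by apply/eqP; rewrite -sqrp_eq1 ?normc_ge0// sqr_normcE /= expr0n expr1n add0r. Qed.

Variables (f : R[i] -> R[i]) (z0 : R[i]) (r : R).
Hypothesis df : holomorphic_on_disc f.
Hypotheses (z0r : normc z0 < r) (r1 : r < 1).

Let r0 : 0 < r. Proof. exact: le_lt_trans (normc_ge0 _) z0r. Qed.

Let v (t : R) : R[i] := r%:C * cexpi t - z0.

Let normc_circle (t : R) : normc (r%:C * cexpi t) = r.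
Proof. by rewrite normcMM normc_cexpi mulr1 normc_real gtr0_norm. Qed.

Let v_ge t : r - normc z0 <= normc (v t).
Proof.
have := le_normcD (v t) z0; rewrite subrK normc_circle; lra.
Qed.

Let v_neq0 t : v t != 0.
Proof. rewrite -normc_gt0; apply: lt_le_trans (v_ge t); rewrite subr_gt0; exact: z0r. Qed.

Let v_le t : normc (v t) <= 2.
Proof. apply: le_trans (normc_sub _ _) _; rewrite normc_circle; move: z0r r1; lra. Qed.

Let ccirc : ccont (fun t : R => r%:C * cexpi t).
Proof.
apply: ccontM; first exact: ccont_cst.
by have := ccont_cexpi (1 : R); under eq_fun do rewrite mul1r.
Qed.

Let cv : ccont v.
Proof. by apply: ccont_sub => //; exact: ccont_cst. Qed.

(* kappa = v' / v *)
Let kappa (t : R) : R[i] := ii * (r%:C * cexpi t) / v t.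

Let ckappa : ccont kappa.
Proof.
apply: ccontM; first by apply: ccontM => //; exact: ccont_cst.
exact: ccontV.
Qed.

Let Kb : R := (r - normc z0)^-1.

Let Kb_gt0 : 0 < Kb. Proof. by rewrite invr_gt0 subr_gt0. Qed.

Let kappa_le t : normc (kappa t) <= Kb.
Proof.
rewrite normcMM normcMM normc_circle normcVV.
rewrite normc_ii.
rewrite mul1r; apply: (@le_trans _ _ (1 * Kb)); last by rewrite mul1r.
apply: ler_pM; [exact: ltW|by rewrite invr_ge0 normc_ge0|exact: ltW|].
by rewrite lef_pV2 ?posrE ?subr_gt0 ?normc_gt0.
Qed.

(* The clamp makes the radial variable range over the whole line. *)
Let lam (s : R) : R := expR (Num.min s 0).

Let lamE s : s <= 0 -> lam s = expR s.
Proof. by move=> s0; rewrite /lam min_l. Qed.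

Let lam_gt0 s : 0 < lam s. Proof. exact: expR_gt0. Qed.
Let lam_le1 s : lam s <= 1.
Proof. by rewrite /lam -expR0 ler_expR ge_min lexx orbT. Qed.

Let clam : continuous lam.
Proof.
move=> s.
have h : {for s, continuous (fun s : R => Num.min s 0)}.
  by apply: continuous_min; [exact: cvg_id|exact: cvg_cst].
exact: (@continuous_comp _ _ _ _ expR s h (@continuous_expR R _)).
Qed.

Let cclam : ccont (fun s => (lam s)%:C).
Proof. by split => s /=; [exact: clam|exact: cvg_cst]. Qed.

Let w s t := z0 + (lam s)%:C * v t.

Let w_disc s t : in_disc (w s t).
Proof.
rewrite /in_disc.
have -> : w s t = (1 - lam s)%:C * z0 + (lam s)%:C * (r%:C * cexpi t).
  by rewrite /w /v RtoCB; ring.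
apply: le_lt_trans (le_normcD _ _) _.
rewrite !normcMM !normc_real normc_cexpi ger0_norm ?subr_ge0 ?lam_le1//.
rewrite (gtr0_norm (lam_gt0 s)) (gtr0_norm r0).
have := lam_gt0 s; have := lam_le1 s; have := normc_ge0 z0.
move: (lam s) (normc z0) z0r r1 => l n nr1 r1' n0 l1 l0.
have : (1 - l) * n <= (1 - l) * r by rewrite ler_wpM2l ?subr_ge0// ltW.
lra.
Qed.

(** For w = z0 + e^s v(t) one has dw / (w - z0) = ds + kappa dt. This is thus the integral of u dw /
    (w - z0) along the boundary of the rectangle with corner (s, t) and sides a, b. The apex z0 sits
    at s = -oo, and the coefficients of the form stay bounded on the way there. *)
Definition path_form (u : R -> R -> R[i]) s t a b : R[i] :=
  Cint s (s + a) (u ^~ t) - Cint s (s + a) (u ^~ (t + b)) +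
  (Cint t (t + b) (fun y => u (s + a) y * kappa y) -
   Cint t (t + b) (fun y => u s y * kappa y)).

Definition sep_ccont (u : R -> R -> R[i]) :=
  (forall t, ccont (u ^~ t)) /\ (forall s, ccont (u s)).

Lemma path_form_lin (c : R[i]) u1 u2 s t a b : sep_ccont u1 -> sep_ccont u2 ->
  path_form (fun x y => c * u1 x y + u2 x y) s t a b =
  c * path_form u1 s t a b + path_form u2 s t a b.
Proof.
move=> [p1 q1] [p2 q2]; rewrite /path_form.
have cz (g : R -> R[i]) : ccont g -> ccont (fun x => c * g x).
  by move=> cg; apply: ccontM => //; exact: ccont_cst.
have ck (g : R -> R[i]) : ccont g -> ccont (fun x => g x * kappa x).
  by move=> cg; exact: ccontM.
have H1 y : Cint s (s + a) (fun x => c * u1 x y + u2 x y) =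
    c * Cint s (s + a) (u1 ^~ y) + Cint s (s + a) (u2 ^~ y).
  by rewrite CintD ?CintZ//; exact: cz.
have H2 x : Cint t (t + b) (fun y => (c * u1 x y + u2 x y) * kappa y) =
    c * Cint t (t + b) (fun y => u1 x y * kappa y) + Cint t (t + b) (fun y => u2 x y * kappa y).
  rewrite -CintZ; last exact: ck.
  rewrite -CintD; [|by apply: cz; exact: ck|exact: ck].
  by congr Cint; apply/funext => y; ring.
by rewrite !H1 !H2; ring.
Qed.

(** In ds + kappa dt the variables are separated, so opposite sides cancel. *)
Lemma path_form_cst s t a b : path_form (fun _ _ => 1) s t a b = 0.
Proof. by rewrite /path_form !subrr addr0. Qed.

Let cint_v' t b : 0 <= b ->
  Cint t (t + b) (fun y => v y * kappa y) = v (t + b) - v t.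
Proof.
move=> b0; have -> : v (t + b) - v t = r%:C * (cexpi (t + b) - cexpi t) by rewrite /v; ring.
have tb : t <= t + b by lra.
have := Cint_cexpi 1 tb; rewrite !mul1r => <-.
have ce : ccont (fun y : R => (0 +i* 1) * cexpi (1 * y)).
  by apply: ccontM; [exact: ccont_cst|exact: ccont_cexpi].
rewrite -CintZ//; congr Cint; apply/funext => y; rewrite mul1r /kappa.
rewrite -/ii.
by have := v_neq0 y; move: (v y) (cexpi y) => vy c vy0; field.
Qed.

Let cint_lam s a : 0 <= a -> s + a <= 0 ->
  Cint s (s + a) (fun x => (lam x)%:C) = (expR (s + a) - expR s)%:C.
Proof.
move=> a0 sa; rewrite /Cint /=; apply: eqcP => /=.
  rewrite (@Rint_ext _ _ _ _ expR); last first.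
    by move=> x /andP[_ x2]; rewrite lamE//; lra.
  apply: Rint_FTC; [lra|exact: continuous_expR].
by rewrite Rint_cst; [rewrite mul0r|lra].
Qed.

Let csep_lin : sep_ccont (fun x y => (lam x)%:C * v y).
Proof.
split=> [t|s]; apply: ccontM => //; exact: ccont_cst.
Qed.

(** Here u is w - z0, and the form becomes the exact form dw. The bound [s + a <= 0] keeps the
    rectangle where [lam] is the exponential. *)
Lemma path_form_lin0 s t a b : 0 <= a -> 0 <= b -> s + a <= 0 ->
  path_form (fun x y => (lam x)%:C * v y) s t a b = 0.
Proof.
move=> a0 b0 sa; rewrite /path_form.
have H1 y : Cint s (s + a) (fun x => (lam x)%:C * v y) = v y * (expR (s + a) - expR s)%:C.
  rewrite -cint_lam// -CintZ//; congr Cint; apply/funext => x; ring.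
have H2 x : x <= 0 -> Cint t (t + b) (fun y => (lam x)%:C * v y * kappa y) =
    (expR x)%:C * (v (t + b) - v t).
  move=> x0; rewrite -cint_v'// -CintZ; last exact: ccontM.
  by congr Cint; apply/funext => y; rewrite lamE//; ring.
rewrite !H1 !H2//; [|lra]; rewrite RtoCB; ring.
Qed.

Lemma path_form_le u s t a b (K : R) : 0 <= a -> 0 <= b -> sep_ccont u -> 0 <= K ->
  (forall x y, s <= x <= s + a -> t <= y <= t + b -> normc (u x y) <= K) ->
  normc (path_form u s t a b) <= 4 * K * (1 + Kb) * (a + b).
Proof.
move=> a0 b0 [p q] K0 uK; rewrite /path_form.
have H1 y : t <= y <= t + b -> normc (Cint s (s + a) (u ^~ y)) <= 2 * K * a.
  move=> ty; have -> : 2 * K * a = 2 * K * (s + a - s) by ring.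
  by apply: Cint_le => //; [lra|move=> x xs; exact: uK].
have H2 x : s <= x <= s + a -> normc (Cint t (t + b) (fun y => u x y * kappa y)) <=
    2 * (K * Kb) * b.
  move=> sx; have -> : 2 * (K * Kb) * b = 2 * (K * Kb) * (t + b - t) by ring.
  apply: Cint_le => //; [lra|exact: ccontM|move=> y yt; rewrite normcMM].
  by apply: ler_pM; rewrite ?normc_ge0//; exact: uK.
apply: le_trans (le_normcD _ _) _.
have n1 := normc_sub (Cint s (s + a) (u ^~ t)) (Cint s (s + a) (u ^~ (t + b))).
have n2 := normc_sub (Cint t (t + b) (fun y => u (s + a) y * kappa y)) (Cint t (t + b) (fun y => u s y * kappa y)).
have h1 := H1 t; have h2 := H1 (t + b); have h3 := H2 s; have h4 := H2 (s + a).
have {}h1 : _ := h1 ltac:(lra); have {}h2 : _ := h2 ltac:(lra).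
have {}h3 : _ := h3 ltac:(lra); have {}h4 : _ := h4 ltac:(lra).
apply: le_trans (lerD n1 n2) _.
apply: (@le_trans _ _ (4 * K * a + 4 * K * Kb * b)); first lra.
have : 0 <= K * b by exact: mulr_ge0.
have : 0 <= K * Kb * a by rewrite !mulr_ge0// ltW.
lra.
Qed.

Lemma path_form_split u s t a b : 0 <= a -> 0 <= b -> sep_ccont u ->
  path_form u s t a b =
  path_form u s t (a / 2) (b / 2) + path_form u (s + a / 2) t (a / 2) (b / 2) +
  (path_form u s (t + b / 2) (a / 2) (b / 2) +
   path_form u (s + a / 2) (t + b / 2) (a / 2) (b / 2)).
Proof.
move=> a0 b0 [p q]; rewrite /path_form.
have ea : s + a / 2 + a / 2 = s + a by field.
have eb : t + b / 2 + b / 2 = t + b by field.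
rewrite ea eb.
have H1 y : Cint s (s + a) (u ^~ y) =
    Cint s (s + a / 2) (u ^~ y) + Cint (s + a / 2) (s + a) (u ^~ y).
  by apply: Cint_split => //; lra.
have H2 x : Cint t (t + b) (fun y => u x y * kappa y) =
    Cint t (t + b / 2) (fun y => u x y * kappa y) +
    Cint (t + b / 2) (t + b) (fun y => u x y * kappa y).
  by apply: Cint_split => //; [exact: ccontM|lra].
rewrite !H1 !H2; ring.
Qed.

Let u s t := f (w s t) - f z0.

Let cw : sep_ccont w.
Proof.
split=> [t|s].
  exact: (ccontD (ccont_cst z0) (ccontM cclam (ccont_cst (v t)))).
exact: (ccontD (ccont_cst z0) (ccontM (ccont_cst (lam s)%:C) cv)).
Qed.

Let cu : sep_ccont u.
Proof.
have [w1 w2] := cw.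
split=> [t|s]; (apply: ccont_sub; last exact: ccont_cst);
  by apply: ccont_comp => // x; apply: df.
Qed.

Let lam_lip x y : x <= 0 -> y <= 0 -> `|lam x - lam y| <= `|x - y|.
Proof.
wlog xy : x y / x <= y.
  move=> H x0 y0; have [xy|/ltW xy] := leP x y; first exact: H.
  by rewrite (distrC (lam x)) (distrC x); exact: H.
move=> x0 y0; rewrite (distrC (lam x)) (distrC x) !lamE//.
rewrite -(Rint_FTC xy (@continuous_expR R) (@is_derive_expR R)).
rewrite (@ger0_norm _ (y - x)) ?subr_ge0// -[leRHS]mul1r; apply: Rint_norm_le => //.
  exact: continuous_expR.
move=> t /andP[_ ty]; rewrite gtr0_norm ?expR_gt0// -expR0 ler_expR; lra.
Qed.

Let v_lip x y : normc (v x - v y) <= 2 * `|x - y|.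
Proof.
wlog xy : x y / x <= y.
  move=> H; have [/H//|/ltW/H] := leP x y.
  by rewrite normc_subC distrC.
rewrite normc_subC distrC (@ger0_norm _ (y - x)) ?subr_ge0//.
have y0 : 0 <= y - x by rewrite subr_ge0.
have := cint_v' x y0; rewrite (_ : x + (y - x) = y); last by ring.
move=> <-; rewrite -[2 in leRHS]mulr1; apply: Cint_le => //; first exact: ccontM.
move=> t _; rewrite /kappa mulrCA divff// mulr1 normcMM normc_circle.
rewrite normc_ii.
by rewrite mul1r ltW.
Qed.

Let w_lip x y x' y' : x <= 0 -> x' <= 0 ->
  normc (w x y - w x' y') <= 2 * (`|x - x'| + `|y - y'|).
Proof.
move=> x0 x'0.
have -> : w x y - w x' y' = (lam x - lam x')%:C * v y + (lam x')%:C * (v y - v y').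
  by rewrite /w RtoCB; ring.
apply: le_trans (le_normcD _ _) _; rewrite !normcMM !normc_real mulrDr; apply: lerD.
  rewrite mulrC; apply: ler_pM; rewrite ?normc_ge0 ?normr_ge0//; exact: lam_lip.
rewrite (gtr0_norm (lam_gt0 _)) -[leRHS]mul1r; apply: ler_pM; rewrite ?normc_ge0//.
exact: ltW.
Qed.

(** Near a point u is affine in w up to a remainder that is small compared with a + b. The affine
    part integrates to zero by [path_form_cst] and [path_form_lin0], and the perimeter supplies the
    second factor a + b that the bisection asks for. *)
Lemma path_form_closed (L : R) : 0 <= L -> path_form u (- L) 0 L (2 * pi) = 0.
Proof.
move=> L0; apply/eqP; rewrite -normc_eq0 eq_le normc_ge0 andbT.
have pi0 : 0 <= 2 * pi :> R by rewrite mulr_ge0// pi_ge0.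
apply: (@rectangle_bisection R (fun s t a b => normc (path_form u s t a b))) => //.
  move=> s t a b a0 b0 _ _ _ _; rewrite path_form_split//.
  apply: le_trans (le_normcD _ _) _; apply: lerD; exact: le_normcD.
move=> s' t' e s'i t'i e0.
have s'0 : s' <= 0 by lra.
have [d dP] := derivable_eps (df (w_disc s' t')).
(* The 4 (1 + Kb) of [path_form_le] times the Lipschitz constant 2 of w, so that the final bound is
   exactly e (a + b)^2. *)
pose C := 8 * (1 + Kb); have C0 : 0 < C by rewrite mulr_gt0// ltr_wpDl// ltW.
have [dl dl0 dlP] := dP _ (divr_gt0 e0 C0).
(* With both sides below dl / 4, w varies by at most 2 (a + b) < dl. *)
exists (dl / 4); first by rewrite divr_gt0.
move=> s t a b /andP[a0 ad] /andP[b0 bd] sl sr tl tr si ti.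
pose rho x y := u x y - (f (w s' t') - f z0 - d * (w s' t' - z0)) - d * ((lam x)%:C * v y).
have cc k : sep_ccont (fun _ _ => k) by split => ?; exact: ccont_cst.
have [csl1 csl2] := csep_lin; have [cu1 cu2] := cu.
have crho : sep_ccont rho.
  split=> [y|x]; apply: ccont_sub.
  - by apply: ccont_sub => //; exact: ccont_cst.
  - by apply: ccontM => //; exact: ccont_cst.
  - by apply: ccont_sub => //; exact: ccont_cst.
  - by apply: ccontM => //; exact: ccont_cst.
have -> : path_form u s t a b = path_form rho s t a b.
  set K := f (w s' t') - f z0 - d * (w s' t' - z0) in rho crho *.
  have -> : u = (fun x y => K * 1 + (fun x y => d * ((lam x)%:C * v y) + rho x y) x y).
    by apply/funext => x; apply/funext => y; rewrite /rho; ring.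
  rewrite path_form_lin//; last first.
    split=> [y|x]; apply: ccontD => //; [|exact: crho.1| |exact: crho.2];
    by apply: ccontM => //; exact: ccont_cst.
  rewrite path_form_cst mulr0 add0r path_form_lin//.
  by rewrite path_form_lin0 ?mulr0 ?add0r//; lra.
have rho_le x y : s <= x <= s + a -> t <= y <= t + b ->
    normc (rho x y) <= e / C * (2 * (a + b)).
  move=> xi yi.
  have x0 : x <= 0 by lra.
  have wl : normc (w x y - w s' t') <= 2 * (a + b).
    apply: le_trans (w_lip y t' x0 s'0) _; rewrite ler_pM2l//; apply: lerD;
    rewrite ler_norml; lra.
  have -> : rho x y = f (w x y) - f (w s' t') - d * (w x y - w s' t').
    by rewrite /rho /u /w; ring.
  apply: le_trans (dlP _ _) _; first by apply: le_lt_trans wl _; lra.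
  by rewrite ler_pM2l// divr_gt0.
have K0 : 0 <= e / C * (2 * (a + b)).
  by rewrite !mulr_ge0 ?addr_ge0 ?invr_ge0// ltW.
apply: le_trans (path_form_le a0 b0 crho K0 rho_le) _.
rewrite le_eqVlt; apply/orP; left; apply/eqP.
rewrite /C; field; rewrite gt_eqF// ltr_wpDl// ltW//.
Qed.

(** The sides t = 0 and t = 2 pi coincide on the cone, so their contributions cancel and the
    integral at s = 0 equals the one at s = -L. For large L the latter is small, because f is
    continuous at the apex and kappa is bounded. *)
Lemma cauchy_circle :
  Cint 0 (2 * pi) (fun t => (f (r%:C * cexpi t) - f z0) * (r%:C * cexpi t / v t)) = 0.
Proof.
have pi0 : 0 <= 2 * pi :> R by rewrite mulr_ge0// pi_ge0.
have [cu1 cu2] := cu.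
have Q L : 0 <= L -> Cint 0 (2 * pi) (fun y => u 0 y * kappa y) =
    Cint 0 (2 * pi) (fun y => u (- L) y * kappa y).
  move=> L0; have := path_form_closed L0; rewrite /path_form.
  have -> : u^~ (0 + 2 * pi) = u^~ 0.
    by apply/funext => x; rewrite /u /w /v add0r cexpi_2pi cexpi0.
  rewrite subrr add0r add0r addNr.
  by move=> /eqP; rewrite subr_eq0 => /eqP.
have uE t : u 0 t = f (r%:C * cexpi t) - f z0.
  by rewrite /u /w /v lamE// expR0 mul1r (addrC z0) subrK.
have Q0 : Cint 0 (2 * pi) (fun y => u 0 y * kappa y) = 0.
  apply/eqP; rewrite -normc_eq0 eq_le normc_ge0 andbT; apply/ler_addgt0Pl => e e0.
  rewrite addr0.
  have z0d : in_disc z0 by exact: lt_trans z0r r1.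
  pose C := 4 * Kb * pi; have C0 : 0 < C by rewrite !mulr_gt0// pi_gt0.
  have [d d0 dP] := derivable_cont (df z0d) (divr_gt0 e0 C0).
  (* This gives e^-L <= d / 4, hence |w - z0| <= 2 e^-L < d. *)
  pose L := Num.max 0 (- ln (d / 4)).
  have L0 : 0 <= L by rewrite le_max lexx.
  rewrite (Q _ L0).
  have lL : expR (- L) <= d / 4.
    rewrite -[leRHS]lnK ?posrE ?divr_gt0// ler_expR lerNl le_max lexx orbT//.
  have -> : e = 2 * (e / C * Kb) * (2 * pi - 0).
    have aux (k p : R) : 0 < k -> 0 < p -> e = 2 * (e / (4 * k * p) * k) * (2 * p - 0).
      by move=> k0 p0; field; rewrite !gt_eqF.
    by apply: aux => //; exact: pi_gt0.
  apply: Cint_le => //; first by apply: ccontM.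
  move=> t _; rewrite normcMM; apply: ler_pM; rewrite ?normc_ge0//; apply: ltW; apply: dP.
  rewrite /w addrC addKr normcMM normc_real gtr0_norm// lamE ?oppr_le0//.
  apply: (@le_lt_trans _ _ (d / 4 * 2)); last lra.
  by apply: ler_pM; rewrite ?normc_ge0// expR_ge0.
have i0 : ii != 0 by rewrite -normc_gt0 normc_ii.
apply: (mulfI i0); rewrite mulr0 -Q0 -CintZ.
  congr Cint; apply/funext => t; rewrite uE /kappa; ring.
apply: ccontM; first by under eq_fun do rewrite -uE.
by apply: ccontM => //; exact: ccontV.
Qed.

End CauchyFormula.

(** * Taylor expansion of bounded holomorphic functions *)

Section Taylor.
Variable R : realType.

Lemma cexpiJ (t : R) : cexpi t * conjc (cexpi t) = 1.
Proof. by rewrite mulcJ normc_cexpi expr1n. Qed.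

Lemma ccont_expiJ k : ccont (fun t : R => conjc (cexpi t) ^+ k).
Proof.
rewrite (_ : (fun _ => _) = (fun t => conjc (cexpi (k%:R * t)))).
  by apply: ccont_conj; exact: ccont_cexpi.
by apply/funext => t; rewrite -cexpiX rmorphXn.
Qed.

Lemma Cint_expiJ (k : nat) : (0 < k)%N ->
  Cint 0 (2 * pi) (fun t : R => conjc (cexpi t) ^+ k) = 0.
Proof.
move=> k0; rewrite -conjc0 -(@Cint_cexpi_period R k)// -Cint_conj.
  by congr Cint; apply/funext => t; rewrite rmorphXn.
by have := ccont_cexpi (k%:R : R); under eq_fun do rewrite -cexpiX.
Qed.

Lemma twopi_gt0 : 0 < 2 * pi :> R.
Proof. by rewrite mulr_gt0// pi_gt0. Qed.

Lemma cvg_geo (q C : R) : 0 <= q < 1 -> 0 <= C ->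
  forall e : R, 0 < e -> exists N, forall n, (N <= n)%N -> q ^+ n * C < e.
Proof.
move=> /andP[q0 q1] C0 e e0.
have q1' : `|q| < 1 by rewrite ger0_norm.
have /cvgrPdist_lt h := cvg_expr q1'.
have C1 : 0 < C + 1 by rewrite ltr_wpDl.
have [N _ NP] := h _ (divr_gt0 e0 C1).
exists N => n Nn; have := NP _ Nn; rewrite /= sub0r normrN ger0_norm ?exprn_ge0//.
rewrite ltr_pdivlMr// => h2.
have := exprn_ge0 n q0; nra.
Qed.

(** Radii tending to 1 from below; the offset 2 keeps [rad 0] positive. *)
Definition rad (n : nat) : R := 1 - (n.+2%:R)^-1.

Lemma rad01 n : 0 < rad n < 1.
Proof. by rewrite /rad subr_gt0 gtrBl invr_gt0 ltr0n invf_lt1 ?ltr1n. Qed.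

Lemma rad_cvg : rad @ \oo --> (1 : R).
Proof.
apply/cvgrPdist_lt => e e0.
have /cvgrPdist_lt/(_ _ e0)[N _ NP] := @cvg_harmonic R.
exists N => // n Nn /=; have := NP n.+1 (leqW Nn).
by rewrite /rad subKr /= sub0r normrN.
Qed.

Lemma radX_cvg k : (fun n => rad n ^+ k) @ \oo --> (1 : R).
Proof.
elim: k => [|k IH]; first by under eq_fun do rewrite expr0; exact: cvg_cst.
have -> : (fun n => rad n ^+ k.+1) = (fun n => rad n * rad n ^+ k).
  by apply/funext => n; rewrite exprS.
suff: (fun n => rad n * rad n ^+ k) @ \oo --> (1 * 1 : R) by rewrite mulr1.
exact: cvgM rad_cvg IH.
Qed.

Section Kernel.
Variables (z0 : R[i]) (r : R).
Hypothesis z0r : normc z0 < r.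

Let r0 : 0 < r. Proof. exact: le_lt_trans (normc_ge0 _) z0r. Qed.
Let q : R[i] := z0 / r%:C.
Let ker (t : R) : R[i] := r%:C * cexpi t / (r%:C * cexpi t - z0).

Let rC0 : r%:C != 0. Proof. by rewrite RtoC_eq0 gt_eqF. Qed.

Lemma normc_circle (t : R) : normc (r%:C * cexpi t) = r.
Proof. by rewrite normcMM normc_cexpi mulr1 normc_real gtr0_norm. Qed.

Let den_ge t : r - normc z0 <= normc (r%:C * cexpi t - z0).
Proof.
have := le_normcD (r%:C * cexpi t - z0) z0; rewrite subrK normc_circle; lra.
Qed.

Let den0 t : r%:C * cexpi t - z0 != 0.
Proof. by rewrite -normc_gt0; apply: lt_le_trans (den_ge t); rewrite subr_gt0. Qed.

Let normq : 0 <= normc q < 1.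
Proof.
rewrite normc_ge0 /= /q normcMM normcVV normc_real gtr0_norm//.
by rewrite ltr_pdivrMr// mul1r.
Qed.

Lemma ccont_circle : ccont (fun t : R => r%:C * cexpi t).
Proof.
apply: ccontM; first exact: ccont_cst.
by have := ccont_cexpi (1 : R); under eq_fun do rewrite mul1r.
Qed.

Lemma ccont_kernel : ccont ker.
Proof.
have c := ccont_circle; apply: ccontM => //; apply: ccontV => //.
exact: (ccont_sub c (ccont_cst z0)).
Qed.

(** The kernel is 1 / (1 - q e^(-it)) with |q| < 1. Keeping the exact remainder of the geometric
    series lets [kernel_cvg] integrate finite sums only. *)
Lemma kernel_expand n t :
  ker t = \sum_(0 <= k < n) (q * conjc (cexpi t)) ^+ k + (q * conjc (cexpi t)) ^+ n * ker t.
Proof.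
have ker1 : ker t = 1 + q * conjc (cexpi t) * ker t.
  have e1 := cexpiJ t; have d0 := den0 t; rewrite /ker /q.
  apply: (mulIf d0); rewrite mulrDl mul1r -!mulrA mulVf// !mulr1.
  have -> : z0 * (r%:C^-1 * (conjc (cexpi t) * (r%:C * cexpi t))) =
    z0 * (r%:C^-1 * r%:C) * (cexpi t * conjc (cexpi t)) by ring.
  by rewrite e1 mulVf// !mulr1 subrK.
elim: n => [|n IH]; first by rewrite big_geq// add0r expr0 mul1r.
rewrite big_nat_recr//= {1}IH -!addrA; congr (_ + _).
by rewrite {1}ker1 mulrDr mulr1 exprSr mulrA.
Qed.

Lemma kernel_cvg (g : R -> R[i]) (M : R) : ccont g -> (forall t, normc (g t) <= M) ->
  series (fun k => q ^+ k * Cint 0 (2 * pi) (fun t => g t * conjc (cexpi t) ^+ k)) @ \oo -->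
  Cint 0 (2 * pi) (fun t => g t * ker t).
Proof.
move=> cg gM; have M0 : 0 <= M := le_trans (normc_ge0 _) (gM 0).
have cgk k : ccont (fun t => g t * conjc (cexpi t) ^+ k).
  by apply: ccontM => //; exact: ccont_expiJ.
have ck := ccont_kernel.
have E n : Cint 0 (2 * pi) (fun t => g t * ker t) =
   series (fun k => q ^+ k * Cint 0 (2 * pi) (fun t => g t * conjc (cexpi t) ^+ k)) n +
   q ^+ n * Cint 0 (2 * pi) (fun t => g t * conjc (cexpi t) ^+ n * ker t).
  have cF k : ccont (fun t => q ^+ k * (g t * conjc (cexpi t) ^+ k)).
    exact: (ccontM (ccont_cst (q ^+ k)) (cgk k)).
  have [cs Es] := @Cint_sum R 0 (2 * pi) _ n cF.
  rewrite /series /= (eq_bigr (fun k => Cint 0 (2 * pi) (fun t => q ^+ k * (g t * conjc (cexpi t) ^+ k)))); last first.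
    by move=> k _; rewrite CintZ.
  have crem : ccont (fun t => g t * conjc (cexpi t) ^+ n * ker t) by exact: (ccontM (cgk n) ck).
  rewrite -Es -CintZ// -CintD//; last exact: (ccontM (ccont_cst (q ^+ n)) crem).
  congr Cint; apply/funext => t; rewrite {1}(kernel_expand n t) mulrDr mulr_sumr.
  congr (_ + _); first by apply: eq_bigr => k _; rewrite exprMn; ring.
  by rewrite exprMn; ring.
pose K := (r - normc z0)^-1.
have K0 : 0 < K by rewrite invr_gt0 subr_gt0.
have kerle t : normc (ker t) <= r * K.
  rewrite /ker normcMM normc_circle normcVV ler_pM2l// lef_pV2 ?posrE ?subr_gt0//.
  by rewrite normc_gt0.
apply/cvgcP => e e0.
have C0 : 0 <= 2 * (M * (r * K)) * (2 * pi - 0).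
  by rewrite subr0; rewrite !mulr_ge0// ?pi_ge0// ltW.
have [N NP] := cvg_geo normq C0 e0; exists N => n /NP; apply: le_lt_trans.
rewrite normc_subC (E n) addrC addKr normcMM normcX.
rewrite ler_wpM2l ?exprn_ge0 ?normc_ge0//.
apply: Cint_le; [exact: ltW twopi_gt0|exact: (ccontM (cgk n) ck)|].
move=> t _; rewrite (normcMM _ (ker t)) (normcMM (g t)) normcX normcJ_eq normc_cexpi expr1n mulr1.
apply: ler_pM; [exact: normc_ge0|exact: normc_ge0|exact: gM|exact: kerle].
Qed.

End Kernel.

Variables (f : R[i] -> R[i]) (M : R).
Hypothesis df : holomorphic_on_disc f.
Hypothesis fM : forall z, in_disc z -> normc (f z) <= M.

Definition circle_coef (r : R) (k : nat) : R[i] :=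
  ((2 * pi)^-1)%:C * Cint 0 (2 * pi) (fun t => f (r%:C * cexpi t) * conjc (cexpi t) ^+ k).

Let circ_disc (r t : R) : 0 < r < 1 -> in_disc (r%:C * cexpi t).
Proof.
move=> /andP[r0 r1]; rewrite /in_disc normcMM normc_cexpi mulr1 normc_real.
by rewrite gtr0_norm.
Qed.

Lemma ccont_fcircle r : 0 < r < 1 -> ccont (fun t => f (r%:C * cexpi t)).
Proof.
move=> r01; apply: ccont_comp; first exact: ccont_circle.
by move=> t; apply: df; exact: circ_disc.
Qed.

Lemma circle_coef_bound r : 0 < r < 1 -> coef_bound (2 * M) (circle_coef r).
Proof.
move=> r01 k; rewrite /circle_coef normcMM normc_real gtr0_norm ?invr_gt0 ?twopi_gt0//.
rewrite mulrC ler_pdivrMr ?twopi_gt0//.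
rewrite -[X in _ <= _ * X]subr0; apply: Cint_le; first exact: ltW twopi_gt0.
  exact: (ccontM (ccont_fcircle r01) (ccont_expiJ k)).
move=> t _; rewrite normcMM normcX normcJ_eq normc_cexpi expr1n mulr1.
by apply: fM; exact: circ_disc.
Qed.

Lemma circle_coef_ev r z : normc z < r -> r < 1 -> f z = ev (circle_coef r) (z / r%:C).
Proof.
move=> zr r1; have r0 : 0 < r := le_lt_trans (normc_ge0 _) zr.
have r01 : 0 < r < 1 by rewrite r0.
have cf := ccont_fcircle r01.
have ck := ccont_kernel zr.
have c1 : forall t : R, normc ((fun=> 1 : R[i]) t) <= 1 by move=> t; rewrite normc11.
have K1 := kernel_cvg zr (ccont_cst (1 : R[i])) c1.
have Kf := kernel_cvg zr cf (fun t => fM (circ_disc t r01)).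
have tp0 : ((2 * pi)%:C : R[i]) != 0 by rewrite RtoC_eq0 gt_eqF// twopi_gt0.
(* The kernel has total mass 2 pi: in [kernel_cvg] for the constant 1 only the term k = 0
   survives. *)
have I1 : Cint 0 (2 * pi) (fun t : R => 1 * (r%:C * cexpi t / (r%:C * cexpi t - z))) = (2 * pi)%:C.
  apply: (cvgc_unique K1); apply/cvgcP => e e0; exists 1%N => -[//|n] _.
  rewrite /series /= big_nat_recl//= big1 => [|k _]; last first.
    rewrite (_ : (fun t => _) = (fun t : R => conjc (cexpi t) ^+ k.+1)).
      by rewrite Cint_expiJ// mulr0.
    by apply/funext => t; rewrite mul1r.
  rewrite addr0 (_ : (fun t => _) = (fun t : R => 1)); last first.
    by apply/funext => t; rewrite mul1r.
  rewrite Cint_cst ?subr0; last exact: ltW twopi_gt0.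
  by rewrite expr0 !mul1r subrr normc00.
have := cauchy_circle df zr r1.
rewrite (_ : (fun t => _) = (fun t => f (r%:C * cexpi t) * (r%:C * cexpi t / (r%:C * cexpi t - z))
   - f z * (1 * (r%:C * cexpi t / (r%:C * cexpi t - z))))); last first.
  by apply/funext => t; rewrite mul1r mulrBl.
have c1k : ccont (fun t : R => 1 * (r%:C * cexpi t / (r%:C * cexpi t - z))).
  exact: (ccontM (ccont_cst 1) ck).
rewrite CintB; [|exact: (ccontM cf ck)|exact: (ccontM (ccont_cst (f z)) c1k)].
rewrite CintZ// I1 => /eqP; rewrite subr_eq0 => /eqP If.
symmetry; apply: cvgc_lim.
have -> : f z = ((2 * pi)^-1)%:C * (f z * (2 * pi)%:C) by rewrite RtoCV mulrCA mulVf ?mulr1.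
rewrite -If.
have -> : series (fun n => circle_coef r n * (z / r%:C) ^+ n) = (fun n =>
   ((2 * pi)^-1)%:C * series (fun k => (z / r%:C) ^+ k *
   Cint 0 (2 * pi) (fun t => f (r%:C * cexpi t) * conjc (cexpi t) ^+ k)) n).
  apply/funext => n; rewrite /series /= mulr_sumr; apply: eq_bigr => k _.
  rewrite /circle_coef; ring.
exact: (cvgcZ Kf).
Qed.

(** Both radii expand the same function z -> f (r1 z) on the unit disc, and [ev_eq0] makes the
    coefficients unique. *)
Lemma circle_coef_indep r1 r2 k : 0 < r1 -> r1 <= r2 -> r2 < 1 ->
  circle_coef r1 k / (r1 ^+ k)%:C = circle_coef r2 k / (r2 ^+ k)%:C.
Proof.
move=> r10 r12 r21; have r20 : 0 < r2 by exact: lt_le_trans r12.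
have q0 : 0 < r1 / r2 by exact: divr_gt0.
have q1 : r1 / r2 <= 1 by rewrite ler_pdivrMr// mul1r.
have r1i : 0 < r1 < 1 by rewrite r10 (le_lt_trans r12).
have r2i : 0 < r2 < 1 by rewrite r20.
pose x n : R[i] := ((r1 / r2) ^+ n)%:C * circle_coef r2 n.
have xB : coef_bound (2 * M) x.
  move=> n; rewrite normcMM normc_real ger0_norm ?exprn_ge0 ?(ltW q0)//.
  apply: le_trans (circle_coef_bound r2i n).
  by rewrite ler_piMl ?normc_ge0// exprn_ile1// ltW.
have yB := circle_coef_bound r1i.
have zB := coef_bound_lin (-1) xB yB.
have E : forall n, -1 * x n + circle_coef r1 n = 0.
  apply: (ev_eq0 zB ltr01) => z _ z1.
  rewrite (ev_lin _ xB yB z1).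
  have zr : normc (z * r1%:C) < r1.
    by rewrite normcMM normc_real gtr0_norm// -[ltRHS]mul1r ltr_pM2r.
  have e1 := circle_coef_ev zr (le_lt_trans r12 r21).
  have e2 := circle_coef_ev (lt_le_trans zr r12) r21.
  have -> : ev (circle_coef r1) z = f (z * r1%:C).
    by rewrite e1 mulfK// RtoC_eq0 gt_eqF.
  have -> : ev x z = f (z * r1%:C); last by rewrite mulN1r addNr.
  rewrite e2; congr (limn (series _)); apply/funext => n.
  rewrite /x (_ : ((r1 / r2) ^+ n)%:C = (r1%:C / r2%:C) ^+ n); first by rewrite !exprMn; ring.
  by rewrite -RtoCV -RtoCM; exact: (rmorphXn (real_complex R)).
have := E k; rewrite mulN1r => /eqP; rewrite addrC subr_eq0 => /eqP ->.
rewrite /x mulrC expr_div_n RtoCM RtoCV; field.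
by rewrite !RtoC_eq0 !expf_neq0// gt_eqF.
Qed.

(** The coefficients are read off at radius 1/2, but independence of the radius yields |c k| r^k <=
    2 M for every r < 1; r -> 1 along [rad] gives the bound. *)
Lemma taylor_expansion : exists c, coef_bound (2 * M) c /\
  forall z, in_disc z -> f z = ev c z.
Proof.
pose c k := circle_coef (1 / 2) k / ((1 / 2) ^+ k)%:C.
have cE r k : 0 < r < 1 -> circle_coef r k = c k * (r ^+ k)%:C.
  move=> /andP[r0 r1]; have rk : (r ^+ k)%:C != 0.
    by rewrite RtoC_eq0 expf_neq0// gt_eqF.
  apply: (mulIf (invr_neq0 rk)); rewrite mulfK//.
  by have [h|/ltW h] := leP r (1 / 2); [|symmetry];
    apply: circle_coef_indep => //; rewrite ?divr_gt0//; lra.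
exists c; split; last first.
  move=> z z1; pose r := (normc z + 1) / 2.
  have zr : normc z < r by rewrite /r; move: z1; rewrite /in_disc; lra.
  have r1 : r < 1 by rewrite /r; move: z1; rewrite /in_disc; lra.
  have r0 : 0 < r := le_lt_trans (normc_ge0 _) zr.
  clearbody r; rewrite (circle_coef_ev zr r1); congr (limn (series _)); apply/funext => n.
  rewrite cE ?r0// exprMn exprVn -mulrA; congr (_ * _).
  rewrite (_ : (r ^+ n)%:C = r%:C ^+ n); last exact: (rmorphXn (real_complex R)).
  by rewrite mulrC mulfVK// expf_neq0// RtoC_eq0 gt_eqF.
move=> k.
have h : (fun n => normc (c k) * rad n ^+ k) @ \oo --> normc (c k) * 1.
  by apply: cvgM; [exact: cvg_cst|exact: radX_cvg].
rewrite mulr1 in h; apply: (cvgr_le h) => n.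
have := circle_coef_bound (rad01 n) k; rewrite cE ?rad01// normcMM normc_real.
by rewrite ger0_norm// exprn_ge0//; case/andP: (rad01 n) => /ltW.
Qed.

End Taylor.

(** * Multiplication and inner functions *)

Section Parseval.
Variable R : realType.
Implicit Types (x y h c : cseq R) (z : R[i]).

Lemma normc_sq_expand (z w : R[i]) :
  normc (z + w) ^+ 2 = normc z ^+ 2 + normc w ^+ 2 + 2 * Re (z * conjc w).
Proof. by rewrite !sqr_normcE ReD ImD ReM; case: w => a b /=; ring. Qed.

Definition trig y N (t : R) : R[i] := \sum_(0 <= k < N) y k * cexpi t ^+ k.

Lemma ccont_expiX k : ccont (fun t : R => cexpi t ^+ k).
Proof.
by have := ccont_cexpi (k%:R : R); under eq_fun do rewrite -cexpiX.
Qed.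

Lemma ccont_trig y N : ccont (trig y N).
Proof.
have cF k : ccont (fun t : R => y k * cexpi t ^+ k).
  exact: (ccontM (ccont_cst (y k)) (ccont_expiX k)).
by have [] := @Cint_sum R 0 0 _ N cF.
Qed.

Lemma trig_orth y N : Cint 0 (2 * pi) (fun t => trig y N t * conjc (y N * cexpi t ^+ N)) = 0.
Proof.
have cF k : ccont (fun t : R => y k * cexpi t ^+ k * conjc (y N * cexpi t ^+ N)).
  have c1 j := ccontM (ccont_cst (y j)) (ccont_expiX j).
  exact: (ccontM (c1 k) (ccont_conj (c1 N))).
have [_ E] := @Cint_sum R 0 (2 * pi) _ N cF.
rewrite (_ : (fun t => _) = (fun t : R => \sum_(0 <= k < N) y k * cexpi t ^+ k * conjc (y N * cexpi t ^+ N))).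
  rewrite E big_nat_cond big1// => k /andP[/andP[_ kN] _].
  rewrite (_ : (fun t => _) = (fun t : R => y k * conjc (y N) * conjc (cexpi t) ^+ (N - k))).
    by rewrite CintZ; [rewrite Cint_expiJ ?mulr0// subn_gt0|exact: ccont_expiJ].
  apply/funext => t; rewrite rmorphM rmorphXn /=.
  have -> : conjc (cexpi t) ^+ N = conjc (cexpi t) ^+ (N - k) * conjc (cexpi t) ^+ k.
    by rewrite -exprD subnK// ltnW.
  have -> : y k * cexpi t ^+ k * (conjc (y N) * (conjc (cexpi t) ^+ (N - k) * conjc (cexpi t) ^+ k)) =
    y k * conjc (y N) * conjc (cexpi t) ^+ (N - k) * (cexpi t ^+ k * conjc (cexpi t) ^+ k) by ring.
  by rewrite -exprMn cexpiJ expr1n mulr1.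
by apply/funext => t; rewrite mulr_suml.
Qed.

Lemma parseval_trig y N :
  Rint 0 (2 * pi) (fun t => normc (trig y N t) ^+ 2) =
  2 * pi * series (fun n => normc (y n) ^+ 2) N.
Proof.
have tp := ltW (twopi_gt0 R).
elim: N => [|N IH].
  rewrite (_ : (fun t => _) = (fun t : R => 0)); last first.
    by apply/funext => t; rewrite /trig big_geq// normc00 expr0n.
  by rewrite Rint_cst// mul0r /series /= big_geq// mulr0.
have ct := ccont_trig y N.
have cN : ccont (fun t : R => y N * cexpi t ^+ N).
  exact: (ccontM (ccont_cst (y N)) (ccont_expiX N)).
have [cI _] := ccontM ct (ccont_conj cN).
have O : Rint 0 (2 * pi) (fun t => Re (trig y N t * conjc (y N * cexpi t ^+ N))) = 0.
  by have := congr1 (fun z => Re z) (trig_orth y N).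
rewrite (_ : (fun t => _) = (fun t : R => (normc (trig y N t) ^+ 2 + normc (y N) ^+ 2) +
    2 * Re (trig y N t * conjc (y N * cexpi t ^+ N)))); last first.
  apply/funext => t; rewrite {1}/trig big_nat_recr//= -/(trig y N t) normc_sq_expand.
  by rewrite (normcMM (y N)) normcX normc_cexpi expr1n mulr1.
have cc (k : R) : continuous (fun _ : R => k) by move=> ?; exact: cvg_cst.
have cs := ccont_normc_sq ct.
rewrite RintD; [|by move=> t; apply: cvgD; [exact: cs|exact: cvg_cst]|]; last first.
  by move=> t; apply: cvgM; [exact: cvg_cst|exact: cI].
rewrite RintZ// O mulr0 addr0 RintD// IH Rint_cst// subr0.
rewrite /series /= big_nat_recr//=; move: (2 * pi) => p; ring.
Qed.

Lemma ev_tail B x z N : coef_bound B x -> in_disc z ->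
  ev x z = \sum_(0 <= k < N) x k * z ^+ k + z ^+ N * ev (fun n => x (n + N)%N) z.
Proof.
move=> xB z1; elim: N => [|N IH].
  rewrite big_geq// add0r expr0 mul1r; congr ev.
  by apply/funext => n; rewrite addn0.
rewrite IH big_nat_recr//= -addrA; congr (_ + _).
have xN : coef_bound B (fun n => x (n + N)%N) by move=> n; exact: xB.
rewrite (evS xN z1) add0n mulrDr [x N * _]mulrC; congr (_ + _).
have -> : bshift (fun n => x (n + N)%N) = (fun n => x (n + N.+1)%N).
  by apply/funext => n; rewrite /bshift addSnnS.
by rewrite exprSr mulrA.
Qed.

Definition dilate (r : R) x : cseq R := fun n => x n * (r ^+ n)%:C.

Lemma dilate_sq r x n : normc (dilate r x n) ^+ 2 = normc (x n) ^+ 2 * (r ^+ n) ^+ 2.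
Proof. by rewrite /dilate normcMM normc_real exprMn real_normK// num_real. Qed.

Lemma parseval B x r : coef_bound B x -> 0 < r < 1 ->
  ccont (fun t => ev x (r%:C * cexpi t)) ->
  H2 (dilate r x) /\
  Rint 0 (2 * pi) (fun t => normc (ev x (r%:C * cexpi t)) ^+ 2) = 2 * pi * nrm2 (dilate r x).
Proof.
move=> xB /andP[r0 r1] cx; have B0 := coef_bound_ge0 xB.
pose S := B / (1 - r).
have S0 : 0 <= S by rewrite divr_ge0// subr_ge0 ltW.
have tp := twopi_gt0 R.
have disc t : in_disc (r%:C * cexpi t).
  by rewrite /in_disc normcMM normc_cexpi mulr1 normc_real gtr0_norm.
have nz t : normc (r%:C * cexpi t) = r.
  by rewrite normcMM normc_cexpi mulr1 normc_real gtr0_norm.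
have evS' t : normc (ev x (r%:C * cexpi t)) <= S by have := ev_le xB (disc t); rewrite nz.
have tail N t : normc (ev x (r%:C * cexpi t) - trig (dilate r x) N t) <= r ^+ N * S.
  rewrite (ev_tail N xB (disc t)).
  have -> : trig (dilate r x) N t = \sum_(0 <= k < N) x k * (r%:C * cexpi t) ^+ k.
    apply: eq_bigr => k _; rewrite /dilate exprMn -mulrA; congr (_ * (_ * _)).
    exact: (rmorphXn (real_complex R)).
  rewrite addrC addKr normcMM normcX nz; apply: ler_wpM2l.
    by rewrite exprn_ge0// ltW.
  have xN : coef_bound B (fun n => x (n + N)%N) by move=> n; exact: xB.
  by have := ev_le xN (disc t); rewrite nz.
have cs := ccont_normc_sq cx.
(* Uniformly in t the truncation error is at most r^N S. As |ev| <= S, the truncation is at most 2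
   S, and the squares differ by at most (r^N S) (3 S). *)
have key N : `|Rint 0 (2 * pi) (fun t => normc (ev x (r%:C * cexpi t)) ^+ 2) -
    2 * pi * series (fun n => normc (dilate r x n) ^+ 2) N| <= r ^+ N * (S * (3 * S) * (2 * pi)).
  rewrite -parseval_trig -RintB//; last by apply: ccont_normc_sq; exact: ccont_trig.
  have aux (a b d p : R) : a * (b * d * p) = a * b * d * (p - 0) by ring.
  rewrite aux; apply: Rint_norm_le; first exact: ltW.
    move=> t; apply: cvgB; first exact: cs.
    exact: (ccont_normc_sq (ccont_trig (dilate r x) N)).
  move=> t _.
  have h1 := tail N t; have h2 := evS' t.
  have rN : 0 <= r ^+ N <= 1 by rewrite exprn_ge0 ?exprn_ile1// ltW.
  set a := ev _ _ in h1 h2 *; set b := trig _ _ _ in h1 *.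
  have h3 : normc b <= normc a + normc (a - b) by rewrite -{1}(subKr a b); exact: normc_sub.
  have h4 : normc a <= normc b + normc (a - b).
    by have := le_normcD b (a - b); rewrite (addrC b) subrK.
  have d1 : `|normc a - normc b| <= r ^+ N * S by rewrite ler_norml; apply/andP; split; lra.
  have d2 : `|normc a + normc b| <= 3 * S.
    rewrite ger0_norm ?addr_ge0 ?normc_ge0//.
    have : r ^+ N * S <= 1 * S by case/andP: rN => _ rN1; rewrite ler_wpM2r.
    lra.
  by rewrite subr_sqr normrM; apply: ler_pM.
have dH : H2 (dilate r x).
  have C0 : 0 <= S * (3 * S) * (2 * pi) by apply: mulr_ge0; [apply: mulr_ge0 => //; exact: mulr_ge0|exact: ltW].
  pose I := Rint 0 (2 * pi) (fun t => normc (ev x (r%:C * cexpi t)) ^+ 2).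
  apply: (@H2_bound _ _ ((I + S * (3 * S) * (2 * pi)) / (2 * pi))) => n.
  rewrite ler_pdivlMr// mulrC.
  have := key n; rewrite -/I ler_norml => /andP[h _].
  have : r ^+ n * (S * (3 * S) * (2 * pi)) <= 1 * (S * (3 * S) * (2 * pi)).
    by rewrite ler_wpM2r// exprn_ile1// ltW.
  lra.
split => //.
have C0 : 0 <= S * (3 * S) * (2 * pi) by apply: mulr_ge0; [apply: mulr_ge0 => //; exact: mulr_ge0|exact: ltW].
have r01 : 0 <= r < 1 by rewrite r1 ltW.
pose u N := 2 * pi * series (fun n => normc (dilate r x n) ^+ 2) N.
have u1 : u @ \oo --> 2 * pi * nrm2 (dilate r x).
  by apply: cvgM; [exact: cvg_cst|exact: dH].
have u2 : u @ \oo --> Rint 0 (2 * pi) (fun t => normc (ev x (r%:C * cexpi t)) ^+ 2).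
  apply/cvgrPdist_lt => e e0; have [N NP] := cvg_geo r01 C0 e0.
  by exists N => // n /NP; apply: le_lt_trans; exact: key.
by rewrite -(cvg_lim _ u1)// -(cvg_lim _ u2).
Qed.

End Parseval.

(** * Multiplication of [H2] by a bounded holomorphic function *)

Section Multiplication.
Variable R : realType.
Implicit Types (x y h g c : cseq R) (z : R[i]).

Local Notation Sh k c := (iter k (@ushift R) c).

Lemma iter_ushift_lt k c n : (n < k)%N -> Sh k c n = 0.
Proof.
by elim: k n => // k IH [|n] //=; rewrite ltnS => /IH.
Qed.

Definition pmul N h c : cseq R := fun n => \sum_(0 <= k < N) h k * Sh k c n.

(** The Cauchy product: [Sh k c] vanishes below index k, so each entry is a finite sum and the
    product exists before its square-summability is known. *)
Definition mulc c h : cseq R := fun n => \sum_(0 <= k < n.+1) h k * Sh k c n.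

Lemma mulc_widen c h n N : (n < N)%N -> mulc c h n = pmul N h c n.
Proof.
move=> nN; rewrite /pmul (big_cat_nat (leq0n n.+1) nN) /=.
rewrite [X in _ = _ + X]big_nat_cond [X in _ = _ + X]big1 ?addr0//.
by move=> k /andP[/andP[nk _] _]; rewrite iter_ushift_lt ?mulr0.
Qed.

Lemma pmulS N h c : pmul N.+1 h c = (fun n => h N * Sh N c n + pmul N h c n).
Proof. by apply/funext => n; rewrite /pmul big_nat_recr//= addrC. Qed.

Lemma coef_bound_iter B c k : coef_bound B c -> coef_bound B (Sh k c).
Proof. by move=> cB; elim: k => //= k IH; exact: coef_bound_ushift. Qed.

Lemma coef_bound_pmul B h c N : coef_bound B c -> exists B', coef_bound B' (pmul N h c).
Proof.
move=> cB; elim: N => [|N [B' IH]].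
  by exists 0 => n; rewrite /pmul big_geq// normc00.
exists (normc (h N) * B + B'); rewrite pmulS.
by apply: coef_bound_lin => //; exact: coef_bound_iter.
Qed.

Lemma ev_iter B c k z : coef_bound B c -> in_disc z -> ev (Sh k c) z = z ^+ k * ev c z.
Proof.
move=> cB z1; elim: k => [|k IH]; first by rewrite mul1r.
by rewrite /= (ev_ushift (coef_bound_iter k cB) z1) IH exprS mulrA.
Qed.

Lemma ev_pmul B h c N z : coef_bound B c -> in_disc z ->
  ev (pmul N h c) z = (\sum_(0 <= k < N) h k * z ^+ k) * ev c z.
Proof.
move=> cB z1; elim: N => [|N IH].
  rewrite big_geq// mul0r -[RHS](ev_zero z); congr ev.
  by apply/funext => n; rewrite /pmul big_geq.
have [B' pB] := coef_bound_pmul h N cB.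
rewrite pmulS (ev_lin _ (coef_bound_iter N cB) pB z1) IH (ev_iter N cB z1).
by rewrite big_nat_recr//= mulrDl addrC mulrA.
Qed.

Definition tail N h : cseq R := fun n => if (n < N)%N then 0 else h n.

Lemma tail_H2 N h : H2 h -> H2 (tail N h) /\
  nrm2 (tail N h) <= nrm2 h - series (fun n => normc (h n) ^+ 2) N.
Proof.
move=> hH.
have key n : series (fun n => normc (tail N h n) ^+ 2) n <=
    nrm2 h - series (fun n => normc (h n) ^+ 2) N.
  have [nN|Nn] := leqP n N.
    rewrite /series /= big_nat_cond big1 ?subr_ge0; first exact: series_le_nrm2.
    move=> k /andP[/andP[_ kn] _].
    by rewrite /tail (leq_trans kn nN) normc00 expr0n.
  rewrite lerBrDr; apply: le_trans (series_le_nrm2 n hH).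
  have e1 : \sum_(0 <= k < n) normc (tail N h k) ^+ 2 = \sum_(N <= k < n) normc (h k) ^+ 2.
    rewrite (big_cat_nat (leq0n N) (ltnW Nn)) /= big_nat_cond big1 ?add0r; last first.
      by move=> k /andP[/andP[_ kn] _]; rewrite /tail kn normc00 expr0n.
    rewrite big_nat_cond [RHS]big_nat_cond; apply: eq_bigr => k /andP[/andP[Nk _] _].
    by rewrite /tail ltnNge Nk.
  have e2 : \sum_(0 <= k < n) normc (h k) ^+ 2 =
      \sum_(0 <= k < N) normc (h k) ^+ 2 + \sum_(N <= k < n) normc (h k) ^+ 2.
    by rewrite (big_cat_nat (leq0n N) (ltnW Nn)).
  by rewrite /series /= e1 e2 addrC.
have tH : H2 (tail N h) by apply: (H2_bound key).
by split => //; exact: nrm2_ub.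
Qed.

Lemma mulc_tail c h N n : mulc c h n = mulc c (tail N h) n + pmul N h c n.
Proof.
pose K := maxn n.+1 N.
have nK : (n < K)%N by exact: leq_maxl.
have NK : (N <= K)%N by exact: leq_maxr.
rewrite !(mulc_widen _ _ nK) /pmul !(big_cat_nat (leq0n N) NK) /=.
rewrite [X in _ = X + _ + _]big_nat_cond [X in _ = X + _ + _]big1 ?add0r; last first.
  by move=> k /andP[/andP[_ kN] _]; rewrite /tail kN mul0r.
rewrite addrC; congr (_ + _).
rewrite big_nat_cond [RHS]big_nat_cond; apply: eq_bigr => k /andP[/andP[Nk _] _].
by rewrite /tail ltnNge Nk.
Qed.

Lemma nrm2_tail_small h (e : R) : H2 h -> 0 < e -> exists N0, forall N, (N0 <= N)%N ->
  nrm2 (tail N h) <= e.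
Proof.
move=> hH e0; have /cvgrPdist_lt/(_ _ e0)[N0 _ NP] := hH.
exists N0 => N /NP /= h1; have [_ h2] := tail_H2 N hH.
apply: le_trans h2 _; apply: le_trans (ler_norm _) _; exact: ltW.
Qed.

Section Bounded.
Variables (f : R[i] -> R[i]) (M : R) (c : cseq R).
Hypothesis df : holomorphic_on_disc f.
Hypothesis fM : forall z, in_disc z -> normc (f z) <= M.
Hypothesis cB : coef_bound (2 * M) c.
Hypothesis fc : forall z, in_disc z -> f z = ev c z.

Let disc (r t : R) : 0 < r < 1 -> in_disc (r%:C * cexpi t).
Proof.
move=> /andP[r0 r1]; rewrite /in_disc normcMM normc_cexpi mulr1 normc_real.
by rewrite gtr0_norm.
Qed.

Let hp h N r t := trig (dilate r h) N t.

Let hpE h N (r t : R) : \sum_(0 <= k < N) h k * (r%:C * cexpi t) ^+ k = hp h N r t.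
Proof.
apply: eq_bigr => k _; rewrite /dilate exprMn -mulrA; congr (_ * (_ * _)).
by symmetry; exact: (rmorphXn (real_complex R)).
Qed.

Lemma pmul_circle h N r t : 0 < r < 1 ->
  ev (pmul N h c) (r%:C * cexpi t) = hp h N r t * f (r%:C * cexpi t).
Proof.
move=> r01; rewrite (ev_pmul _ _ cB (disc t r01)) -fc; last exact: disc.
by rewrite hpE.
Qed.

Lemma parseval_pmul h N r : 0 < r < 1 ->
  H2 (dilate r (pmul N h c)) /\
  Rint 0 (2 * pi) (fun t => normc (hp h N r t * f (r%:C * cexpi t)) ^+ 2) =
  2 * pi * nrm2 (dilate r (pmul N h c)).
Proof.
move=> r01; have [B' pB] := coef_bound_pmul h N cB.
have E : (fun t => ev (pmul N h c) (r%:C * cexpi t)) =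
    (fun t => hp h N r t * f (r%:C * cexpi t)).
  by apply/funext => t; exact: pmul_circle.
have := parseval pB r01; rewrite E.
have -> : (fun t => normc (ev (pmul N h c) (r%:C * cexpi t)) ^+ 2) =
    (fun t => normc (hp h N r t * f (r%:C * cexpi t)) ^+ 2).
  by apply/funext => t; rewrite pmul_circle.
apply; exact: (ccontM (ccont_trig _ _) (ccont_fcircle df r01)).
Qed.

Lemma dilate_series_cvg x K :
  (fun j => series (fun n => normc (dilate (rad R j) x n) ^+ 2) K) @ \oo -->
  series (fun n => normc (x n) ^+ 2) K.
Proof.
rewrite /series /=; apply: cvg_big; first exact: add_continuous.
move=> n _; have h := @radX_cvg R n.
have h2 : (fun j => normc (x n) ^+ 2 * (rad R j ^+ n * rad R j ^+ n)) @ \oo -->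
   normc (x n) ^+ 2 * (1 * 1).
  by apply: cvgM; [exact: cvg_cst|exact: (cvgM h h)].
rewrite !mulr1 in h2.
have -> : (fun j => normc (dilate (rad R j) x n) ^+ 2) =
  (fun j => normc (x n) ^+ 2 * (rad R j ^+ n * rad R j ^+ n)).
  by apply/funext => j; rewrite dilate_sq expr2.
exact: h2.
Qed.

Lemma dilate_series_le (r : R) h K : 0 < r < 1 ->
  series (fun n => normc (dilate r h n) ^+ 2) K <= series (fun n => normc (h n) ^+ 2) K.
Proof.
move=> /andP[r0 r1]; apply: ler_sum => n _; rewrite dilate_sq ler_piMr ?sqr_ge0//.
by rewrite exprn_ile1 ?exprn_ge0 ?exprn_ile1// ltW.
Qed.

(** On the circle of radius r, multiplication by f costs at most a factor M, and Parseval turns this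
    into a bound on dilated coefficients. Only K of them occur, so r -> 1 removes the dilation. *)
Lemma pmul_series_le h N K : series (fun n => normc (pmul N h c n) ^+ 2) K <=
  M ^+ 2 * series (fun n => normc (h n) ^+ 2) N.
Proof.
apply: (cvgr_le (@dilate_series_cvg (pmul N h c) K)) => j.
have r01 := rad01 R j.
have [dH E] := parseval_pmul h N r01.
apply: le_trans (series_le_nrm2 K dH) _.
rewrite -(ler_pM2l (twopi_gt0 R)) -E.
apply: (@le_trans _ _ (M ^+ 2 * (2 * pi * series (fun n => normc (dilate (rad R j) h n) ^+ 2) N))); last first.
  rewrite mulrCA ler_pM2l ?twopi_gt0// ler_wpM2l ?sqr_ge0//; exact: dilate_series_le.
have ct := ccont_trig (dilate (rad R j) h) N.
have cs := ccont_normc_sq ct.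
rewrite -parseval_trig -RintZ//; apply: Rint_mono.
- exact: (ccont_normc_sq (ccontM ct (ccont_fcircle df r01))).
- by move=> t; apply: cvgM; [exact: cvg_cst|exact: cs].
move=> t _; rewrite normcMM exprMn mulrC ler_wpM2r ?sqr_ge0//.
have fd := fM (disc t r01).
by rewrite ler_sqr ?nnegrE ?normc_ge0//; exact: le_trans (normc_ge0 _) fd.
Qed.

Lemma pmul_H2 h N : H2 (pmul N h c).
Proof. by apply: H2_bound => n; exact: pmul_series_le. Qed.

Lemma mulc_H2 h : H2 h -> H2 (mulc c h) /\ nrm2 (mulc c h) <= M ^+ 2 * nrm2 h.
Proof.
move=> hH.
have key K : series (fun n => normc (mulc c h n) ^+ 2) K <= M ^+ 2 * nrm2 h.
  have -> : series (fun n => normc (mulc c h n) ^+ 2) K =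
      series (fun n => normc (pmul K h c n) ^+ 2) K.
    rewrite /series /= big_nat_cond [RHS]big_nat_cond; apply: eq_bigr.
    by move=> k /andP[/andP[_ kK] _]; rewrite (mulc_widen _ _ kK).
  apply: le_trans (pmul_series_le h K K) _.
  by rewrite ler_wpM2l ?sqr_ge0// series_le_nrm2.
have mH : H2 (mulc c h) by exact: (H2_bound key).
by split => //; exact: nrm2_ub.
Qed.

Lemma mulc_tail_small h (e : R) : H2 h -> 0 < e -> exists N0, forall N, (N0 <= N)%N ->
  nrm (mulc c (tail N h)) <= e.
Proof.
move=> hH e0; have M0 : 0 < M ^+ 2 + 1 by rewrite ltr_wpDl ?sqr_ge0.
have e2 : 0 < e ^+ 2 / (M ^+ 2 + 1) by rewrite divr_gt0// exprn_gt0.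
have [N0 NP] := nrm2_tail_small hH e2; exists N0 => N /NP h1.
have [tH _] := tail_H2 N hH; have [mH h2] := mulc_H2 tH.
apply: nrm2_le_nrm => //; first exact: ltW.
apply: le_trans h2 _; rewrite ler_pdivlMr// in h1; apply: le_trans h1.
by rewrite mulrDr mulr1 mulrC lerDl nrm2_ge0.
Qed.

(** The formula holds for truncations of h; their products converge in norm, and evaluation at z is
    continuous in the norm. *)
Lemma mulc_ev h z : H2 h -> in_disc z -> ev (mulc c h) z = f z * ev h z.
Proof.
move=> hH z1; have z0 : 0 < 1 - normc z by rewrite subr_gt0.
apply: (@cvgc_unique R (fun N => ev (pmul N h c) z)).
  apply/cvgcP => e e0.
  have e2 : 0 < e / 2 * (1 - normc z) by rewrite mulr_gt0// divr_gt0.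
  have [N0 NP] := mulc_tail_small hH e2; exists N0 => N /NP h1.
  have [tH _] := tail_H2 N hH; have [mH _] := mulc_H2 tH.
  have E : mulc c h = (fun n => 1 * mulc c (tail N h) n + pmul N h c n).
    by apply/funext => n; rewrite mul1r -mulc_tail.
  rewrite E (ev_lin _ (H2_coef_bound mH) (H2_coef_bound (@pmul_H2 h N)) z1) mul1r.
  rewrite normc_subC addrK; apply: le_lt_trans (ev_le_nrm mH z1) _.
  rewrite ltr_pdivrMr//; apply: le_lt_trans h1 _.
  by rewrite ltr_pM2r//; lra.
have -> : (fun N => ev (pmul N h c) z) = (fun N => f z * series (fun n => h n * z ^+ n) N).
  by apply/funext => N; rewrite (ev_pmul _ _ cB z1) -fc// mulrC.
exact: (cvgcZ (ev_cvg (H2_coef_bound hH) z1)).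
Qed.

Lemma iter_H2 x k : H2 x -> H2 (Sh k x).
Proof. by move=> xH; elim: k => //= k; exact: ushift_H2. Qed.

Lemma coef_H2 : H2 c.
Proof.
have := @pmul_H2 (fun=> 1) 1; congr H2; apply/funext => n.
by rewrite /pmul big_nat1 mul1r.
Qed.

Lemma mulc_orth x h : H2 x -> (forall k, ip x (Sh k c) = 0) -> H2 h ->
  ip x (mulc c h) = 0.
Proof.
move=> xH x0 hH; have cH := coef_H2.
have p0 N : ip x (pmul N h c) = 0.
  elim: N => [|N IH].
    rewrite (_ : pmul 0 h c = @zero_seq R); last by apply/funext => n; rewrite /pmul big_geq.
    by rewrite (ip_conj (@H2_0 R) xH) ip0l conjc0.
  have sH := @iter_H2 c N cH.
  rewrite pmulS (ipDr (H2_Z (h N) sH) (@pmul_H2 h N) xH) IH addr0.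
  by rewrite (ipZr (h N) xH sH) x0 mulr0.
apply/eqP; rewrite -normc_eq0 eq_le normc_ge0 andbT; apply/ler_addgt0Pl => e e0.
rewrite addr0; have k0 : 0 < nrm x + 1 by rewrite ltr_wpDl ?nrm_ge0.
have [N NP] := mulc_tail_small hH (divr_gt0 e0 k0).
have [tH _] := tail_H2 N hH; have [mH _] := mulc_H2 tH.
have -> : mulc c h = (fun n => mulc c (tail N h) n + pmul N h c n).
  by apply/funext => n; rewrite -mulc_tail.
rewrite (ipDr mH (@pmul_H2 h N) xH) p0 addr0.
apply: le_trans (ip_cauchy_schwarz xH mH) _.
have := NP _ (leqnn N); rewrite ler_pdivlMr// => h1.
apply: le_trans h1; rewrite mulrC ler_wpM2l ?nrm_ge0//; lra.
Qed.

(** Replaces orthogonality to all products f a by countably many conditions: monomials a give the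
    sequences [Sh k c], and [mulc_orth] recovers every other a. *)
Lemma model_spaceP x : model_space f x <-> H2 x /\ forall k, ip x (Sh k c) = 0.
Proof.
have cH := coef_H2; split=> [[xH xm]|[xH x0]]; split=> //.
  move=> k; apply: xm; split; first exact: iter_H2.
  (* The constant function 1, so that [Sh k e0] is z^k. *)
  pose e0 : cseq R := fun n => (n == 0%N)%:R.
  have eH : H2 e0.
    apply: (@H2_bound _ _ 1) => -[|n]; first by rewrite /series /= big_geq.
    rewrite /series /= big_nat_recl//= normc11 expr1n big1 ?addr0// => i _.
    by rewrite normc00 expr0n.
  have eB := H2_coef_bound eH.
  exists (Sh k e0); split; first exact: iter_H2.
  move=> z z1; rewrite (ev_iter _ eB z1) (ev_iter _ cB z1) -fc//.
  rewrite (evS eB z1) (_ : ev (bshift e0) z = 0) ?mulr0 ?addr0 ?mulr1 1?mulrC//.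
  by have -> : bshift e0 = @zero_seq R; [apply/funext|exact: ev_zero].
move=> y [yH [a [aH ya]]].
suff -> : y = mulc c a by exact: mulc_orth.
have [mH _] := mulc_H2 aH.
have B1 := coef_bound_lin (-1) (H2_coef_bound mH) (H2_coef_bound yH).
apply/funext => n.
have := ev_eq0 B1 ltr01 _ n; rewrite mulN1r => h.
apply/eqP; rewrite -subr_eq0 addrC h// => z _ z1.
by rewrite (ev_lin _ (H2_coef_bound mH) (H2_coef_bound yH) z1) ya// mulc_ev// mulN1r addNr.
Qed.

End Bounded.
End Multiplication.

(** * Orthonormality of the shifts of an inner function *)

Section Inner.
Variable R : realType.
Implicit Types (x y h : cseq R) (z : R[i]).
Local Notation Sh k c := (iter k (@ushift R) c).
Local Notation mu := (@lebesgue_measure R).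

Lemma trig_dilate_cvg h N (t : R) :
  (fun j => trig (dilate (rad R j) h) N t) @ \oo --> trig h N t.
Proof.
elim: N => [|N IH].
  rewrite /trig big_geq//.
  have -> : (fun j => \sum_(0 <= k < 0) dilate (rad R j) h k * cexpi t ^+ k) = (fun=> 0).
    by apply/funext => j; rewrite big_geq.
  exact: cvgc_cst.
have r1 : (fun j => (rad R j ^+ N)%:C) @ \oo --> (1 : R[i]).
  by apply: cvgcReIm => /=; [exact: radX_cvg|exact: cvg_cst].
have h1 : (fun j => h N * cexpi t ^+ N * (rad R j ^+ N)%:C) @ \oo --> (h N * cexpi t ^+ N * 1).
  exact: (cvgcZ r1).
have := cvgcD IH h1.
have -> : trig h N.+1 t = trig h N t + h N * cexpi t ^+ N * 1.
  by rewrite /trig big_nat_recr//= mulr1.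
have -> // : (fun j => trig (dilate (rad R j) h) N.+1 t) =
  (fun j => trig (dilate (rad R j) h) N t + h N * cexpi t ^+ N * (rad R j ^+ N)%:C).
by apply/funext => j; rewrite /trig big_nat_recr//= /dilate mulrAC.
Qed.

Lemma rad_at_left : rad R @ \oo --> (1 : R)^'-.
Proof.
move=> A [e /= e0 eA]; have /cvgrPdist_lt/(_ _ e0)[N _ NP] := @rad_cvg R.
exists N => // n /NP h; apply: eA => //=.
by case/andP: (rad01 R n).
Qed.

Lemma trig_le h N (t r : R) : 0 < r < 1 ->
  normc (trig (dilate r h) N t) <= \sum_(0 <= k < N) normc (h k).
Proof.
move=> /andP[r0 r1]; apply: le_trans (normc_sum _ _ _) _; apply: ler_sum => k _.
rewrite normcMM normcX normc_cexpi expr1n mulr1 /dilate normcMM normc_real.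
rewrite ger0_norm ?exprn_ge0 ?(ltW r0)// ler_piMr ?normc_ge0//.
by rewrite exprn_ile1// ltW.
Qed.

Variables (f : R[i] -> R[i]) (M : R) (c : cseq R).
Hypothesis df : holomorphic_on_disc f.
Hypothesis fM : forall z, in_disc z -> normc (f z) <= M.
Hypothesis cB : coef_bound (2 * M) c.
Hypothesis fc : forall z, in_disc z -> f z = ev c z.
Hypothesis f_radial : {ae mu, forall t : R, exists l : R[i],
       (fun r : R => f (r%:C * cexpi t)) @ (1 : R)^'- --> l /\ normc l = 1}.

(** Where the radial limit exists, |f| tends to 1 along [rad] and only the trigonometric polynomial
    remains. The integrands are dominated by the constant K, so an exceptional null set does no
    harm. *)
Lemma inner_circle_cvg h N :
  (fun j => Rint 0 (2 * pi) (fun t =>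
     normc (trig (dilate (rad R j) h) N t * f ((rad R j)%:C * cexpi t)) ^+ 2)) @ \oo -->
  Rint 0 (2 * pi) (fun t => normc (trig h N t) ^+ 2).
Proof.
pose D := [set` `[0, 2 * pi : R]].
pose F j t : R := normc (trig (dilate (rad R j) h) N t * f ((rad R j)%:C * cexpi t)) ^+ 2.
pose G t : R := normc (trig h N t) ^+ 2.
pose K : R := ((\sum_(0 <= k < N) normc (h k)) * M) ^+ 2.
have cF j : continuous (F j).
  exact: (ccont_normc_sq (ccontM (ccont_trig _ _) (ccont_fcircle df (rad01 R j)))).
have cG : continuous G by exact: (ccont_normc_sq (ccont_trig _ _)).
have cK : continuous (fun _ : R => K) by move=> ?; exact: cvg_cst.
have iF j := Rint_integrable 0 (2 * pi) (cF j).
have iG := Rint_integrable 0 (2 * pi) cG.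
have iK := Rint_integrable 0 (2 * pi) cK.
have mD : measurable D by exact: measurable_itv.
have [] := @dominated_convergence _ _ R mu D mD (fun j t => (F j t)%:E)
   (fun t => (G t)%:E) (fun t => K%:E).
- by move=> j; exact: (measurable_int mu (iF j)).
- exact: (measurable_int mu iG).
- have [A [mA A0 AP]] := f_radial; exists A; split=> // t; apply: contraPP => /= nA.
  have [l [fl l1]] : exists l : R[i],
     (fun r : R => f (r%:C * cexpi t)) @ (1 : R)^'- --> l /\ normc l = 1.
    by apply: contra_notP nA => H; exact: AP.
  apply => _.
  apply/cvg_EFin; first exact: nearW.
  have n1 := cvgc_normc (@trig_dilate_cvg h N t).
  have fl' : (fun j => f ((rad R j)%:C * cexpi t)) @ \oo --> l.
    exact: (cvg_comp _ _ rad_at_left fl).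
  have n2 := cvgc_normc fl'; rewrite l1 in n2.
  pose u j : R := normc (trig (dilate (rad R j) h) N t) * normc (f ((rad R j)%:C * cexpi t)).
  have n3 : u @ \oo --> normc (trig h N t).
    by rewrite -(mulr1 (normc (trig h N t))); exact: (cvgM n1 n2).
  have n4 : (fun j => u j * u j) @ \oo --> normc (trig h N t) * normc (trig h N t).
    exact: (cvgM n3 n3).
  rewrite /G expr2 (_ : _ \o _ = (fun j => u j * u j)); first exact: n4.
  by apply/funext => j; rewrite /F /= normcMM expr2.
- exact: iK.
- apply: aeW => t j _; rewrite lee_fin ger0_norm ?sqr_ge0//.
  have h1 := trig_le h N t (rad01 R j).
  have h2 : normc (f ((rad R j)%:C * cexpi t)) <= M.
    apply: fM; rewrite /in_disc normcMM normc_cexpi mulr1 normc_real.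
    by have /andP[r0 r1] := rad01 R j; rewrite gtr0_norm.
  have s0 : 0 <= \sum_(0 <= k < N) normc (h k).
    by apply: sumr_ge0 => k _; exact: normc_ge0.
  have M0 : 0 <= M := le_trans (normc_ge0 _) h2.
  rewrite ler_sqr ?nnegrE ?normc_ge0 ?mulr_ge0// normcMM.
  by apply: ler_pM; rewrite ?normc_ge0.
move=> _ _ /= h3.
have E : (\int[mu]_(x in D) (G x)%:E)%E = (Rint 0 (2 * pi) G)%:E.
  by rewrite /Rint /Rintegral fineK//; exact: integrable_fin_num.
rewrite E in h3; exact: (fine_cvg h3).
Qed.

(** By Parseval and [inner_circle_cvg] the squared norms of the dilated product tend to the
    right-hand side. They never exceed that of the product itself, and each of its partial sums is a
    limit of dilated ones; this gives both inequalities. *)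
Lemma inner_nrm2 h N : nrm2 (pmul N h c) = series (fun n => normc (h n) ^+ 2) N.
Proof.
have pH := @pmul_H2 R f M c df fM cB fc h N.
have := @inner_circle_cvg h N; rewrite parseval_trig => cvgI.
have E j := @parseval_pmul R f M c df cB fc h N _ (rad01 R j).
have cv : (fun j => nrm2 (dilate (rad R j) (pmul N h c))) @ \oo -->
    series (fun n => normc (h n) ^+ 2) N.
  have tp := twopi_gt0 R.
  have -> : (fun j => nrm2 (dilate (rad R j) (pmul N h c))) =
     (fun j => (2 * pi)^-1 * Rint 0 (2 * pi) (fun t =>
     normc (trig (dilate (rad R j) h) N t * f ((rad R j)%:C * cexpi t)) ^+ 2)).
    by apply/funext => j; have [_ ->] := E j; rewrite mulKf// gt_eqF.
  have -> : series (fun n => normc (h n) ^+ 2) N =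
     (2 * pi)^-1 * (2 * pi * series (fun n => normc (h n) ^+ 2) N).
    by rewrite mulKf// gt_eqF.
  by apply: cvgM => //; exact: cvg_cst.
apply/eqP; rewrite eq_le; apply/andP; split.
  apply: nrm2_ub => // K.
  have c1 := @dilate_series_cvg R (pmul N h c) K.
  rewrite -(cvg_lim _ c1)// -(cvg_lim _ cv)//.
  apply: ler_lim; [by apply/cvg_ex; eexists; exact: c1|by apply/cvg_ex; eexists; exact: cv|].
  by apply: nearW => j; apply: series_le_nrm2; case: (E j).
apply: (cvgr_le cv) => j; apply: nrm2_ub; first by case: (E j).
move=> K; apply: le_trans (series_le_nrm2 K pH).
exact: dilate_series_le (rad01 R j).
Qed.

Let cH : H2 c. Proof. exact: (coef_H2 df fM cB fc). Qed.

Lemma inner_nrm2_shift k : nrm2 (Sh k c) = 1.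
Proof.
pose h : cseq R := fun n => (n == k)%:R.
have -> : Sh k c = pmul k.+1 h c.
  apply/funext => n; rewrite /pmul big_nat_recr//= big_nat_cond big1.
    by rewrite add0r /h eqxx mul1r.
  by move=> i /andP[/andP[_ ik] _]; rewrite /h (ltn_eqF ik) mul0r.
rewrite inner_nrm2 /series /= big_nat_recr//= big_nat_cond big1.
  by rewrite add0r /h eqxx normc11 expr1n.
by move=> i /andP[/andP[_ ik] _]; rewrite /h (ltn_eqF ik) normc00 expr0n.
Qed.

(** Polarization: for |a| = 1, [inner_nrm2] applied to 1 - a z^k gives |c - a Sh k c|^2 = 2 = |c|^2
    + |Sh k c|^2, so the cross term vanishes. Taking a = 1 and a = i kills the real and the
    imaginary part. *)
Lemma inner_orth k : (0 < k)%N -> ip c (Sh k c) = 0.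
Proof.
case: k => // k _; have sH : H2 (Sh k.+1 c) by exact: iter_H2.
have key (a : R[i]) : normc a = 1 -> Re (conjc a * ip c (Sh k.+1 c)) = 0.
  move=> a1.
  pose h : cseq R := fun n => (n == 0%N)%:R - a * (n == k.+1)%:R.
  have E : (fun n => c n - a * Sh k.+1 c n) = pmul k.+2 h c.
    apply/funext => n; rewrite /pmul big_nat_recr//=
      big_nat_recl//= big_nat_cond big1.
      by rewrite addr0 /h /= eqxx mulr0 subr0 mulr1 mul1r sub0r mulNr.
    move=> i /andP[/andP[_ ik] _]; rewrite /h /= eqSS (ltn_eqF ik) mulr0 subr0.
    by rewrite mul0r.
  have N2 : nrm2 (pmul k.+2 h c) = 2.
    rewrite inner_nrm2 /series /= big_nat_recr//= big_nat_recl//= big_nat_cond big1.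
      rewrite addr0 /h /= eqxx mulr0 subr0 mulr1 sub0r normcN a1 normc11 expr1n.
      by ring.
    move=> i /andP[/andP[_ ik] _]; rewrite /h /= eqSS (ltn_eqF ik) mulr0 subr0.
    by rewrite normc00 expr0n.
  have n0 : nrm2 c = 1 := inner_nrm2_shift 0.
  have := ip_ge0_expand a cH sH; rewrite E N2 (ip_conj cH sH) n0 (inner_nrm2_shift k.+1).
  rewrite mulcJ a1 expr1n.
  move=> /(congr1 (fun z => Re z)).
  rewrite ReD !ReB !ReM /=; case: (ip _ _) => p q; case: a {a1 h E N2} => u v /=; lra.
have h1 := key 1 (normc11 R).
have i1 : normc (0 +i* 1 : R[i]) = 1.
  by apply/eqP; rewrite -sqrp_eq1 ?normc_ge0// sqr_normcE /= expr0n expr1n add0r.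
have h2 := key _ i1.
move: h1 h2; case: (ip _ _) => p q; rewrite !ReM /= => h1 h2.
by apply: eqcP => /=; lra.
Qed.

End Inner.

(** * The compressed shift *)

Section CompressedShift.
Variable R : realType.
Implicit Types (x y w : cseq R).
Local Notation Sh k c := (iter k (@ushift R) c).

Lemma bshift_ushift x : bshift (ushift x) = x.
Proof. by []. Qed.

Lemma ip_bshift x y : H2 x -> H2 y -> ip (bshift x) y = ip x (ushift y).
Proof.
move=> xH yH; rewrite (ip_conj (ushift_H2 yH) xH) (ip_ushift yH xH).
by rewrite -(ip_conj yH (bshift_H2 xH)).
Qed.

Variable c : cseq R.
Hypothesis cH : H2 c.

(** The model space in the form of [model_spaceP], with the function present only through its
    coefficients. *)
Definition coinv : set (cseq R) := [set x | H2 x /\ forall k, ip x (Sh k c) = 0].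

Lemma coinv_sub : coinv `<=` @H2 R.
Proof. by move=> x []. Qed.

Let ShH k : H2 (Sh k c). Proof. exact: iter_H2. Qed.

Lemma coinv_lin (a : R[i]) x y : coinv x -> coinv y -> coinv (fun n => a * x n + y n).
Proof.
move=> [xH x0] [yH y0]; split; first exact: H2_lin.
by move=> k; rewrite (ip_lin a xH yH (@ShH k)) x0 y0 mulr0 addr0.
Qed.

Lemma coinv0 : coinv (@zero_seq R).
Proof. by split=> [|k]; [exact: H2_0|rewrite ip0l]. Qed.

Lemma coinv_B x y : coinv x -> coinv y -> coinv (fun n => x n - y n).
Proof.
move=> xc yc; have := coinv_lin (-1) yc xc.
by under eq_fun do rewrite mulN1r addrC.
Qed.

Lemma coinv_bshift x : coinv x -> coinv (bshift x).
Proof.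
move=> [xH x0]; split; first exact: bshift_H2.
by move=> k; rewrite (ip_bshift xH (@ShH k)); exact: (x0 k.+1).
Qed.

Lemma orth_closed (w : cseq R) (u : nat -> cseq R) y : H2 w -> (forall k, H2 (u k)) ->
  (forall k, ip (u k) w = 0) -> H2 y ->
  (fun k => nrm (fun n => u k n - y n)) @ \oo --> (0 : R) -> ip y w = 0.
Proof.
move=> wH uH u0 yH /cvgrPdist_lt uy.
apply/eqP; rewrite -normc_eq0 eq_le normc_ge0 andbT; apply/ler_addgt0Pl => e e0.
rewrite addr0; have k0 : 0 < nrm w + 1 by rewrite ltr_wpDl ?nrm_ge0.
have [N _ /(_ N (leqnn N))] := uy _ (divr_gt0 e0 k0).
rewrite /= sub0r normrN ger0_norm ?nrm_ge0// => h.
have uyH := H2_B (uH N) yH.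
have -> : ip y w = - ip (fun n => u N n - y n) w.
  by rewrite (ipBl (uH N) yH wH) u0 sub0r opprK.
rewrite normcN; apply: le_trans (ip_cauchy_schwarz uyH wH) _.
have h2 : nrm (fun n => u N n - y n) * (nrm w + 1) <= e by rewrite -ler_pdivlMr// ltW.
apply: le_trans h2; rewrite ler_wpM2l ?nrm_ge0//; lra.
Qed.

Lemma coinv_closed : nrm_closed coinv.
Proof.
move=> u y uc yH uy; split => // k.
by apply: (orth_closed (@ShH k) _ _ yH uy) => j; case: (uc j).
Qed.

Lemma eq_from_ip x y : coinv x -> coinv y ->
  (forall w, coinv w -> ip x w = ip y w) -> x = y.
Proof.
move=> xc yc xy; have dc := coinv_B xc yc.
have xH := coinv_sub xc; have yH := coinv_sub yc; have dH := coinv_sub dc.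
have := ip_self dH; rewrite (ipBl xH yH dH) (xy _ dc) subrr => /esym/RtoC_inj d0.
have := nrm2_eq0 dH d0 => /(congr1 (fun s => (fun n => s n + y n))).
under eq_fun do rewrite subrK.
by under [RHS]eq_fun do rewrite /zero_seq add0r.
Qed.

Variable T : cseq R -> cseq R.
Hypothesis TP : forall x, coinv x -> is_proj coinv (ushift x) (T x).

Lemma T_coinv x : coinv x -> coinv (T x).
Proof. by move=> /TP[]. Qed.

(** The adjoint of the compression is the backward shift itself, since [coinv] is invariant under
    it. Identities for T are obtained by testing against [coinv]. *)
Lemma ip_T x w : coinv x -> coinv w -> ip (T x) w = ip x (bshift w).
Proof.
move=> xc wc; have [Tc /(_ _ wc)] := TP xc.
have xH := coinv_sub xc; have wH := coinv_sub wc.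
rewrite (ipBl (ushift_H2 xH) (coinv_sub Tc) wH) (ip_ushift xH wH).
by move=> /eqP; rewrite subr_eq0 => /eqP ->.
Qed.

Lemma ip_TT x w : coinv x -> coinv w -> ip (T (T x)) w = ip x (bshift (bshift w)).
Proof.
by move=> xc wc; rewrite !ip_T//; [exact: coinv_bshift|exact: T_coinv].
Qed.

Lemma T_lin (a : R[i]) x y : coinv x -> coinv y ->
  T (fun n => a * x n + y n) = (fun n => a * T x n + T y n).
Proof.
move=> xc yc; have lc := coinv_lin a xc yc.
have Tx := T_coinv xc; have Ty := T_coinv yc.
apply: eq_from_ip; [exact: T_coinv|exact: coinv_lin|move=> w wc].
have bH := coinv_sub (coinv_bshift wc).
rewrite (ip_T lc wc) (ip_lin a (coinv_sub xc) (coinv_sub yc) bH).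
by rewrite (ip_lin a (coinv_sub Tx) (coinv_sub Ty) (coinv_sub wc)) !ip_T.
Qed.

(** Makes T an admissible commuting operator in the definition of [Lat']. The bound comes from |T
    x|^2 = <S x, T x> <= |x| |T x|. *)
Lemma T_bounded : bounded_op coinv T.
Proof.
split; first exact: T_coinv.
split; first by move=> a x y; exact: T_lin.
exists 1 => x xc; rewrite mul1r; have [Tc _] := TP xc.
have xH := coinv_sub xc; have TH := coinv_sub Tc.
have [T0|T0] := eqVneq (nrm (T x)) 0; first by rewrite T0 nrm_ge0.
have Tp : 0 < nrm (T x) by rewrite lt_neqAle eq_sym T0 nrm_ge0.
rewrite -(ler_pM2r Tp) -expr2 (sqr_nrm TH).
have := ip_self TH; rewrite (ip_T xc Tc) => E.
have := ip_cauchy_schwarz (ushift_H2 xH) TH; rewrite (ip_ushift xH TH) E normc_real.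
rewrite (ger0_norm (nrm2_ge0 TH)) => h; apply: le_trans h _.
rewrite ler_wpM2r ?nrm_ge0//; apply: nrm2_le_nrm; [exact: ushift_H2|exact: nrm_ge0|].
by rewrite sqr_nrm//; exact: nrm2_ushift_le.
Qed.

Lemma TT_adjoint : is_adjoint coinv (fun x => T (T x)) (fun x => bshift (bshift x)).
Proof.
split=> [x xc|x y xc yc]; last exact: ip_TT.
by do 2 apply: coinv_bshift.
Qed.

(** Here d stands for the coefficients of the even divisor p, so [B k] is S*^(k+1) p. *)
Lemma odd_shift_lat (d : cseq R) : H2 d -> coinv (bshift d) ->
  (forall n, odd n -> d n = 0) -> ~ (forall n, d n.+1 = 0) ->
  Lat coinv (fun x => T (T x)) <> Lat' coinv (fun x => T (T x)).
Proof.
move=> dH bdc dodd dn E.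
pose B k := iter k (@bshift R) (bshift d).
have Bc k : coinv (B k) by elim: k => // k; exact: coinv_bshift.
have BE k n : B k n = d (n + k).+1.
  elim: k n => [|k IH] n; first by rewrite addn0.
  by rewrite /B /= /bshift -/(B k) IH addSnnS.
pose M := [set x | coinv x /\ forall k, ip x (B k.*2) = 0].
have Ml : Lat coinv (fun x => T (T x)) M.
  split; first split.
  - by move=> x [].
  - split; first by split=> [|k]; [exact: coinv0|exact: ip0l].
    split.
      move=> a x y [xc x0] [yc y0]; split; first exact: coinv_lin.
      move=> k; rewrite (ip_lin a (coinv_sub xc) (coinv_sub yc) (coinv_sub (Bc _))).
      by rewrite x0 y0 mulr0 addr0.
    move=> u y uM yc uy; split => // k.
    apply: (orth_closed (coinv_sub (Bc _)) _ _ (coinv_sub yc) uy) => j.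
      by case: (uM j) => /coinv_sub.
    by case: (uM j).
  - move=> x [xc x0]; split; first by do 2 apply: T_coinv.
    by move=> k; rewrite ip_TT//; exact: (x0 k.+1).
rewrite E in Ml; have [_ ML] := Ml.
(* Disjoint supports: [B 1] lives on even indices and [B k.*2] on odd ones. *)
have MB : M (B 1%N).
  split => // k; apply: cvgc_lim.
  have -> : series (fun n => B 1%N n * conjc (B k.*2 n)) = (fun=> 0).
    apply/funext => N; apply: big1 => n _; rewrite (BE 1%N n) (BE k.*2 n).
    have [on|en] := boolP (odd n).
      have dn2 : d n.+2 = 0 by apply: dodd; rewrite /= negbK.
      by rewrite addn1 dn2 mul0r.
    have dk : d (n + k.*2).+1 = 0 by apply: dodd; rewrite /= oddD odd_double addbF.
    by rewrite dk conjc0 mulr0.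
  exact: cvgc_cst.
have [_ /(_ 0%N)] := ML T T_bounded (fun _ _ => erefl) _ MB.
rewrite double0 (ip_T (Bc 1%N) (Bc 0%N)) (ip_self (coinv_sub (Bc 1%N))) => /RtoC_inj h.
have B0 := nrm2_eq0 (coinv_sub (Bc 1%N)) h.
(* [B 1] = 0 removes d from index 2 on, and d 1 vanishes by parity, so d would be constant. *)
apply: dn => -[|n]; first exact: dodd.
by have := congr1 (fun s => s n) B0; rewrite BE addn1.
Qed.

End CompressedShift.

(** * The projection onto sequences of pairs on a line *)

Section PairProjection.
Variables (R : realType) (a b : R[i]).
Implicit Types (x y : cseq R).

(* The projection of [x] onto the sequences whose consecutive pairs
   [(x (2n), x (2n+1))] are multiples of the unit vector [(a, b)]. *)
Definition pairproj x : cseq R := fun n =>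
  if odd n then b * (conjc a * x n.-1 + conjc b * x n)
  else a * (conjc a * x n + conjc b * x n.+1).

Definition evenpart x : cseq R := fun n => if odd n then 0 else x n.

Lemma evenpart_H2 x : H2 x -> H2 (evenpart x).
Proof.
move=> xH; apply: (@H2_bound _ _ (nrm2 x)) => n; apply: le_trans (series_le_nrm2 n xH).
apply: ler_sum => k _; rewrite /evenpart; case: ifP => _ //.
by rewrite normc00 expr0n; exact: sqr_ge0.
Qed.

Lemma ip_evenpart x y : ip (evenpart x) y = ip x (evenpart y).
Proof.
congr (limn (series _)); apply/funext => n; rewrite /evenpart.
by case: (odd n); rewrite ?mul0r ?conjc0 ?mulr0.
Qed.

(** With E the even part, the four blocks are E, E S*, S E and 1 - E. E is self-adjoint and the two
    middle blocks are adjoint to each other, which yields [pairproj_adj]. *)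
Lemma pairprojE x : pairproj x = (fun n =>
  a * conjc a * evenpart x n + (a * conjc b * evenpart (bshift x) n +
  (b * conjc a * ushift (evenpart x) n + (b * conjc b * (x n - evenpart x n))))).
Proof.
apply/funext => -[|n]; rewrite /pairproj /evenpart /bshift /=; first by ring.
by case: (odd n) => /=; ring.
Qed.

Lemma pairproj_H2 x : H2 x -> H2 (pairproj x).
Proof.
move=> xH; have eH := evenpart_H2 xH.
rewrite pairprojE; apply: H2_lin => //; apply: H2_lin.
  by apply: evenpart_H2; exact: bshift_H2.
by apply: H2_lin; [exact: ushift_H2|apply: H2_Z; exact: H2_B].
Qed.

Lemma pairproj_adj x y : H2 x -> H2 y -> ip (pairproj x) y = ip x (pairproj y).
Proof.
move=> xH yH; have exH := evenpart_H2 xH; have eyH := evenpart_H2 yH.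
have ebx := evenpart_H2 (bshift_H2 xH); have eby := evenpart_H2 (bshift_H2 yH).
have uex := ushift_H2 exH; have uey := ushift_H2 eyH.
have ox := H2_B xH exH; have oy := H2_B yH eyH.
rewrite !pairprojE.
rewrite (ip_lin _ exH (H2_lin _ ebx (H2_lin _ uex (H2_Z _ ox))) yH).
rewrite (ip_lin _ ebx (H2_lin _ uex (H2_Z _ ox)) yH) (ip_lin _ uex (H2_Z _ ox) yH).
rewrite (ipZl _ ox yH) (ipBl xH exH yH).
rewrite (ipDr (H2_Z _ eyH) (H2_lin _ eby (H2_lin _ uey (H2_Z _ oy))) xH).
rewrite (ipDr (H2_Z _ eby) (H2_lin _ uey (H2_Z _ oy)) xH) (ipDr (H2_Z _ uey) (H2_Z _ oy) xH).
rewrite (ipZr _ xH eyH) (ipZr _ xH eby) (ipZr _ xH uey) (ipZr _ xH oy) (ipBr yH eyH xH).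
rewrite !rmorphM /= !conjcK.
rewrite !ip_evenpart (ip_ushift exH yH) ip_evenpart (ip_bshift xH eyH).
ring.
Qed.

Lemma pairproj_bshift2 x : pairproj (bshift (bshift x)) = bshift (bshift (pairproj x)).
Proof.
apply/funext => -[|n]; rewrite /pairproj /bshift //=.
by case: (odd n).
Qed.

Lemma ev_even x z : (forall n, odd n -> x n = 0) -> ev x (- z) = ev x z.
Proof.
move=> x0; rewrite ev_opp; congr ev; apply/funext => n.
have [/x0 ->|en] := boolP (odd n); first by rewrite mulr0.
by rewrite -signr_odd (negbTE en) expr0 mul1r.
Qed.

(** The hypothesis says that the odd coefficients of (u + v z) x vanish, so this product is an even
    function. *)
Lemma ev_pair (u v : R[i]) x z : H2 x -> in_disc z ->
  (forall n, ~~ odd n -> u * x n.+1 + v * x n = 0) ->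
  (u + v * z) * ev x z = (u - v * z) * ev x (- z).
Proof.
move=> xH z1 xP; have nz1 : in_disc (- z) by rewrite /in_disc normcN.
pose y : cseq R := fun n => v * ushift x n + u * x n.
have uxH := ushift_H2 xH.
have yH : H2 y by apply: H2_lin => //; exact: H2_Z.
have yE w : in_disc w -> ev y w = (u + v * w) * ev x w.
  move=> w1; rewrite (ev_lin v (H2_coef_bound uxH) (H2_coef_bound (H2_Z u xH)) w1).
  rewrite (ev_ushift (H2_coef_bound xH) w1).
  have := ev_lin u (H2_coef_bound xH) (H2_coef_bound (@H2_0 R)) w1.
  rewrite ev_zero.
  have -> : (fun n => u * x n + zero_seq R n) = (fun n => u * x n).
    by apply/funext => n; rewrite /zero_seq addr0.
  by move=> ->; ring.
have yodd n : odd n -> y n = 0.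
  by case: n => // n on; rewrite /y /= addrC xP.
have h := ev_even z yodd; rewrite (yE _ z1) (yE _ nz1) in h.
by rewrite -h; congr (_ * _); ring.
Qed.

End PairProjection.

Arguments pairproj_H2 {R} a b {x} _.

(** * Subspaces reducing the square of the compressed shift *)

Section Reducing.
Variables (R : realType) (c : cseq R).
Implicit Types (x y w : cseq R).
Local Notation Sh k c := (iter k (@ushift R) c).
Hypothesis cH : H2 c.
Hypothesis c_unit : ip c c = 1.
Hypothesis c_orth : forall k, ip c (Sh k.+1 c) = 0.
Variable T : cseq R -> cseq R.
Hypothesis TP : forall x, coinv c x -> is_proj (coinv c) (ushift x) (T x).

Let ucH : H2 (ushift c). Proof. exact: ushift_H2. Qed.

Let uc_c : ip (ushift c) c = 0.
Proof. by rewrite (ip_conj cH ucH) (c_orth 0) conjc0. Qed.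

(** Minus its components along c and [ushift c], v is orthogonal to every [Sh k c] and so lies in
    [coinv c]; it is also orthogonal to [coinv c], hence zero. *)
Lemma orth_coinv_span v : H2 v -> (forall w, coinv c w -> ip v w = 0) ->
  (forall k, ip v (Sh k.+2 c) = 0) ->
  v = (fun n => ip v c * c n + ip v (ushift c) * ushift c n).
Proof.
move=> vH vo v2; set g0 := ip v c; set g1 := ip v (ushift c).
pose s : cseq R := fun n => g0 * c n + g1 * ushift c n.
have sH : H2 s by apply: H2_lin => //; exact: H2_Z.
have ips w : H2 w -> ip s w = g0 * ip c w + g1 * ip (ushift c) w.
  by move=> wH; rewrite (ip_lin g0 cH (H2_Z g1 ucH) wH) (ipZl g1 ucH wH).
pose d : cseq R := fun n => v n - s n.
have dH : H2 d by exact: H2_B.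
have dc : coinv c d.
  split=> // k; have kH : H2 (Sh k c) by exact: iter_H2.
  rewrite (ipBl vH sH kH) (ips _ kH); case: k kH => [|[|k]] kH.
  - by rewrite /= c_unit uc_c mulr0 addr0 mulr1 subrr.
  - by rewrite (c_orth 0) (ip_ushift cH kH) /= bshift_ushift c_unit mulr0 add0r mulr1 subrr.
  - rewrite v2 c_orth (ip_ushift cH kH).
    have -> : bshift (Sh k.+2 c) = Sh k.+1 c by [].
    by rewrite c_orth !mulr0 addr0 subrr.
have d0 : ip d d = 0.
  have [_ dk] := dc.
  rewrite {1}/d (ipBl vH sH dH) (vo _ dc) (ips _ dH) sub0r.
  rewrite (ip_conj dH cH) (dk 0%N) (ip_conj dH ucH) (dk 1%N) conjc0 !mulr0 addr0.
  by rewrite oppr0.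
have := nrm2_eq0 dH; rewrite (ip_self dH) in d0; move=> /(_ (RtoC_inj d0)) E.
apply/funext => n; have := congr1 (fun q => q n) E; rewrite /d /zero_seq => /eqP.
by rewrite subr_eq0 => /eqP.
Qed.

Variable M : set (cseq R).
Hypothesis Mcl : closed_subspace (coinv c) M.
Hypothesis Minv : op_invariant (fun x => T (T x)) M.
Hypothesis Madj : forall B, is_adjoint (coinv c) (fun x => T (T x)) B -> op_invariant B M.

Let M_coinv : M `<=` coinv c. Proof. by case: Mcl. Qed.
Let N := [set x | coinv c x /\ forall y, M y -> ip x y = 0].

Let M_b2 x : M x -> M (bshift (bshift x)).
Proof. exact: (Madj (TT_adjoint cH TP)). Qed.

Let N_b2 x : N x -> N (bshift (bshift x)).
Proof.
move=> [xc x0]; have bc : coinv c (bshift (bshift x)) by do 2 apply: (coinv_bshift cH).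
split=> // y My; have yc := M_coinv My.
have xH := coinv_sub xc; have yH := coinv_sub yc.
rewrite (ip_conj yH (coinv_sub bc)) -(ip_TT cH TP yc xc).
have TTc := M_coinv (Minv My).
by rewrite (ip_conj xH (coinv_sub TTc)) (x0 _ (Minv My)) conjcK.
Qed.

(** Both <x, y> and <S*^2 x, S*^2 y> vanish, and they differ exactly by the product of the leading
    pairs. *)
Let MN_pair x y : M x -> N y -> x 0%N * conjc (y 0%N) + x 1%N * conjc (y 1%N) = 0.
Proof.
move=> Mx Ny; have xH := coinv_sub (M_coinv Mx); have yH := coinv_sub Ny.1.
have ort u v : M u -> N v -> ip u v = 0.
  move=> Mu Nv; rewrite (ip_conj (coinv_sub Nv.1) (coinv_sub (M_coinv Mu))).
  by rewrite (Nv.2 _ Mu) conjc0.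
have := ort _ _ Mx Ny.
rewrite (ip_split xH yH) (ip_split (bshift_H2 xH) (bshift_H2 yH)).
by rewrite (ort _ _ (M_b2 Mx) (N_b2 Ny)) addr0.
Qed.

(** The pair at an even place is the leading pair of an iterate under S*^2, so a property of leading
    pairs spreads to all pairs. *)
Let pair_ind (P : set (cseq R)) (Q : R[i] -> R[i] -> Prop) :
  (forall x, P x -> P (bshift (bshift x))) -> (forall x, P x -> Q (x 0%N) (x 1%N)) ->
  forall x n, P x -> ~~ odd n -> Q (x n) (x n.+1).
Proof.
move=> Pb PQ x n; elim/ltn_ind: n x => -[|[|n]] IH x Px //= on; first exact: PQ.
by have := IH n (ltnW (leqnn _)) _ (Pb _ Px); apply; rewrite negbK in on.
Qed.

Let pair_zero (P : set (cseq R)) :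
  (forall x, P x -> P (bshift (bshift x))) -> (forall x, P x -> x 0%N = 0 /\ x 1%N = 0) ->
  forall x, P x -> x = @zero_seq R.
Proof.
move=> Pb P0 x Px; apply/funext => n.
have h k := @pair_ind P (fun u v => u = 0 /\ v = 0) Pb P0 x k Px.
have [on|en] := boolP (odd n); last by case: (h n en).
case: n on => // n on; by case: (h n on).
Qed.

Lemma reducing_split x : coinv c x -> exists y, M y /\ N (fun n => x n - y n).
Proof.
move=> xc; have [M1 [M2 [M3 M4]]] := Mcl.
have Ms : subspace M by split => // y /M_coinv/coinv_sub.
have Mn : nrm_closed M.
  move=> u y uM yH uy; apply: (M4 u) => //.
  by apply: (coinv_closed cH _ yH uy) => k; exact: M_coinv.
have [y My yo] := hilbert_projection Ms Mn (coinv_sub xc).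
exists y; split => //; split => //.
by apply: coinv_B => //; exact: M_coinv.
Qed.

(** [ev_pair] applied to Q m, m - Q m, Q (z m) and z m - Q (z m), where Q m = (g0 + g1 z) m and Q (z
    m) = (conj g1 + d1 z) m. *)
Definition reducing_equations (a b g0 g1 d1 : R[i]) := forall z, in_disc z ->
  [/\ (g0 + g1 * z) * ev c z * (a - b * z) = (g0 - g1 * z) * ev c (- z) * (a + b * z),
      (1 - g0 - g1 * z) * ev c z * (conjc b + conjc a * z) =
      (1 - g0 + g1 * z) * ev c (- z) * (conjc b - conjc a * z),
      (conjc g1 + d1 * z) * ev c z * (a - b * z) =
      (conjc g1 - d1 * z) * ev c (- z) * (a + b * z) &
      ((1 - d1) * z - conjc g1) * ev c z * (conjc b + conjc a * z) =
      (- ((1 - d1) * z) - conjc g1) * ev c (- z) * (conjc b - conjc a * z)].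

Lemma reducing_trichotomy : [\/ M = [set @zero_seq R], M = coinv c |
  exists a b g0 g1 d1, a * conjc a + b * conjc b = 1 /\ reducing_equations a b g0 g1 d1].
Proof.
have [_ [M0 _]] := Mcl.
have [Mz|/existsNP[x0 /not_implyP[Mx0 x0n]]] :=
    pselect (forall x, M x -> x 0%N = 0 /\ x 1%N = 0).
  apply: Or31; apply/seteqP; split=> [x Mx|_ ->//].
  exact: (pair_zero M_b2 Mz).
have [Nz|/existsNP[y0 /not_implyP[Ny0 y0n]]] :=
    pselect (forall x, N x -> x 0%N = 0 /\ x 1%N = 0).
  apply: Or32; apply/seteqP; split=> [x|x xc]; first exact: M_coinv.
  have [y [My Nxy]] := reducing_split xc.
  have := pair_zero N_b2 Nz Nxy => E.
  have -> // : x = y.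
  apply/funext => n; have := congr1 (fun q => q n) E; rewrite /zero_seq => /eqP.
  by rewrite subr_eq0 => /eqP.
apply: Or33.
(* A nonzero leading pair in M determines the line; dividing by its length gives the unit vector (a,
   b). *)
pose s2 := normc (x0 0%N) ^+ 2 + normc (x0 1%N) ^+ 2.
have s2p : 0 < s2.
  rewrite lt_neqAle addr_ge0 ?sqr_ge0// andbT eq_sym; apply/negP.
  rewrite paddr_eq0 ?sqr_ge0// !sqrf_eq0 !normc_eq0 => /andP[/eqP h1 /eqP h2].
  exact: x0n.
pose s := Num.sqrt s2.
have sp : 0 < s by rewrite sqrtr_gt0.
have sC : s%:C != 0 by rewrite RtoC_eq0 gt_eqF.
pose a := x0 0%N / s%:C; pose b := x0 1%N / s%:C.
have cs u : conjc (u / s%:C) = conjc u / s%:C.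
  by rewrite -RtoCV rmorphM; congr (_ * _); apply: eqcP => //=; rewrite oppr0.
have ab1 : a * conjc a + b * conjc b = 1.
  rewrite /a /b !cs.
  have -> : x0 0%N / s%:C * (conjc (x0 0%N) / s%:C) + x0 1%N / s%:C * (conjc (x0 1%N) / s%:C)
     = (x0 0%N * conjc (x0 0%N) + x0 1%N * conjc (x0 1%N)) / (s%:C * s%:C) by field.
  rewrite !mulcJ -RtoCD -/s2 -RtoCM -expr2 sqr_sqrtr ?ltW// divff//.
  by rewrite RtoC_eq0 gt_eqF.
have Npair y : N y -> conjc a * y 0%N + conjc b * y 1%N = 0.
  move=> Ny.
  have -> : conjc a * y 0%N + conjc b * y 1%N =
      conjc (x0 0%N * conjc (y 0%N) + x0 1%N * conjc (y 1%N)) / s%:C.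
    rewrite [conjc a]cs [conjc b]cs rmorphD !rmorphM /= !conjcK.
    by rewrite mulrDl mulrAC [X in _ + X]mulrAC.
  by rewrite (MN_pair Mx0 Ny) conjc0 mul0r.
clearbody a b.
(* In C^2 the leading pair of x and (a, b) are both orthogonal to the nonzero leading pair of [y0],
   hence proportional; the cases tell which entry of that pair can be cancelled. *)
have Mpair x : M x -> x 0%N * b = x 1%N * a.
  move=> Mx; have e1 := MN_pair Mx Ny0; have := Npair _ Ny0.
  move=> /(congr1 (fun z => conjc z)); rewrite conjc0 rmorphD !rmorphM /= !conjcK => e2.
  have [h1|h1] := eqVneq (y0 0%N) 0; last first.
    apply: (@mulfI _ (conjc (y0 0%N))); first by rewrite conjc_eq0.
    have -> : conjc (y0 0%N) * (x 0%N * b) = x 0%N * conjc (y0 0%N) * b by ring.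
    have -> : conjc (y0 0%N) * (x 1%N * a) = x 1%N * (a * conjc (y0 0%N)) by ring.
    move/eqP: e1; rewrite addr_eq0 => /eqP ->; move/eqP: e2; rewrite addr_eq0 => /eqP ->.
    by ring.
  have h2 : y0 1%N != 0 by apply/negP => /eqP h2; apply: y0n.
  apply: (@mulfI _ (conjc (y0 1%N))); first by rewrite conjc_eq0.
  have -> : conjc (y0 1%N) * (x 0%N * b) = x 0%N * (b * conjc (y0 1%N)) by ring.
  have -> : conjc (y0 1%N) * (x 1%N * a) = (x 1%N * conjc (y0 1%N)) * a by ring.
  move/eqP: e1; rewrite addrC addr_eq0 => /eqP ->; move/eqP: e2; rewrite addrC addr_eq0 => /eqP ->.
  by rewrite h1 conjc0 !mulr0 oppr0 mulr0 mul0r.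
have Qid x : M x -> pairproj a b x = x.
  move=> Mx; apply/funext => n.
  have h k ek : x k * b = x k.+1 * a := @pair_ind M (fun u v => u * b = v * a) M_b2 Mpair x k Mx ek.
  have [on|en] := boolP (odd n); rewrite /pairproj.
    case: n on => // n on; rewrite on /=.
    have -> : b * (conjc a * x n + conjc b * x n.+1) = conjc a * (x n * b) + b * conjc b * x n.+1 by ring.
    rewrite (h _ on).
    have -> : conjc a * (x n.+1 * a) = a * conjc a * x n.+1 by ring.
    by rewrite -mulrDl ab1 mul1r.
  rewrite (negbTE en).
  have -> : a * (conjc a * x n + conjc b * x n.+1) = a * conjc a * x n + conjc b * (x n.+1 * a) by ring.
  rewrite -(h _ en).
  have -> : conjc b * (x n * b) = b * conjc b * x n by ring.
  by rewrite -mulrDl ab1 mul1r.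
have Q0 y : N y -> pairproj a b y = @zero_seq R.
  move=> Ny; apply/funext => n.
  have h k ek : conjc a * y k + conjc b * y k.+1 = 0 :=
    @pair_ind N (fun u v => conjc a * u + conjc b * v = 0) N_b2 Npair y k Ny ek.
  have [on|en] := boolP (odd n); rewrite /pairproj.
    by case: n on => // n on; rewrite on /= (h _ on) mulr0.
  by rewrite (negbTE en) (h _ en) mulr0.
(* Being the identity on M and zero on N, [pairproj] sends w to its component in M. *)
have Qc w : coinv c w -> coinv c (pairproj a b w).
  move=> wc; have [y [My Nwy]] := reducing_split wc.
  have -> : pairproj a b w = y; last exact: M_coinv.
  rewrite -[RHS](Qid _ My); apply/funext => n.
  have := congr1 (fun q => q n) (Q0 _ Nwy); rewrite /pairproj /zero_seq.
  case: ifP => _ /eqP; rewrite -subr_eq0 subr0 => /eqP h; apply/eqP; rewrite -subr_eq0;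
    apply/eqP; rewrite -[RHS]h; ring.
(* By self-adjointness and [Qc] the image of v stays orthogonal to [coinv c]. Its product with
   [Sh k.+2 c] is that of [pairproj (bshift (bshift v))], a member of [coinv c], with [Sh k c],
   namely 0. This serves v = c and v = [ushift c]. *)
have Qspan v : H2 v -> (forall w, coinv c w -> ip v w = 0) ->
    coinv c (bshift (bshift v)) ->
    pairproj a b v = (fun n => ip (pairproj a b v) c * c n +
       ip (pairproj a b v) (ushift c) * ushift c n).
  move=> vH vo bv; have QH := pairproj_H2 a b vH.
  apply: orth_coinv_span => //.
    move=> w wc; rewrite (pairproj_adj a b vH (coinv_sub wc)); exact: vo (Qc _ wc).
  move=> k; have kH : H2 (Sh k c) by exact: iter_H2.
  rewrite -[Sh k.+2 c]/(ushift (ushift (Sh k c))).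
  rewrite -(ip_bshift QH (ushift_H2 kH)) -(ip_bshift (bshift_H2 QH) kH).
  rewrite -pairproj_bshift2; exact: (Qc _ bv).2.
have bc : coinv c (bshift c).
  split=> [|k]; first exact: bshift_H2.
  by rewrite (ip_bshift cH (@iter_H2 R c k cH)); exact: c_orth.
have e0 w : coinv c w -> ip c w = 0.
  by move=> [wH w0]; rewrite (ip_conj wH cH) (w0 0%N) conjc0.
have e1 w : coinv c w -> ip (ushift c) w = 0.
  by move=> [wH w0]; rewrite (ip_conj wH ucH) (w0 1%N) conjc0.
have S0 := Qspan c cH e0 (coinv_bshift cH bc).
have S1 := Qspan (ushift c) ucH e1 bc.
have QcH := pairproj_H2 a b cH; have QuH := pairproj_H2 a b ucH.
set g0 := ip (pairproj a b c) c in S0; set g1 := ip (pairproj a b c) (ushift c) in S0.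
set d1 := ip (pairproj a b (ushift c)) (ushift c) in S1.
(* The matrix of a self-adjoint operator on the pair c, [ushift c] is Hermitian. *)
have d0 : ip (pairproj a b (ushift c)) c = conjc g1.
  by rewrite (pairproj_adj a b ucH cH) (ip_conj QcH ucH).
rewrite d0 in S1; clearbody g0 g1 d1.
exists a, b, g0, g1, d1; split => // z z1.
have evQ (u v w : R[i]) : in_disc w -> ev (fun n => u * c n + v * ushift c n) w = (u + v * w) * ev c w.
  move=> w1; have vH := H2_Z v ucH.
  rewrite (ev_lin u (H2_coef_bound cH) (H2_coef_bound vH) w1).
  have h := ev_lin v (H2_coef_bound ucH) (H2_coef_bound (@H2_0 R)) w1.
  have E1 : (fun n => v * ushift c n + zero_seq R n) = (fun n => v * ushift c n).
    by apply/funext => n; rewrite /zero_seq addr0.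
  rewrite E1 ev_zero addr0 (ev_ushift (H2_coef_bound cH) w1) in h.
  by rewrite h; ring.
have nz1 : in_disc (- z) by rewrite /in_disc normcN.
have rel1 x : H2 x -> (a - b * z) * ev (pairproj a b x) z = (a + b * z) * ev (pairproj a b x) (- z).
  move=> xH; have := @ev_pair R a (- b) _ z (pairproj_H2 a b xH) z1; rewrite mulNr opprK; apply.
  by move=> n en; rewrite /pairproj /= en /= (negbTE en); ring.
have rel2 x : H2 x -> (conjc b + conjc a * z) * ev (fun n => x n - pairproj a b x n) z =
    (conjc b - conjc a * z) * ev (fun n => x n - pairproj a b x n) (- z).
  move=> xH; apply: ev_pair => //; first exact: H2_B (pairproj_H2 a b xH).
  move=> n en; rewrite /pairproj /= en /= (negbTE en).
  have -> : conjc b * (x n.+1 - b * (conjc a * x n + conjc b * x n.+1)) +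
    conjc a * (x n - a * (conjc a * x n + conjc b * x n.+1)) =
    (conjc a * x n + conjc b * x n.+1) * (1 - (a * conjc a + b * conjc b)) by ring.
  by rewrite ab1 subrr mulr0.
have F1 : (fun n => c n - pairproj a b c n) = (fun n => (1 - g0) * c n + - g1 * ushift c n).
  by apply/funext => n; rewrite {1}S0; ring.
have F2 : (fun n => ushift c n - pairproj a b (ushift c) n) =
    (fun n => - conjc g1 * c n + (1 - d1) * ushift c n).
  by apply/funext => n; rewrite {1}S1; ring.
split.
- move: (rel1 _ cH); rewrite S0 (evQ g0 g1 z z1) (evQ g0 g1 (- z) nz1).
  move: (ev c z) (ev c (- z)) => p q h.
  have -> : (g0 + g1 * z) * p * (a - b * z) = (a - b * z) * ((g0 + g1 * z) * p) by ring.
  by rewrite h; ring.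
- move: (rel2 _ cH); rewrite F1 (evQ (1 - g0) (- g1) z z1) (evQ (1 - g0) (- g1) (- z) nz1).
  move: (ev c z) (ev c (- z)) => p q h.
  have -> : (1 - g0 - g1 * z) * p * (conjc b + conjc a * z) =
    (conjc b + conjc a * z) * ((1 - g0 + - g1 * z) * p) by ring.
  by rewrite h; ring.
- move: (rel1 _ ucH); rewrite S1 (evQ (conjc g1) d1 z z1) (evQ (conjc g1) d1 (- z) nz1).
  move: (ev c z) (ev c (- z)) => p q h.
  have -> : (conjc g1 + d1 * z) * p * (a - b * z) = (a - b * z) * ((conjc g1 + d1 * z) * p) by ring.
  by rewrite h; ring.
move: (rel2 _ ucH); rewrite F2 (evQ (- conjc g1) (1 - d1) z z1) (evQ (- conjc g1) (1 - d1) (- z) nz1).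
move: (ev c z) (ev c (- z)) => p q h.
have -> : ((1 - d1) * z - conjc g1) * p * (conjc b + conjc a * z) =
  (conjc b + conjc a * z) * ((- conjc g1 + (1 - d1) * z) * p) by ring.
by rewrite h; ring.
Qed.

End Reducing.

(** * Parity of the characteristic function from the reducing equations *)

Section ParityAnalysis.
Variable R : realType.
Implicit Types (x c : cseq R) (z : R[i]).

Lemma ev_parity B c (s : R[i]) (d : R) : coef_bound B c -> 0 < d ->
  (forall z, in_disc z -> z != 0 -> normc z < d -> ev c z = s * ev c (- z)) ->
  forall n, c n = s * ((-1) ^+ n * c n).
Proof.
move=> cB d0 H n; pose y : cseq R := fun n => (-1) ^+ n * c n.
have yB : coef_bound B y.
  by move=> k; rewrite /y normcMM normcX normcN normc11 expr1n mul1r.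
have m0 : 0 < Num.min d 1 by rewrite lt_min d0 ltr01.
have := ev_eq0 (coef_bound_lin (- s) yB cB) m0 _ n; rewrite mulNr addrC => h.
apply/eqP; rewrite -subr_eq0; apply/eqP; apply: h => z z0.
rewrite lt_min => /andP[zd z1].
by rewrite (ev_lin (- s) yB cB z1) -ev_opp (H z z1 z0 zd) mulNr addNr.
Qed.

Lemma ev_parity_disc c (s z : R[i]) : (forall n, c n = s * ((-1) ^+ n * c n)) ->
  abs_summable (fun n => ((-1) ^+ n * c n) * z ^+ n) ->
  ev c z = s * ev c (- z).
Proof.
move=> cs su; rewrite ev_opp /ev -(csumZ s su); congr (limn (series _)).
by apply/funext => n; rewrite [in LHS]cs -!mulrA.
Qed.

(** Near 0 the relation determines the coefficients, and these carry it to the whole disc; so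
    cancellations may be confined to a small punctured disc. *)
Lemma ev_parity_near B c (s : R[i]) (d : R) : coef_bound B c -> 0 < d ->
  (forall z, in_disc z -> z != 0 -> normc z < d -> ev c z = s * ev c (- z)) ->
  forall z, in_disc z -> ev c z = s * ev c (- z).
Proof.
move=> cB d0 H z z1; apply: ev_parity_disc (ev_parity cB d0 H) _.
apply: (@ev_summable R B (fun n => (-1) ^+ n * c n)) => //.
by move=> k; rewrite normcMM normcX normcN normc11 expr1n mul1r.
Qed.

Lemma small_point (e : R) : 0 < e -> exists2 z : R[i], z != 0 & normc z < e /\ normc (z + z) < e.
Proof.
move=> e0; exists (e / 4)%:C; first by rewrite RtoC_eq0 gt_eqF// divr_gt0.
by rewrite -RtoCD !normc_real !gtr0_norm ?addr_gt0 ?divr_gt0//; split; lra.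
Qed.

(** The values at z and 2 z differ by 3 z^2 P1. *)
Lemma quadratic_zero (P0 P1 : R[i]) (e : R) : 0 < e ->
  (forall z, z != 0 -> normc z < e -> P0 + z ^+ 2 * P1 = 0) -> P0 = 0 /\ P1 = 0.
Proof.
move=> e0 H; have [z z0 [h1 h2]] := small_point e0.
have zz0 : z + z != 0 by rewrite -mulr2n mulrn_eq0.
have e1 := H z z0 h1; have e2 := H _ zz0 h2.
have P10 : P1 = 0.
  have : 3 * z ^+ 2 * P1 = 0.
    have -> : 3 * z ^+ 2 * P1 = (P0 + (z + z) ^+ 2 * P1) - (P0 + z ^+ 2 * P1) by ring.
    by rewrite e1 e2 subrr.
  by move=> /eqP; rewrite !mulf_eq0 (negbTE z0) pnatr_eq0 /= => /eqP.
by split => //; move: e1; rewrite P10 mulr0 addr0.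
Qed.

Lemma linear_zero (P0 P1 : R[i]) (e : R) : 0 < e ->
  (forall z, z != 0 -> normc z < e -> P0 + z * P1 = 0) -> P0 = 0 /\ P1 = 0.
Proof.
move=> e0 H; have [z z0 [h1 h2]] := small_point e0.
have zz0 : z + z != 0 by rewrite -mulr2n mulrn_eq0.
have e1 := H z z0 h1; have e2 := H _ zz0 h2.
have P10 : P1 = 0.
  have : z * P1 = 0.
    have -> : z * P1 = (P0 + (z + z) * P1) - (P0 + z * P1) by ring.
    by rewrite e1 e2 subrr.
  by move=> /eqP; rewrite mulf_eq0 (negbTE z0) /= => /eqP.
by split => //; move: e1; rewrite P10 mulr0 addr0.
Qed.

(** Eliminates p = F(z) and q = F(-z) from two relations, leaving an identity between polynomials in
    z. *)
Lemma cross_cancel (p q L1 L2 R1 R2 : R[i]) : p != 0 -> q != 0 ->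
  L1 * p = R1 * q -> L2 * p = R2 * q -> L1 * R2 = R1 * L2.
Proof.
move=> p0 q0 h1 h2; apply: (mulIf (mulf_neq0 p0 q0)).
have -> : L1 * R2 * (p * q) = (L1 * p) * (R2 * q) by ring.
by rewrite h1 -h2; ring.
Qed.

Variables (c : cseq R) (B0 : R) (n0 : nat).
Hypotheses (cB : coef_bound B0 c) (c0 : c n0 != 0).
Variables (a b : R[i]).
Local Notation A := (conjc a).
Local Notation B := (conjc b).
Hypothesis ab1 : a * A + b * B = 1.
Local Notation F := (ev c).

Let near_nz : exists e : R, [/\ 0 < e, e <= 1 &
  forall z, z != 0 -> normc z < e -> F z != 0 /\ F (- z) != 0].
Proof.
have [d [d0 d1 H]] := ev_isolated cB c0; exists d; split => // z z0 zd; split; first exact: H.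
by apply: H; rewrite ?oppr_eq0// normcN.
Qed.

Let ab_nz : ~ (a = 0 /\ b = 0).
Proof.
by move=> [a0 b0]; move: ab1; rewrite a0 b0 !mul0r addr0 => /eqP; rewrite eq_sym oner_eq0.
Qed.

(** In the third case F divided by a Blaschke factor is even: its zero is B / A if |b| < |a|, and -
    a / b if |a| < |b|. *)
Definition symmetric_or_exceptional :=
  [\/ forall z, in_disc z -> F z = F (- z), forall z, in_disc z -> F z = - F (- z) |
   [/\ a != 0, b != 0, a * A != b * B & forall z, in_disc z ->
     F z * (B + A * z) * (a - b * z) = F (- z) * (B - A * z) * (a + b * z)]].

(** Eliminating F gives a B + z^2 b A = 0, so a or b vanishes; the first relation then states that F
    is even or odd. *)
Lemma parity_of_relations (s : R[i]) (e : R) : s = 1 \/ s = -1 -> 0 < e -> e <= 1 ->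
  (forall z, z != 0 -> normc z < e -> F z != 0 /\ F (- z) != 0) ->
  (forall z, z != 0 -> normc z < e -> F z * (a - b * z) = s * F (- z) * (a + b * z)) ->
  (forall z, z != 0 -> normc z < e -> F z * (B + A * z) = - s * F (- z) * (B - A * z)) ->
  symmetric_or_exceptional.
Proof.
move=> s1 e0 e1 nz H1 H2.
have s0 : s != 0 by case: s1 => ->; rewrite ?oppr_eq0 oner_eq0.
have fin (t : R[i]) : t = 1 \/ t = -1 ->
    (forall z, z != 0 -> normc z < e -> F z = t * F (- z)) -> symmetric_or_exceptional.
  move=> t1 Ht; have := @ev_parity_near B0 c t e cB e0 (fun z _ => Ht z).
  case: t1 => -> h; [apply: Or31|apply: Or32] => z z1; rewrite {1}(h z z1).
    by rewrite mul1r.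
  by rewrite mulN1r.
have [aB _] : a * B = 0 /\ b * A = 0.
  apply: (quadratic_zero e0) => z z0 ze; have [p0 q0] := nz _ z0 ze.
  have r1 : (a - b * z) * F z = (s * (a + b * z)) * F (- z).
    by rewrite mulrC H1//; ring.
  have r2 : (B + A * z) * F z = (- s * (B - A * z)) * F (- z).
    by rewrite mulrC H2//; ring.
  have := cross_cancel p0 q0 r1 r2 => E.
  have : 2 * s * (a * B + z ^+ 2 * (b * A)) = 0.
    have -> : 2 * s * (a * B + z ^+ 2 * (b * A)) =
      (s * (a + b * z)) * (B + A * z) - (a - b * z) * (- s * (B - A * z)) by ring.
    by rewrite E subrr.
  by move=> /eqP; rewrite !mulf_eq0 pnatr_eq0 (negbTE s0) /= => /eqP.
move/eqP: aB; rewrite mulf_eq0 conjc_eq0 => /orP[] /eqP z0.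
  have b0 : b != 0 by apply/eqP => b0; exact: ab_nz.
  apply: (fin (- s)); first by case: s1 => ->; rewrite ?opprK; [right|left].
  move=> z zz ze; have := H1 z zz ze; rewrite z0 sub0r add0r => h.
  apply: (mulIf (mulf_neq0 b0 zz)); apply: oppr_inj; rewrite -mulrN h; ring.
have a0 : a != 0 by apply/eqP => a0; exact: ab_nz.
apply: (fin s) => // z zz ze; have := H1 z zz ze; rewrite z0 mul0r subr0 addr0.
exact: (mulIf a0).
Qed.

Variables (g0 g1 d1 : R[i]).
Hypothesis eqs : reducing_equations c a b g0 g1 d1.

Lemma reducing_parity : symmetric_or_exceptional.
Proof.
have [e [e0 e1 nz]] := near_nz.
have disc z : normc z < e -> in_disc z by move=> h; exact: lt_le_trans e1.
(* The first two equations after elimination of F: an odd polynomial in z, divided by 2 z. *)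
have [P0 P1] : g1 * (a * B) - g0 * (1 - g0) = 0 /\ g1 * (b * A) - g1 ^+ 2 = 0.
  apply: (quadratic_zero e0) => z z0 ze; have [p0 q0] := nz _ z0 ze.
  have [h1 h2 _ _] := eqs (disc _ ze).
  have r1 : ((g0 + g1 * z) * (a - b * z)) * F z = ((g0 - g1 * z) * (a + b * z)) * F (- z).
    by rewrite mulrAC h1; ring.
  have r2 : ((1 - g0 - g1 * z) * (B + A * z)) * F z =
      ((1 - g0 + g1 * z) * (B - A * z)) * F (- z) by rewrite mulrAC h2; ring.
  have E := cross_cancel p0 q0 r1 r2.
  have : 2 * z * ((g1 * (a * B) - g0 * (1 - g0)) + z ^+ 2 * (g1 * (b * A) - g1 ^+ 2)) = 0.
    (* Inserting a A + b B for 1 turns the claim into an identity that [ring] can decide. *)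
    have -> : 2 * z * ((g1 * (a * B) - g0 * (1 - g0)) + z ^+ 2 * (g1 * (b * A) - g1 ^+ 2)) =
      2 * z * ((g1 * (a * B) - g0 * (1 - g0) * (a * A + b * B)) +
        z ^+ 2 * (g1 * (b * A) - g1 ^+ 2 * (a * A + b * B))) by rewrite ab1 !mulr1.
    have -> : 2 * z * ((g1 * (a * B) - g0 * (1 - g0) * (a * A + b * B)) +
        z ^+ 2 * (g1 * (b * A) - g1 ^+ 2 * (a * A + b * B))) =
      (g0 + g1 * z) * (a - b * z) * ((1 - g0 + g1 * z) * (B - A * z)) -
      (g0 - g1 * z) * (a + b * z) * ((1 - g0 - g1 * z) * (B + A * z)) by ring.
    by rewrite E subrr.
  by move=> /eqP; rewrite mulf_eq0 mulf_eq0 pnatr_eq0 (negbTE z0) /= => /eqP.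
have [g10|g1n] := eqVneq g1 0.
  move/eqP: P0; rewrite g10 mul0r sub0r oppr_eq0 mulf_eq0 subr_eq0 => /orP[] /eqP g0E.
    have H2 z : z != 0 -> normc z < e -> F z * (B + A * z) = F (- z) * (B - A * z).
      move=> z0 ze; have [_ h2 _ _] := eqs (disc _ ze).
      by move: h2; rewrite g10 g0E !mul0r !subr0 addr0 !mul1r.
    (* With g0 = g1 = 0 the last equation makes (1 - d1) F (B + A z) odd, while [H2] makes F (B + A
       z) even. So d1 <> 1 would force A = B = 0. *)
    have [d1E|d1n] := eqVneq d1 1.
      apply: (@parity_of_relations (-1) e) => //; first by right.
        move=> z z0 ze; have [_ _ h3 _] := eqs (disc _ ze).
        apply: (mulfI z0); move: h3; rewrite g10 conjc0 d1E add0r sub0r mul1r.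
        by move=> h; rewrite mulrA h; ring.
      by move=> z z0 ze; rewrite H2// opprK mul1r.
    case: ab_nz; have [BE AE] : B = 0 /\ A = 0.
      apply: (linear_zero e0) => z z0 ze; have [p0 q0] := nz _ z0 ze.
      have [_ _ _ h4] := eqs (disc _ ze); have h2 := H2 z z0 ze.
      have dz : (1 - d1) * z != 0 by rewrite mulf_neq0// subr_eq0 eq_sym.
      have : 2 * ((1 - d1) * z) * F z * (B + z * A) = 0.
        move: h4; rewrite g10 conjc0 !subr0 => h4.
        have -> : 2 * ((1 - d1) * z) * F z * (B + z * A) =
          (1 - d1) * z * F z * (B + A * z) + (1 - d1) * z * (F z * (B + A * z)) by ring.
        by rewrite h4 h2; ring.
      move/eqP; rewrite mulf_eq0 mulf_eq0 mulf_eq0 (negbTE dz) pnatr_eq0 (negbTE p0) /=.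
      by move/eqP.
    by move/eqP: BE; move/eqP: AE; rewrite !conjc_eq0 => /eqP-> /eqP->.
  have {}g0E : g0 = 1 by [].
  have H1 z : z != 0 -> normc z < e -> F z * (a - b * z) = F (- z) * (a + b * z).
    move=> z0 ze; have [h1 _ _ _] := eqs (disc _ ze).
    by move: h1; rewrite g10 g0E !mul0r !subr0 addr0 !mul1r.
  have [d1E|d1n] := eqVneq d1 0.
    apply: (@parity_of_relations 1 e) => //; first by left.
      by move=> z z0 ze; rewrite H1// mul1r.
    move=> z z0 ze; have [_ _ _ h4] := eqs (disc _ ze).
    apply: (mulfI z0); move: h4; rewrite g10 conjc0 d1E !subr0 mul1r.
    by move=> h; rewrite mulrA h; ring.
  case: ab_nz; have [aE bE] : a = 0 /\ - b = 0.
    apply: (linear_zero e0) => z z0 ze; have [p0 q0] := nz _ z0 ze.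
    have [_ _ h3 _] := eqs (disc _ ze); have h1 := H1 z z0 ze.
    have dz : d1 * z != 0 by rewrite mulf_neq0.
    have : 2 * (d1 * z) * F z * (a + z * - b) = 0.
      move: h3; rewrite g10 conjc0 add0r sub0r => h3.
      have -> : 2 * (d1 * z) * F z * (a + z * - b) =
        d1 * z * F z * (a - b * z) + d1 * z * (F z * (a - b * z)) by ring.
      by rewrite h3 h1; ring.
    move/eqP; rewrite mulf_eq0 mulf_eq0 mulf_eq0 (negbTE dz) pnatr_eq0 (negbTE p0) /=.
    by move/eqP.
  by split => //; apply/eqP; rewrite -oppr_eq0 bE.
have g1E : g1 = b * A.
  by apply/esym/eqP; rewrite -subr_eq0; apply/eqP; apply: (mulfI g1n); rewrite mulr0 mulrBr -expr2.
have bn : b != 0 by apply: contra g1n => /eqP b0; rewrite g1E b0 mul0r.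
have An : A != 0 by apply: contra g1n => /eqP A0; rewrite g1E A0 mulr0.
have an : a != 0 by rewrite -conjc_eq0.
(* With g1 = b A, [P0] is a quadratic equation for g0 whose roots have sum 1 = a A + b B and product
   (a A) (b B). *)
have : (g0 - a * A) * (g0 - b * B) = 0.
  have -> : (g0 - a * A) * (g0 - b * B) =
    (b * A) * (a * B) - g0 * ((a * A + b * B) - g0) by ring.
  by rewrite ab1 -g1E P0.
(* Here g0 + g1 z = A (a + b z), so the first equation says that F is even wherever a + b z and a -
   b z can be cancelled. As |b| <= 1, the disc |z| < |a| is small enough for that. *)
have [g0E _|g0n /eqP] := eqVneq g0 (a * A).
  have na : 0 < normc a by rewrite normc_gt0.
  have nb : normc b <= 1.
    have E : normc a ^+ 2 + normc b ^+ 2 = 1.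
      by apply: RtoC_inj; rewrite RtoCD -!mulcJ.
    rewrite -ler_sqr ?nnegrE ?normc_ge0// expr1n -E lerDr; exact: sqr_ge0.
  have m0 : 0 < Num.min e (normc a) by rewrite lt_min e0.
  apply: Or31 => z z1.
  have := @ev_parity_near B0 c 1 _ cB m0 _ z z1; rewrite mul1r; apply.
  move=> w w1 w0; rewrite lt_min mul1r => /andP[we wa].
  have [h1 _ _ _] := eqs (disc _ we).
  have nw : normc (b * w) < normc a.
    rewrite normcMM; apply: le_lt_trans wa; rewrite -[leRHS]mul1r.
    by rewrite ler_wpM2r ?normc_ge0.
  have n1 : a + b * w != 0.
    apply/eqP => /eqP; rewrite addr_eq0 => /eqP E.
    by move: nw; rewrite E normcN ltxx.
  have n2 : a - b * w != 0.
    apply/eqP => /eqP; rewrite subr_eq0 => /eqP E.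
    by move: nw; rewrite E ltxx.
  apply: (mulfI (mulf_neq0 An (mulf_neq0 n1 n2))).
  have -> : A * ((a + b * w) * (a - b * w)) * F w =
    (a * A + b * A * w) * F w * (a - b * w) by ring.
  by rewrite -g0E -g1E h1 g0E g1E; ring.
rewrite mulf_eq0 !subr_eq0 (negbTE g0n) /= => /eqP g0E.
(* Now g0 + g1 z = b (B + A z), and the first equation divided by b is the exceptional relation. *)
apply: Or33; split => //; first by rewrite -g0E eq_sym.
move=> z z1; have [h1 _ _ _] := eqs z1.
apply: (mulfI bn).
have -> : b * (F z * (B + A * z) * (a - b * z)) = (b * B + b * A * z) * F z * (a - b * z) by ring.
by rewrite -g0E -g1E h1 g0E g1E; ring.
Qed.

End ParityAnalysis.

(** * Contradictions with condition (B) *)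

Section Exceptional.
Variables (R : realType) (m : R[i] -> R[i]).
Hypothesis mB : forall lam0, in_disc lam0 -> m lam0 = 0 ->
     exists lam, in_disc lam /\ lam <> lam0 /\ - lam <> lam0 /\
       m lam / blaschke lam0 lam <> m (- lam) / blaschke lam0 (- lam).

Lemma conjc_div (x y : R[i]) : conjc (x / y) = conjc x / conjc y.
Proof. by rewrite rmorphM /= conjc_inv. Qed.

(** An odd m vanishes at 0, where the Blaschke factor is z itself, and the quotient of two odd
    functions is even. *)
Lemma not_odd : ~ (forall z, in_disc z -> m z = - m (- z)).
Proof.
move=> H.
have d0 : in_disc (0 : R[i]) by rewrite /in_disc normc00.
have m0 : m 0 = 0.
  have := H 0 d0; rewrite oppr0 => /eqP; rewrite -addr_eq0 -mulr2n mulrn_eq0 /=.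
  by move/eqP.
have [l [l1 [l0 [nl0]]]] := mB d0 m0; apply.
rewrite /blaschke conjc0 !mul0r !subr0 !divr1 (H l l1).
by rewrite invrN mulrN mulNr.
Qed.

(** The zeros B / A of B - A z and - a / b of a + b z are related by l -> - 1 / conj l, so exactly
    one lies in the disc as |a| <> |b|. The relation forces m to vanish there, and the Blaschke
    factor of that point is, up to a constant, (A z - B) / (a - b z), respectively (a + b z) / (B +
    A z); the relation thus says that the quotient is even. *)
Lemma not_exceptional (a b : R[i]) : a != 0 -> b != 0 ->
  a * conjc a != b * conjc b -> ~ (forall z, in_disc z ->
  m z * (conjc b + conjc a * z) * (a - b * z) =
  m (- z) * (conjc b - conjc a * z) * (a + b * z)).
Proof.
move=> an bn abn H.
have An : conjc a != 0 by rewrite conjc_eq0.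
have Bn : conjc b != 0 by rewrite conjc_eq0.
have na : 0 < normc a by rewrite normc_gt0.
have nb : 0 < normc b by rewrite normc_gt0.
have [ab|ab|ab] := ltgtP (normc a) (normc b); last first.
- by move: abn; rewrite !mulcJ ab eqxx.
- pose l0 := conjc b / conjc a.
  have l0d : in_disc l0 by rewrite /in_disc /l0 normcMM normcVV !normcJ_eq ltr_pdivrMr// mul1r.
  have ml0 : m l0 = 0.
    have := H l0 l0d.
    have -> : conjc b - conjc a * l0 = 0 by rewrite /l0; field.
    rewrite mulr0 mul0r => /eqP; rewrite !mulf_eq0 => /orP[/orP[/eqP//|]|].
      rewrite /l0 mulrC divfK// -mulr2n mulrn_eq0 /= => h.
      by rewrite h in Bn.
    rewrite /l0 => /eqP h; move: abn.
    have -> : a * conjc a = b * conjc b + (a - b * (conjc b / conjc a)) * conjc a by field.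
    by rewrite h mul0r addr0 eqxx.
  have [l [l1 [ll0 [nll0]]]] := mB l0d ml0; apply.
  have h := H l l1.
  have n1 : conjc a * l - conjc b != 0.
    apply/eqP => /eqP; rewrite subr_eq0 => /eqP E; apply: ll0.
    by rewrite /l0 -E; field.
  have n2 : conjc b + conjc a * l != 0.
    apply/eqP => /eqP; rewrite addr_eq0 => /eqP E; apply: nll0.
    by rewrite /l0 E; field.
  rewrite /blaschke /l0 conjc_div !conjcK !invf_div.
  have -> : m l * ((1 - b / a * l) / (l - conjc b / conjc a)) =
    m l * (conjc b + conjc a * l) * (a - b * l) * (conjc a / a /
      ((conjc a * l - conjc b) * (conjc b + conjc a * l))).
    by field; rewrite an An n1 n2 /=.
  have n3 : - l * conjc a - conjc b != 0.
    have -> : - l * conjc a - conjc b = - (conjc b + conjc a * l) by ring.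
    by rewrite oppr_eq0.
  by rewrite h; field; repeat (apply/andP; split => //).
pose l0 := - (a / b).
have l0d : in_disc l0 by rewrite /in_disc /l0 normcN normcMM normcVV ltr_pdivrMr// mul1r.
have ml0 : m l0 = 0.
  have := H l0 l0d.
  have -> : a + b * l0 = 0 by rewrite /l0; field.
  rewrite mulr0 => /eqP; rewrite !mulf_eq0 => /orP[/orP[/eqP//|]|].
    rewrite /l0 => /eqP h; move: abn.
    have -> : b * conjc b = a * conjc a + (conjc b + conjc a * - (a / b)) * b by field.
    by rewrite h mul0r addr0 eqxx.
  rewrite /l0 mulrN opprK mulrC divfK// -mulr2n mulrn_eq0 /= => h.
  by rewrite h in an.
have [l [l1 [ll0 [nll0]]]] := mB l0d ml0; apply.
have h := H l l1.
have n1 : a + b * l != 0.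
  apply/eqP => /eqP; rewrite addr_eq0 => /eqP E; apply: ll0.
  by rewrite /l0 E; field.
have n2 : a - b * l != 0.
  apply/eqP => /eqP; rewrite subr_eq0 => /eqP E; apply: nll0.
  by rewrite /l0 E; field.
have cl : conjc (- (a / b)) = - (conjc a / conjc b).
  by rewrite -conjc_div; exact: (rmorphN (@conjc R)).
rewrite /blaschke /l0 cl !invf_div.
have -> : m l * ((1 - - (conjc a / conjc b) * l) / (l - - (a / b))) =
  m l * (conjc b + conjc a * l) * (a - b * l) * (b / conjc b / ((a + b * l) * (a - b * l))).
  by field; rewrite bn Bn n1 n2 /=.
have n3 : - l * b - - a != 0.
  by have -> : - l * b - - a = a - b * l by ring.
by rewrite h; field; repeat (apply/andP; split => //).
Qed.

End Exceptional.

(** * Model spaces of divisors *)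

Section InnerDivisor.
Variable R : realType.

(** Since m a = p (q a) with q a again in [H2], the range of multiplication by m is contained in
    that of p. *)
Lemma model_space_divisor (m p q : R[i] -> R[i]) : Hinf q ->
  (forall z, in_disc z -> m z = p z * q z) -> model_space p `<=` model_space m.
Proof.
move=> [dq [M qM]] mpq x [xH xp]; split => // y [yH [a [aH ya]]].
have [c [cB qc]] := taylor_expansion dq qM.
apply: xp; split => //; exists (mulc c a).
have [mH _] := mulc_H2 dq qM cB qc aH; split => // z z1.
by rewrite ya// mpq// (mulc_ev dq qM cB qc aH z1) mulrA.
Qed.

End InnerDivisor.

Theorem theorem3 (R : realType) (m : R[i] -> R[i]) (T : cseq R -> cseq R) :
  inner_fun m ->
  dim_ge2 (model_space m) ->
  (forall x, model_space m x -> is_proj (model_space m) (ushift x) (T x)) ->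
  (* (A) *)
  (exists lam, in_disc lam /\ m lam <> m (- lam)) ->
  (* (B) *)
  (forall lam0, in_disc lam0 -> m lam0 = 0 ->
     exists lam, in_disc lam /\ lam <> lam0 /\ - lam <> lam0 /\
       m lam / blaschke lam0 lam <> m (- lam) / blaschke lam0 (- lam)) ->
  (* (C) *)
  (exists p : R[i] -> R[i],
     inner_fun p /\
     ~ (exists c, forall z, in_disc z -> p z = c) /\
     (exists q, Hinf q /\ forall z, in_disc z -> m z = p z * q z) /\
     (forall z, in_disc z -> p z = p (- z))) ->
  (* (D) and (E) *)
  op_irreducible (model_space m) (fun x => T (T x)) /\
  Lat (model_space m) (fun x => T (T x)) <> Lat' (model_space m) (fun x => T (T x)).
Proof.
move=> [[dm [M mM]] mrad] _ TP mA mB [p [[[dp [Mp pM]] prad] [pn [[q [qI mpq]] pev]]]].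
have [c [cB mc]] := taylor_expansion dm mM.
have cH := coef_H2 dm mM cB mc.
have HE : model_space m = coinv c.
  by apply/seteqP; split => x /(model_spaceP dm mM cB mc).
have c1 : nrm2 c = 1 := inner_nrm2_shift dm mM cB mc mrad 0.
have c_unit : ip c c = 1 by rewrite ip_self// c1.
have c_orth k : ip c (iter k.+1 (@ushift R) c) = 0.
  exact: (inner_orth dm mM cB mc mrad).
have [n0 cn0] : exists n, c n != 0.
  apply: contrapT => /forallNP c0; have cz : c = @zero_seq R.
    by apply/funext => n; apply/eqP/negPn/negP => h; apply: (c0 n).
  move: c_unit; rewrite {1}cz ip0l => /eqP.
  by rewrite eq_sym oner_eq0.
rewrite HE in TP *; split.
  move=> K Kcl Kinv Kadj.
  have [|[]|] := reducing_trichotomy cH c_unit c_orth TP Kcl Kinv Kadj; [by left|by right|].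
  move=> [a [b [g0 [g1 [d1 [ab1 eqs]]]]]]; exfalso.
  have ez z : in_disc z -> in_disc (- z) by rewrite /in_disc normcN.
  have [ev|od|[an bn abn ex]] := reducing_parity cB cn0 ab1 eqs.
  - by have [l [l1]] := mA; apply; rewrite !mc//; [exact: ev|exact: ez].
  - by apply: (not_odd mB) => z z1; rewrite !mc//; [exact: od|exact: ez].
  - apply: (not_exceptional mB an bn abn) => z z1; rewrite !mc//; [exact: ex|exact: ez].
have [d [dB pd]] := taylor_expansion dp pM.
have dH := coef_H2 dp pM dB pd.
apply: (odd_shift_lat cH TP dH).
(* S* p is orthogonal to z^k p because p is orthogonal to z^(k+1) p. *)
- rewrite -HE; apply: (model_space_divisor qI mpq); apply/(model_spaceP dp pM dB pd).
  split=> [|k]; first exact: bshift_H2.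
  rewrite (ip_bshift dH (@iter_H2 R d k dH)).
  exact: (inner_orth dp pM dB pd prad (ltn0Sn k)).
- have dev : forall n, d n = 1 * ((-1) ^+ n * d n).
    apply: (ev_parity dB ltr01) => z z1 _ _; rewrite mul1r -!pd//; first exact: pev.
    by rewrite /in_disc normcN.
  move=> n on; have := dev n; rewrite mul1r -signr_odd on expr1 mulN1r => /eqP.
  by rewrite -addr_eq0 -mulr2n mulrn_eq0 => /eqP.
move=> d0; apply: pn; exists (d 0%N) => z z1.
have bz : bshift d = @zero_seq R by apply/funext.
by rewrite pd// (evS dB z1) bz ev_zero mulr0 addr0.
Qed.
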